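(* Let $\alpha\in(0,1)$ and $\theta>-\alpha$, and let $n\ge 1$ and $1\le k\le n$ be fixed integers. Under the $(\alpha,\theta)$ Poisson-Dirichlet partition model, conditionally on $K_n=k$, the sequence $K_m^{(n)}/m^{\alpha}$ converges almost surely, as $m\to\infty$, to a random variable $Z_{n,k}^{\alpha,\theta}$ whose distribution has density, for $z>0$, $$ f_{\alpha,\theta}^{n,k}(z)=\frac{\Gamma(\theta+n)}{\Gamma(\theta/\alpha+k)\,\Gamma(n-k\alpha)\,\alpha}\;z^{\theta/\alpha+k-1}\int_z^\infty\big(1-(z/v)^{1/\alpha}\big)^{n-k\alpha-1}f_\alpha(v^{-1/\alpha})\,v^{-1/\alpha-1}\,dv, $$ where $f_\alpha$ is the density of the positive $\alpha$-stable random variable.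
   Context: Notation: $(a)_b=a(a+1)\cdots(a+b-1)$ denotes the rising factorial, with $(a)_0=1$, and $(x)_{s\uparrow\alpha}=x(x+\alpha)(x+2\alpha)\cdots(x+(s-1)\alpha)$ denotes the generalized rising factorial, with $(x)_{0\uparrow\alpha}=1$. The $(\alpha,\theta)$ Poisson-Dirichlet partition model is the exchangeable random partition of $\mathbb{N}$, with law denoted $\mathbb{P}_{\alpha,\theta}$, such that for every $n\ge1$ and every partition of $\{1,\dots,n\}$ into $k$ blocks of sizes $n_1,\dots,n_k$, the probability that the restriction of the random partition to $\{1,\dots,n\}$ equals that partition is $$ p(n_1,\dots,n_k)=\frac{(\theta+\alpha)_{k-1\uparrow\alpha}}{(\theta+1)_{n-1}}\prod_{j=1}^k(1-\alpha)_{n_j-1}. $$ The integers represent successive observations $X_1,X_2,\dots$ and the blocks represent species. $K_n$ is the number of blocks of the restriction to $\{1,\dots,n\}$, i.e. the number of distinct species among $X_1,\dots,X_n$. $K_m^{(n)}=K_{n+m}-K_n$ is the number of new species (not represented among $X_1,\dots,X_n$) that appear in the additional sample $X_{n+1},\dots,X_{n+m}$. Convergence almost surely conditionally on $K_n=k$ means almost surely with respect to $\mathbb{P}_{\alpha,\theta}(\,\cdot\mid K_n=k)$. The positive $\alpha$-stable density $f_\alpha$ on $(0,\infty)$ is the one with Laplace transform $\int_0^\infty e^{-\lambda x}f_\alpha(x)\,dx=e^{-\lambda^\alpha}$, $\lambda\ge0$. *)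

(* Defs.v *)
From HB Require Import structures.
From mathcomp Require Import all_boot all_order all_algebra all_fingroup.
From mathcomp Require Import all_classical all_reals all_analysis.

Set Implicit Arguments.
Unset Strict Implicit.
Unset Printing Implicit Defensive.

Import Order.TTheory GRing.Theory Num.Theory.
Import numFieldNormedType.Exports.

Local Open Scope classical_set_scope.
Local Open Scope ring_scope.

Definition rising {R : pzSemiRingType} (a : R) (b : nat) : R :=
  \prod_(i < b) (a + i%:R).

Definition gen_rising {R : pzSemiRingType} (x : R) (s : nat) (alpha : R) : R :=
  \prod_(i < s) (x + i%:R * alpha).

(* Meaningful for x > 0 only, where the integral converges. *)
Definition Gamma {R : realType} (x : R) : R :=
  \int[lebesgue_measure]_(t in `]0%R, +oo[) (t `^ (x - 1) * expR (- t)).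

(* A random partition of the positive integers, given as a random equivalence
   relation. Observation X_{i+1} has index i : nat, and rand_rel w i j says
   that X_{i+1} and X_{j+1} belong to the same species. *)
Record random_partition d (T : measurableType d) := RandomPartition {
  rand_rel :> T -> rel nat ;
  rand_rel_equiv : forall w, equivalence_rel (rand_rel w) ;
  rand_rel_measurable : forall i j, measurable [set w | rand_rel w i j]
}.

Section random_partition.
Context d (T : measurableType d) (Pi : random_partition T).

(* The restriction to {1, ..., n}, which is indexed by 'I_n. *)
Definition restriction (n : nat) (w : T) : {set {set 'I_n}} :=
  equivalence_partition (fun i j : 'I_n => Pi w i j) [set: 'I_n]%SET.

Definition num_blocks (n : nat) (w : T) : nat := #|restriction n w|.

Definition num_new_blocks {R : pzRingType} (n m : nat) (w : T) : R :=
  (num_blocks (n + m) w)%:R - (num_blocks n w)%:R.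

Lemma measurable_num_blocks n k : measurable [set w | num_blocks n w = k].
Proof.
pose g w := [ffun p : 'I_n * 'I_n => Pi w p.1 p.2].
have mg (h : {ffun 'I_n * 'I_n -> bool}) : measurable [set w | g w = h].
  have -> : [set w | g w = h] =
      \bigcap_(p in [set: 'I_n * 'I_n]) [set w | Pi w p.1 p.2 = h p].
    apply/seteqP; split=> w /=.
      by move=> <- p _; rewrite ffunE.
    by move=> H; apply/ffunP => p; rewrite ffunE; exact: H.
  apply: fin_bigcap_measurable; first exact: finite_finset.
  move=> p _; case: (h p); first exact: rand_rel_measurable.
  rewrite (_ : [set w | _] = ~` [set w | Pi w p.1 p.2]).
    by apply: measurableC; exact: rand_rel_measurable.
  by apply/seteqP; split=> w /=; [move=> ->|move/negP/negbTE].
pose c (h : {ffun 'I_n * 'I_n -> bool}) : nat :=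
  #|equivalence_partition (fun i j => h (i, j)) [set: 'I_n]%SET|.
have cE w : num_blocks n w = c (g w).
  rewrite /num_blocks /restriction /c; congr (#|pred_of_set _|).
  apply: eq_imset => i; apply/setP => j.
  by rewrite !inE /g ffunE.
have -> : [set w | num_blocks n w = k] =
    \bigcup_(h in [set h | c h = k]) [set w | g w = h].
  apply/seteqP; split=> w /=.
    by rewrite cE => H; exists (g w).
  by move=> [h <- /= <-]; rewrite cE.
apply: fin_bigcup_measurable; first exact: finite_finset.
by move=> h _; exact: mg.
Qed.

End random_partition.

(* The probability of a given partition Q of {1, ..., n}; it depends on the
   block sizes alone. *)
Definition PD_eppf {R : realType} (alpha theta : R) (n : nat)
    (Q : {set {set 'I_n}}) : R :=
  gen_rising (theta + alpha) (#|Q| - 1) alpha / rising (theta + 1) (n - 1) *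
  \prod_(B in Q) rising (1 - alpha) (#|B| - 1).

(* Exchangeability is automatic, see PD_exchangeable below. *)
Definition poisson_dirichlet d (T : measurableType d) (R : realType)
    (P : probability T R) (alpha theta : R) (Pi : random_partition T) : Prop :=
  forall (n : nat) (Q : {set {set 'I_n}}),
    (0 < n)%N -> finset.partition Q [set: 'I_n]%SET ->
    P [set w | restriction Pi n w = Q] = (PD_eppf alpha theta Q)%:E.

Lemma PD_exchangeable d (T : measurableType d) (R : realType)
    (P : probability T R) (alpha theta : R) (Pi : random_partition T)
    (n : nat) (s : {perm 'I_n}) (Q : {set {set 'I_n}}) :
  poisson_dirichlet P alpha theta Pi ->
  (0 < n)%N -> finset.partition Q [set: 'I_n]%SET ->
  P [set w | restriction Pi n w = [set s @: B | B : {set 'I_n} in Q]%SET] =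
  P [set w | restriction Pi n w = Q].
Proof.
move=> PD n0 pQ.
have inj_im : injective (fun B : {set 'I_n} => (s @: B)%SET).
  exact/imset_inj/perm_inj.
have sT : (s @: [set: 'I_n] = [set: 'I_n])%SET.
  apply/setP => x; rewrite inE; apply/imsetP; exists ((s^-1)%g x) => //.
  by rewrite permKV.
rewrite !PD//; last first.
  rewrite -sT; case/and3P: pQ => /eqP cQ tQ Q0; apply/and3P; split.
  - rewrite -cQ; apply/eqP; rewrite /finset.cover.
    rewrite big_imset /=; last by move=> ? ? _ _; exact: inj_im.
    apply/setP => x; apply/finset.bigcupP/imsetP.
      by move=> [B BQ /imsetP[y yB ->]]; exists y => //; apply/finset.bigcupP; exists B.
    move=> [y /finset.bigcupP[B BQ yB] ->]; exists B => //; exact: imset_f.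
  - apply/finset.trivIsetP => _ _ /imsetP[A AQ ->] /imsetP[B BQ ->] AB.
    rewrite imset_disjoint; last exact: perm_inj.
    by apply: (finset.trivIsetP tQ) => //; apply: contraNneq AB => ->.
  - apply/imsetP => -[B BQ /esym/eqP]; rewrite imset_eq0 => /eqP B0.
    by move: Q0; rewrite -B0 BQ.
rewrite /PD_eppf card_imset// big_imset /=; last first.
  by move=> ? ? _ _; exact: inj_im.
by congr ((_ / _ * _)%:E); apply: eq_bigr => B _; rewrite card_imset//; exact: perm_inj.
Qed.

(* P( . | K_n = k). The fallback value P of mnormalize, taken when
   P(K_n = k) = 0, is irrelevant in the Poisson-Dirichlet model: for
   alpha in ]0, 1[, theta > - alpha and 1 <= k <= n, every partition of
   {1, ..., n} into k blocks has positive probability. *)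
Definition cond_num_blocks d (T : measurableType d) (R : realType)
    (P : probability T R) (Pi : random_partition T) (n k : nat)
    : probability T R :=
  mnormalize (mrestr P (measurable_num_blocks Pi n k)) P.

(* f is a version of the density f_alpha: it is determined up to a
   Lebesgue-null set by its Laplace transform, and only its values on
   ]0, +oo[ matter. *)
Definition stable_density {R : realType} (alpha : R) (f : R -> R) : Prop :=
  [/\ measurable_fun (`]0, +oo[ : set R) f,
      (forall x, 0 < x -> 0 <= f x) &
      forall lambda, 0 <= lambda ->
        (\int[lebesgue_measure]_(x in `]0%R, +oo[)
            (expR (- (lambda * x)) * f x)%:E =
         (expR (- (lambda `^ alpha)))%:E)%E].

Definition limit_density {R : realType} (alpha theta : R) (n k : nat)
    (f : R -> R) (z : R) : \bar R :=
  ((Gamma (theta + n%:R) /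
      (Gamma (theta / alpha + k%:R) * Gamma (n%:R - k%:R * alpha) * alpha) *
    z `^ (theta / alpha + k%:R - 1))%:E *
   \int[lebesgue_measure]_(v in `]z, +oo[)
     ((1 - (z / v) `^ (1 / alpha)) `^ (n%:R - k%:R * alpha - 1) *
      f (v `^ (- (1 / alpha))) * v `^ (- (1 / alpha) - 1))%:E)%E.

(* Main.v *)
Require Import Defs.
From HB Require Import structures.
From mathcomp Require Import all_boot all_order all_algebra.
From mathcomp Require Import all_classical all_reals all_analysis.
From mathcomp Require Import measurable_realfun ring lra.
Import Order.TTheory GRing.Theory Num.Theory.
Import numFieldNormedType.Exports.
Local Open Scope classical_set_scope.
Local Open Scope ring_scope.
Set Implicit Arguments.
Unset Strict Implicit.
Unset Printing Implicit Defensive.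

(** Conditionally on [K_n = k], the number of blocks is a Markov chain that
    jumps from [j] to [j + 1] at time [N] with probability
    [(theta + j alpha) / (theta + N)].  Hence, with [x_N = K_N + theta/alpha],
    the rising factorial [(x_N)_s] times [Gamma(theta + N) / Gamma(theta + N +
    s alpha)] has constant expectation.  For [s = 1] this is a martingale, and its
    increments after time [N] have variance of order at most [N^-alpha];
    Chebyshev and Borel-Cantelli along [N = n + j^q], [q alpha >= 6], together
    with the monotonicity of [K], give the almost sure convergence of [K_m^(n) / m^alpha].
    For general [s], Stirling-type bounds on [Gamma] give the limits of all
    moments, which are those of the limit density: the latter reduce, by Tonelli
    and a substitution, to a beta integral and a negative moment of the stable
    law.  These moments grow slowly enough to determine the Laplace transform of
    the limit, and the Laplace transform determines the law. *)

(** * Integrals with respect to Lebesgue measure *)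

(** Rising factorials rather than powers are used because a jump turns (x)_s into (x)_s (x + s) / x,
    while the jump probability is alpha x / (theta + N): the state cancels, and each order s obeys a
    recursion of its own. Only the probability of opening a new block enters, so block sizes are
    never tracked. The almost sure limit and its law are obtained independently. Moments of the
    limit itself are never computed, which would require uniform integrability. Instead the Laplace
    transforms of the approximants are compared with that of the target law, with an error after J
    Taylor terms that involves moments of order at most J only; the sample size tends to infinity
    for fixed J, and then J does. The stable density is known through its Laplace transform alone,
    so everything about it is extracted by integrating that transform against powers. The integrals
    are kept in the extended nonnegative reals, where Tonelli and substitution need no
    integrability; finiteness is established afterwards. *)

Section density.
Local Open Scope ereal_scope.
Context d (T : measurableType d) (R : realType) (mu : {measure set T -> \bar R}).
Variable g : T -> R.
Hypotheses (mg : measurable_fun [set: T] g) (g0 : forall x, (0 <= g x)%R).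

(** The proofs about [g] are arguments, so that the measure structure can be attached to the term
    [density_measure mg g0]. *)
Definition density_measure of measurable_fun [set: T] g & (forall x, (0 <= g x)%R) :=
  fun A : set T => \int[mu]_(x in A) (g x)%:E.

Local Notation nu := (density_measure mg g0).

Let nu0 : nu set0 = 0.
Proof. by rewrite /density_measure integral_set0. Qed.

Let nu_ge0 A : 0 <= nu A.
Proof. by apply: integral_ge0 => x _; rewrite lee_fin. Qed.

Let nu_sigma_additive : semi_sigma_additive nu.
Proof.
move=> /= F mF tF mUF; rewrite /density_measure; apply: cvg_toP.
  apply: ereal_nondecreasing_is_cvgn => m n mn.
  apply: lee_sum_nneg_natr => // k _ _; apply: integral_ge0 => /= x Fkx.
  by rewrite lee_fin.
rewrite ge0_integral_bigcup//=.
- by apply/measurable_EFinP; exact: measurable_funTS.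
- by move=> x _; rewrite lee_fin.
Qed.

HB.instance Definition _ := isMeasure.Build _ _ _ nu nu0 nu_ge0 nu_sigma_additive.

Import HBNNSimple.

Lemma ge0_integral_density (h : T -> \bar R) :
  measurable_fun [set: T] h -> (forall x, 0 <= h x) ->
  \int[nu]_x h x = \int[mu]_x (h x * (g x)%:E).
Proof.
move=> mh h0.
pose h_ := nnsfun_approx measurableT mh.
have mgE : measurable_fun [set: T] (EFin \o g) by exact/measurable_EFinP.
have -> : \int[nu]_x h x = lim (\int[nu]_x (EFin \o h_ n) x @[n --> \oo]).
  have hE x : h x = lim ((EFin \o h_ n) x @[n --> \oo]).
    by apply/esym/cvg_lim => //; exact: cvg_nnsfun_approx.
  under eq_integral => x _ do rewrite hE.
  apply: monotone_convergence => //.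
  - by move=> n; apply/measurable_EFinP; exact/measurable_funP.
  - by move=> n x Ex //=; rewrite lee_fin.
  - by move=> x Ex a b ab; rewrite lee_fin; exact/lefP/nd_nnsfun_approx.
have -> : \int[mu]_x (h x * (g x)%:E) =
    lim (\int[mu]_x ((EFin \o h_ n) \* (EFin \o g)) x @[n --> \oo]).
  have fg x : h x * (g x)%:E = lim (((EFin \o h_ n) \* (EFin \o g)) x @[n --> \oo]).
    by apply/esym/cvg_lim => //; apply: cvgeZr => //; exact: cvg_nnsfun_approx.
  under eq_integral => x _ do rewrite fg.
  apply: monotone_convergence => [//| | |].
  - move=> n; apply/emeasurable_funM => //; exact/measurable_EFinP.
  - by move=> n x Ex /=; rewrite mule_ge0 ?lee_fin.
  - by move=> x Ex a b ab/=; rewrite lee_wpmul2r ?lee_fin//; exact/lefP/nd_nnsfun_approx.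
congr (lim (_ @ \oo)); apply/funext => n.
(* For a simple function both sides are finite sums over its values; on the indicator of one level
   set the identity is the definition of [nu]. *)
transitivity (\int[nu]_x (\sum_(y \in range (h_ n))
    (y * \1_(h_ n @^-1` [set y]) x)%:E)).
  by apply: eq_integral => x _ /=; rewrite fsumEFin// -fimfunE.
transitivity (\int[mu]_x ((\sum_(y \in range (h_ n))
    (y * \1_(h_ n @^-1` [set y]) x)%:E) * (g x)%:E)); last first.
  apply: eq_integral => x _ /=; by rewrite fsumEFin// -fimfunE.
have indich m r : measurable_fun setT (fun x => (r * \1_(h_ m @^-1` [set r]) x)%:E).
  by apply: (measurable_comp measurableT) => //; exact: measurable_funM.
rewrite ge0_integral_fsum//; last by move=> m y Ey; exact: nnfun_muleindic_ge0.
under [RHS]eq_integral => x _.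
  rewrite ge0_mule_fsuml; last by move=> y; exact: nnfun_muleindic_ge0.
  over.
rewrite [RHS]ge0_integral_fsum//; last 2 first.
  - by move=> y; apply: emeasurable_funM.
  - by move=> m y Ey; apply: mule_ge0; rewrite ?lee_fin//; exact: nnfun_muleindic_ge0.
apply: eq_fsbigr => r rhn.
under eq_integral do rewrite EFinM.
rewrite integralZl_indic_nnsfun => //.
under [RHS]eq_integral do rewrite EFinM -muleA.
rewrite [RHS]ge0_integralZl//.
- congr (_ * _); rewrite integral_indic// setIT /= /density_measure.
  rewrite integral_mkcond; apply: eq_integral => x _.
  by rewrite epatch_indic muleC.
- by apply: emeasurable_funM => //; exact/measurable_EFinP.
- by move=> t Et; rewrite mule_ge0 ?lee_fin.
- by move: rhn; rewrite inE => -[t _ <-]; rewrite lee_fin.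
Qed.

End density.

Section change_of_variables.
Local Open Scope ereal_scope.
Context {R : realType}.
Local Notation mu := (@lebesgue_measure R).

Lemma measureR_unique (m1 m2 : {measure set (measurableTypeR R) -> \bar R}) :
  (forall a b : R, (a < b)%R -> m1 `]a, b]%classic = m2 `]a, b]%classic) ->
  (forall a b : R, (a < b)%R -> m1 `]a, b]%classic < +oo) ->
  forall A, measurable A -> m1 A = m2 A.
Proof.
move=> m12 m1oo A mA.
apply: (@measure_unique _ _ (measurableTypeR R) (@ocitv R) (fun k => `](- k%:R)%R, k%:R]%classic)) => //.
- exact: ocitvI.
- by move=> k; exact: is_ocitv.
- by rewrite bigcup_itvT.
- move=> _ [[a b]] /= _ <-; have [ab|ba] := ltP a b; first exact: m12.
  by rewrite set_itv_ge ?measure0// -leNgt bnd_simp.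
- case=> [|k]; first by rewrite oppr0 set_itvoc0 measure0.
  by apply: m1oo; rewrite (@lt_trans _ _ 0%R)// ?oppr_lt0 ltr0n.
Qed.

(** The hypothesis on intervals says that [phi] pushes the measure of density [w] to Lebesgue
    measure on [E]; half-open intervals suffice by [measureR_unique]. Here [w] is the Jacobian, and
    neither monotonicity nor smoothness of [phi] is involved. *)
Lemma ge0_change_of_variables (phi w : R -> R) (E : set R) (h : R -> \bar R) :
  measurable_fun [set: R] phi -> measurable_fun [set: R] w ->
  (forall x, (0 <= w x)%R) -> measurable E ->
  (forall a b : R, (a < b)%R ->
    \int[mu]_(x in phi @^-1` `]a, b]%classic) (w x)%:E = mu (`]a, b]%classic `&` E)) ->
  (forall x, E (phi x)) ->
  measurable_fun [set: R] h -> (forall x, 0 <= h x) ->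
  \int[mu]_(x in E) h x = \int[mu]_x (h (phi x) * (w x)%:E).
Proof.
move=> mphi mw w0 mE phiw phiE mh h0.
rewrite -(@ge0_integral_density _ _ _ mu w mw w0 (h \o phi)); last 2 first.
  exact: measurableT_comp.
  by move=> x; exact: h0.
pose mphi_mixin := isMeasurableFun.Build _ _ (measurableTypeR R)
  (measurableTypeR R) phi mphi.
pose f : {mfun measurableTypeR R >-> measurableTypeR R} := HB.pack phi mphi_mixin.
transitivity (\int[pushforward (density_measure mu mw w0) f]_(x in E) h x); last first.
  rewrite ge0_integral_pushforward//; last exact: measurable_funTS.
  by have -> : f @^-1` E = [set: R] by apply/seteqP; split => // x _; exact: phiE.
apply: eq_measure_integral => A mA AE.
transitivity (mrestr mu mE A); first by rewrite /mrestr setIidl.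
apply: measureR_unique => //.
  by move=> a b ab; exact/esym/phiw.
move=> a b ab; apply: (@le_lt_trans _ _ (mu `]a, b]%classic)).
  by apply: (@le_measure _ _ _ mu); rewrite ?inE//=; exact: measurableI.
by rewrite lebesgue_measure_itv/=; case: ifP => // _; rewrite -EFinB ltry.
Qed.

End change_of_variables.

Section exp_affine.
Local Open Scope ereal_scope.
Context {R : realType}.
Local Notation mu := (@lebesgue_measure R).

Lemma ge0_integral_affine (p q : R) (h : R -> \bar R) : (p != 0)%R ->
  measurable_fun [set: R] h -> (forall x, 0 <= h x) ->
  \int[mu]_x h x = \int[mu]_x (h (p * x + q)%R * `|p|%:E).
Proof.
move=> p0 mh h0.
apply: (@ge0_change_of_variables _ (fun x => p * x + q)%R (fun=> `|p|%R)) => //.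
  by apply: measurable_funD => //; exact: measurable_funM.
move=> a b ab; rewrite setIT integral_cst//=; last first.
  rewrite -[X in measurable X]setTI; apply: (@measurable_funD _ _ _ _ (fun x => p * x)%R (cst q)) => //.
  exact: measurable_funM.
rewrite lebesgue_measure_itv/= lte_fin ab.
have [p_lt0|p_gt0|/eqP] := ltgtP p 0%R; last by rewrite (negbTE p0).
- have -> : (fun x => p * x + q)%R @^-1` `]a, b]%classic =
    `[((b - q) / p)%R, ((a - q) / p)%R[%classic.
    apply/seteqP; split => x /=; rewrite !in_itv/= ler_ndivrMr// ltr_ndivlMr//;
      by rewrite mulrC => /andP[? ?]; lra.
  rewrite lebesgue_measure_itv/= lte_fin ltr_ndivrMr// divfK// ltrD2r ab.
  rewrite ltr0_norm// -!EFinD -EFinM; congr EFin; field => //.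
- have -> : (fun x => p * x + q)%R @^-1` `]a, b]%classic =
    `]((a - q) / p)%R, ((b - q) / p)%R]%classic.
    apply/seteqP; split => x /=; rewrite !in_itv/= ltr_pdivrMr// ler_pdivlMr//;
      by rewrite mulrC => /andP[? ?]; lra.
  rewrite lebesgue_measure_itv/= lte_fin ltr_pdivrMr// divfK// ltrD2r ab.
  rewrite gtr0_norm// -!EFinD -EFinM; congr EFin; field => //.
Qed.

Lemma integral_expRN (c : R) :
  \int[mu]_(x in `[c, +oo[) (expR (- x))%:E = (expR (- c))%:E.
Proof.
rewrite (@ge0_continuous_FTC2y _ _ (fun x => - expR (- x))%R _ 0%R)//.
- by rewrite EFinN oppeK add0e.
- apply: continuous_subspaceT => x.
  by apply: continuous_comp; [exact: opp_continuous|exact: continuous_expR].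
- by rewrite -oppr0; apply: cvgN; exact: cvgr_expR.
- apply: cvg_at_right_filter; apply: cvgN.
  by apply: continuous_comp; [exact: opp_continuous|exact: continuous_expR].
- by move=> x _; rewrite derive1E derive_val mulrN1 opprK.
Qed.

Lemma integral_expR (c : R) :
  \int[mu]_(x in `]-oo, c]) (expR x)%:E = (expR c)%:E.
Proof.
have cE : continuous (fun x : R => expR x) by exact: continuous_expR.
rewrite -[c in LHS]opprK ge0_integration_by_substitutionNy.
- by rewrite -[c in RHS]opprK -integral_expRN.
- exact: continuous_subspaceT.
- by move=> x _; exact: expR_ge0.
Qed.

(** The exponential carries the line to the half line, so that power substitutions on the latter
    reduce to affine ones on the former. *)
Lemma ge0_integral_exp (h : R -> \bar R) :
  measurable_fun [set: R] h -> (forall x, 0 <= h x) ->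
  \int[mu]_(x in `]0%R, +oo[) h x = \int[mu]_x (h (expR x) * (expR x)%:E).
Proof.
move=> mh h0.
apply: ge0_change_of_variables => //.
(* Three cases: the interval misses the half line, straddles 0, or lies inside it. *)
- move=> a b ab; have [b0|b0] := leP b 0%R.
    rewrite (_ : _ @^-1` _ = set0) ?integral_set0; last first.
      apply/seteqP; split => x //=; rewrite in_itv/= => /andP[_].
      by rewrite leNgt (le_lt_trans b0)// expR_gt0.
    rewrite (_ : _ `&` _ = set0) ?measure0//.
    apply/seteqP; split => x //= -[]; rewrite !in_itv/= andbT => /andP[_].
    by move=> + x0; rewrite leNgt (le_lt_trans b0).
  have [a0|a0] := leP a 0%R.
    rewrite (_ : _ @^-1` _ = `]-oo, ln b]%classic); last first.
      apply/seteqP; split => x /=; rewrite !in_itv/=.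
        by move=> /andP[_]; rewrite -{1}(lnK b0) ler_expR.
      by rewrite -{2}(lnK b0) ler_expR => ->; rewrite (le_lt_trans a0)// expR_gt0.
    rewrite integral_expR lnK//.
    rewrite (_ : _ `&` _ = `]0%R, b]%classic); last first.
      apply/seteqP; split => x /=; rewrite !in_itv/= andbT.
        by move=> [/andP[_ ->] ->].
      by move=> /andP[x0 ->]; rewrite x0 (le_lt_trans a0).
    by rewrite lebesgue_measure_itv/= lte_fin b0 sube0.
  rewrite (_ : _ @^-1` _ = `]ln a, ln b]%classic); last first.
    apply/seteqP; split => x /=; rewrite !in_itv/=.
      by rewrite -{1}(lnK b0) -{1}(lnK a0) ler_expR ltr_expR.
    by rewrite -{2}(lnK b0) -{2}(lnK a0) ler_expR ltr_expR.
  rewrite (_ : _ `&` _ = `]a, b]%classic); last first.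
    apply/seteqP; split => x /=; rewrite !in_itv/= andbT; first by case.
    by move=> /andP[ax ->]; rewrite ax (lt_trans a0).
  rewrite lebesgue_measure_itv/= lte_fin ab integral_itv_obnd_cbnd; last first.
    by apply/measurable_EFinP; exact: measurable_funTS.
  rewrite (@continuous_FTC2 _ _ expR) ?lnK// ?ltr_ln//.
  + exact/continuous_subspaceT/continuous_expR.
  + split.
    * by move=> x _; exact: derivable_expR.
    * exact/cvg_at_right_filter/continuous_expR.
    * exact/cvg_at_left_filter/continuous_expR.
  + by move=> x _; rewrite derive1E derive_val.
- by move=> x /=; rewrite in_itv/= expR_gt0.
Qed.

(** In logarithmic coordinates the map sending x to c x^p is the affine map sending y to p y + ln c.
    Negative [p] is allowed and is used later with p = - alpha. *)
Lemma ge0_integral_powR (c p : R) (h : R -> \bar R) :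
  (0 < c)%R -> (p != 0)%R ->
  measurable_fun [set: R] h -> (forall x, 0 <= h x) ->
  \int[mu]_(x in `]0%R, +oo[) h x =
  \int[mu]_(x in `]0%R, +oo[)
     (h (c * x `^ p)%R * (c * `|p| * x `^ (p - 1))%:E).
Proof.
move=> c0 p0 mh h0.
rewrite ge0_integral_exp// (ge0_integral_affine (ln c) p0); last 2 first.
- apply: emeasurable_funM; first exact: measurableT_comp.
  exact/measurable_EFinP.
- by move=> x; rewrite mule_ge0 ?lee_fin ?expR_ge0.
rewrite [RHS]ge0_integral_exp; last 2 first.
- apply: emeasurable_funM.
    by apply: measurableT_comp => //; apply: measurable_funM.
  apply/measurable_EFinP; apply: measurable_funM => //; exact: measurable_powR.
- by move=> x; rewrite mule_ge0 ?lee_fin ?mulr_ge0 ?powR_ge0// ltW.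
apply: eq_integral => x _.
have -> : expR (p * x + ln c) = (c * expR x `^ p)%R.
  by rewrite expRD lnK// /powR gt_eqF ?expR_gt0// expRK mulrC.
have H : (expR x `^ (p - 1) * expR x = expR x `^ p)%R.
  rewrite -[in RHS](subrK 1%R p) (@powRD _ _ (p - 1) 1) ?powRr1 ?expR_ge0//.
  by rewrite lt0r_neq0 ?expR_gt0 ?implybT.
rewrite -!muleA -!EFinM; congr (_ * _%:E).
by rewrite -[in LHS]H; ring.
Qed.

End exp_affine.

Section measurability.
Context d (T : measurableType d) (R : realType) (D : set T).

Lemma measurable_fun_powR (p : R) (f : T -> R) :
  measurable_fun D f -> measurable_fun D (fun x => f x `^ p).
Proof.
exact: (measurableT_comp (measurable_powR p)).
Qed.

Lemma measurable_fun_expR (f : T -> R) :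
  measurable_fun D f -> measurable_fun D (fun x => expR (f x)).
Proof. exact: measurableT_comp. Qed.

End measurability.

Ltac measR := lazymatch goal with
  | |- measurable_fun _ (fun x => EFin _) => apply/measurable_EFinP; measR
  | |- measurable_fun _ (fun x => _ `^ _) => apply: measurable_fun_powR; measR
  | |- measurable_fun _ (fun x => expR _) => apply: measurable_fun_expR; measR
  | |- measurable_fun _ (fun x => (_ * _)%R) =>
      (first [apply: measurable_funM | apply: emeasurable_funM]); measR
  | |- measurable_fun _ (fun x => (_ + - _)%R) => apply: measurable_funB; measR
  | |- measurable_fun _ (fun x => (_ + _)%R) =>
      (first [apply: measurable_funD | apply: emeasurable_funD]); measR
  | |- measurable_fun _ (fun x => (- _)%R) => apply: measurable_funN; measR
  | |- measurable_fun _ (fun x => (_ ^+ _)%R) => apply: measurable_funX; measR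
  | |- measurable_fun _ (fun x => (_ * _)%E) => apply: emeasurable_funM; measR
  | |- measurable_fun _ (fun x => (_ + _)%E) => apply: emeasurable_funD; measR
  | |- measurable_fun _ (+%R _) => by apply: measurable_funD
  | |- measurable_fun _ ( *%R _) => exact: mulrl_measurable
  | _ => try done
  end.

Section tonelli.
Local Open Scope ereal_scope.
Context {R : realType}.
Local Notation mu := (@lebesgue_measure R).

Lemma ge0_tonelli_in (D E : set R) (F : R -> R -> \bar R) :
  measurable D -> measurable E ->
  measurable_fun [set: R * R] (fun z => F z.1 z.2) ->
  (forall x y, 0 <= F x y) ->
  \int[mu]_(x in D) \int[mu]_(y in E) F x y =
  \int[mu]_(y in E) \int[mu]_(x in D) F x y.
Proof.
move=> mD mE mF F0.
(* The domains become indicator factors, so that Tonelli is applied on the whole plane. *)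
pose G z := F z.1 z.2 * (\1_D z.1 * \1_E z.2)%:E.
have mG : measurable_fun [set: measurableTypeR R * measurableTypeR R] G.
  apply: emeasurable_funM => //; apply/measurable_EFinP/measurable_funM.
    exact: (measurableT_comp (measurable_indic mD)).
  exact: (measurableT_comp (measurable_indic mE)).
have G0 z : 0 <= G z by rewrite mule_ge0 ?lee_fin ?mulr_ge0.
have := fubini_tonelli (m1 := mu) (m2 := mu) G mG G0.
have -> : \int[mu]_x \int[mu]_y G (x, y) = \int[mu]_(x in D) \int[mu]_(y in E) F x y.
  rewrite [RHS]integral_mkcond; apply: eq_integral => x _; rewrite patchE.
  case: ifPn => xD.
    rewrite [RHS]integral_mkcond; apply: eq_integral => y _.
    rewrite patchE /G /= !indicE xD; case: ifPn => yE.
      by rewrite mulr1 mule1.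
    by rewrite mulr0 mule0.
  by apply: integral0_eq => y _; rewrite /G /= !indicE (negbTE xD) mul0r mule0.
move=> ->.
rewrite [RHS]integral_mkcond; apply: eq_integral => y _; rewrite patchE.
case: ifPn => yE.
  rewrite [RHS]integral_mkcond; apply: eq_integral => x _.
  rewrite patchE /G /= !indicE yE; case: ifPn => xD.
    by rewrite mulr1 mule1.
  by rewrite mul0r mule0.
by apply: integral0_eq => x _; rewrite /G /= !indicE (negbTE yE) mulr0 mule0.
Qed.

End tonelli.

(** * Gamma and beta functions *)

Section indicators.
Context d (T : measurableType d) (R : realType).

Lemma measurable_fun_ltR (f g : T -> R) :
  measurable_fun [set: T] f -> measurable_fun [set: T] g ->
  measurable_fun [set: T] (fun x => (f x < g x)%R%:R : R).
Proof.
move=> mf mg.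
rewrite (_ : (fun _ => _) = \1_[set x | f x < g x]); last first.
  by apply/funext => x; rewrite indicE mem_setE.
apply: measurable_indic; rewrite -[X in measurable X]setTI.
exact: (measurable_fun_ltr mf mg).
Qed.

End indicators.

Lemma ltr_powRE (R : realType) (p x y : R) : 0 < p -> 0 <= x -> 0 <= y ->
  (x `^ p < y `^ p) = (x < y).
Proof.
move=> p0 x0 y0; apply/idP/idP => [|xy]; last by rewrite gt0_ltr_powR ?nnegrE.
by apply: contraTT; rewrite -!leNgt => yx; rewrite ge0_ler_powR ?nnegrE// ltW.
Qed.

Lemma gt0_powRD (R : realType) (x r s : R) : 0 < x ->
  x `^ (r + s) = x `^ r * x `^ s.
Proof. by move=> x0; rewrite powRD// lt0r_neq0 ?implybT. Qed.

Lemma powR_invl (R : realType) (x r : R) : 0 <= x -> x^-1 `^ r = x `^ (- r).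
Proof. by move=> x0; rewrite -powR_inv1// -powRrM mulN1r. Qed.

Section Egamma.
Local Open Scope ereal_scope.
Context {R : realType}.
Local Notation mu := (@lebesgue_measure R).
Implicit Types x t : R.

(** Extended-valued, so that the functional equation and the beta identity can be proved by Tonelli
    before finiteness is known; finiteness is then deduced from them. *)
Definition Egamma x : \bar R :=
  \int[mu]_(t in `]0%R, +oo[) (t `^ (x - 1) * expR (- t))%:E.

Lemma GammaE x : Gamma x = fine (Egamma x). Proof. by []. Qed.

Lemma Egamma_ge0 x : 0 <= Egamma x.
Proof.
by apply: integral_ge0 => t _; rewrite lee_fin mulr_ge0 ?powR_ge0 ?expR_ge0.
Qed.

(** A bound that depends on another variable is carried as an indicator factor, which keeps the
    domain of a double integral a product. *)
Lemma integral_ltl x (h : R -> R) :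
  \int[mu]_(t in `]0%R, +oo[) ((t < x)%R%:R * h t)%:E =
  \int[mu]_(t in `]0%R, x[) (h t)%:E.
Proof.
rewrite [LHS]integral_mkcond [RHS]integral_mkcond.
apply: eq_integral => t _; rewrite !patchE !mem_setE !in_itv/= andbT.
by case: (0 < t)%R => //=; case: (t < x)%R; rewrite ?mul1r ?mul0r.
Qed.

Lemma integral_gtr x (h : R -> R) : (0 <= x)%R ->
  \int[mu]_(t in `]0%R, +oo[) ((x < t)%R%:R * h t)%:E =
  \int[mu]_(t in `]x, +oo[) (h t)%:E.
Proof.
move=> x0; rewrite [LHS]integral_mkcond [RHS]integral_mkcond.
apply: eq_integral => t _; rewrite !patchE !mem_setE !in_itv/= !andbT.
have [xt|xt] := ltP x t; first by rewrite (le_lt_trans x0 xt) mul1r.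
by case: ifP => //; rewrite mul0r.
Qed.

(** The substitution u = s^x in the length of ]0, t^x[. It also covers x < 1, where the integrand is
    unbounded near 0. *)
Lemma integral_powRB1 x t : (0 < x)%R -> (0 < t)%R ->
  \int[mu]_(s in `]0%R, +oo[) ((s < t)%R%:R * (x * s `^ (x - 1)))%:E = (t `^ x)%:E.
Proof.
move=> x0 t0.
have := @ge0_integral_powR R 1 x (fun s => ((s < t `^ x)%R%:R * 1)%:E) ltr01
  (lt0r_neq0 x0).
rewrite (integral_ltl _ (cst 1%R)).
have -> : \int[mu]_(s in `]0%R, (t `^ x)%R[) (cst 1%R s)%:E = (t `^ x)%:E.
  rewrite (integral_cst mu _ 1)//= lebesgue_measure_itv/= lte_fin powR_gt0//.
  by rewrite sube0 mul1e.
move=> ->; last 2 first.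
- by apply/measurable_EFinP/measurable_funM => //; exact: measurable_fun_ltR.
- by move=> s; rewrite mulr1 lee_fin.
apply: eq_integral => s; rewrite inE/= in_itv/= andbT => s0.
rewrite mul1r !mulr1 -EFinM (gtr0_norm x0) mul1r ltr_powRE ?ltW//.
Qed.

Lemma Egamma_scale x c : (0 < c)%R ->
  \int[mu]_(t in `]0%R, +oo[) (t `^ (x - 1) * expR (- (c * t)))%:E =
  (c `^ (- x))%:E * Egamma x.
Proof.
move=> c0.
rewrite (@ge0_integral_powR R c^-1 1); last 4 first.
- by rewrite invr_gt0.
- by [].
- by measR.
- by move=> t; rewrite lee_fin mulr_ge0 ?powR_ge0 ?expR_ge0.
rewrite /Egamma -ge0_integralZl_EFin ?powR_ge0//; last 2 first.
- by move=> t _; rewrite lee_fin mulr_ge0 ?powR_ge0 ?expR_ge0.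
- by apply: measurable_funTS; measR.
apply: eq_integral => t; rewrite inE/= in_itv/= andbT => t0.
have -> : (c * (c^-1 * t `^ 1) = t)%R by rewrite mulrA divff ?gt_eqF// mul1r powRr1 ?ltW.
rewrite -!EFinM; congr EFin.
rewrite powRr1 ?(ltW t0)// subrr powRr0 normr1 !mulr1 powRM ?invr_ge0 1?ltW//.
rewrite powR_invl 1?ltW//.
have -> : (- x = - (x - 1) - 1)%R by ring.
by rewrite (gt0_powRD _ _ c0) powR_inv1 ?(ltW c0)//; ring.
Qed.

Lemma integral_expRN_o (c : R) :
  \int[mu]_(x in `]c, +oo[) (expR (- x))%:E = (expR (- c))%:E.
Proof.
rewrite integral_itv_obnd_cbnd ?integral_expRN//.
by apply: measurable_funTS; measR.
Qed.

(** Integration by parts in Tonelli form: t^x is the integral of x s^(x-1) over s < t, and after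
    exchanging the order the integral of exp (- t) over t > s is exp (- s). *)
Lemma EgammaS x : (0 < x)%R -> Egamma (x + 1) = x%:E * Egamma x.
Proof.
move=> x0.
transitivity (\int[mu]_(t in `]0%R, +oo[) \int[mu]_(s in `]0%R, +oo[)
    ((s < t)%R%:R * (x * s `^ (x - 1)) * expR (- t))%:E).
  apply: eq_integral => t; rewrite inE/= in_itv/= andbT => t0.
  rewrite addrK EFinM -integral_powRB1// -ge0_integralZr//.
  - apply: measurable_funTS; apply/measurable_EFinP/measurable_funM; last by measR.
    exact: measurable_fun_ltR.
  - by move=> s _; rewrite lee_fin !mulr_ge0 ?powR_ge0// ltW.
rewrite ge0_tonelli_in//; last 2 first.
- apply/measurable_EFinP; apply: measurable_funM; last by measR.
  by apply: measurable_funM; [exact: measurable_fun_ltR|measR].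
- by move=> t s; rewrite lee_fin !mulr_ge0 ?powR_ge0 ?expR_ge0// ltW.
rewrite /Egamma -ge0_integralZl_EFin ?(ltW x0)//; last 2 first.
- by move=> t _; rewrite lee_fin mulr_ge0 ?powR_ge0 ?expR_ge0.
- by apply: measurable_funTS; measR.
apply: eq_integral => s; rewrite inE/= in_itv/= andbT => s0.
rewrite -EFinM mulrA EFinM -integral_expRN_o -integral_gtr 1?ltW//.
rewrite -ge0_integralZl_EFin ?mulr_ge0 ?powR_ge0 ?(ltW x0)//; last first.
- by apply: measurable_funTS; apply/measurable_EFinP/measurable_funM; [exact: measurable_fun_ltR|measR].
by apply: eq_integral => t _; rewrite -EFinM; congr EFin; ring.
Qed.

Lemma Egamma1 : Egamma 1 = 1.
Proof.
rewrite /Egamma; under eq_integral do rewrite subrr powRr0 mul1r.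
by rewrite integral_expRN_o oppr0 expR0.
Qed.

Lemma Egamma_natS_lty n : Egamma n.+1%:R < +oo.
Proof.
elim: n => [|n ih]; first by rewrite Egamma1 ltry.
by rewrite -natr1 EgammaS// lte_mul_pinfty// lee_fin.
Qed.

(** The bound t^x <= 1 + t^n for 0 < x <= n needs a nonnegative exponent. It therefore shows
    finiteness at x + 1, which [EgammaS] brings back to x. *)
Lemma Egamma_lty x : (0 < x)%R -> Egamma x < +oo.
Proof.
move=> x0; have [n xn] : exists n, (x <= n%:R)%R.
  by exists (Num.truncn x).+1; rewrite ltW// truncnS_gt.
suff : Egamma (x + 1) < +oo.
  rewrite EgammaS// => H.
  have := Egamma_ge0 x; move: H; case: (Egamma x) => // [r _ _|]; first by rewrite ltry.
  by rewrite gt0_muley ?lte_fin.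
apply: (@le_lt_trans _ _ (Egamma 1 + Egamma n.+1%:R)); last first.
  by apply: lte_add_pinfty; [rewrite Egamma1 ltry|exact: Egamma_natS_lty].
rewrite /Egamma -ge0_integralD//; last 4 first.
- by move=> t _; rewrite lee_fin mulr_ge0 ?powR_ge0 ?expR_ge0.
- by apply: measurable_funTS; measR.
- by move=> t _; rewrite lee_fin mulr_ge0 ?powR_ge0 ?expR_ge0.
- by apply: measurable_funTS; measR.
apply: ge0_le_integral => //.
- by move=> t _; rewrite lee_fin mulr_ge0 ?powR_ge0 ?expR_ge0.
- by apply: measurable_funTS; measR.
- by apply: emeasurable_funD; apply: measurable_funTS; measR.
move=> t; rewrite /= in_itv/= andbT => t0.
rewrite lee_fin -mulrDl ler_wpM2r ?expR_ge0// addrK subrr powRr0 -natr1 addrK.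
have [t1|t1] := leP t 1%R.
  rewrite ler_wpDr ?powR_ge0// -(powRr0 t) ger_powR ?t0// ltW//.
by rewrite ler_wpDl// ler_powR// ltW.
Qed.

(** On t < 1 the exponential is at least exp (- 1), and t^(x-1) integrates to 1 / x there. *)
Lemma Egamma_gt0 x : (0 < x)%R -> 0 < Egamma x.
Proof.
move=> x0; apply: (@lt_le_trans _ _ (expR (- 1) * x^-1)%:E).
  by rewrite lte_fin mulr_gt0 ?expR_gt0 ?invr_gt0.
have -> : (expR (- 1) * x^-1)%:E = (expR (- 1) * x^-1)%:E *
   \int[mu]_(s in `]0%R, +oo[) ((s < 1)%R%:R * (x * s `^ (x - 1)))%:E.
  by rewrite integral_powRB1// powR1 mule1.
rewrite -ge0_integralZl_EFin//; last 3 first.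
- by move=> s _; rewrite lee_fin !mulr_ge0 ?powR_ge0// ltW.
- apply: measurable_funTS; apply/measurable_EFinP/measurable_funM; last by measR.
  exact: measurable_fun_ltR.
- by rewrite mulr_ge0 ?expR_ge0 ?invr_ge0 ?ltW.
apply: ge0_le_integral => //.
- by move=> s _; rewrite lee_fin !mulr_ge0 ?expR_ge0 ?invr_ge0 ?powR_ge0// ltW.
- apply: measurable_funTS; apply/measurable_EFinP/measurable_funM; first by measR.
  apply: measurable_funM; last by measR.
  exact: measurable_fun_ltR.
- by apply: measurable_funTS; measR.
move=> t; rewrite /= in_itv/= andbT => t0; rewrite -EFinM lee_fin.
have [t1|t1] := ltP t 1%R; last by rewrite mul0r mulr0 mulr_ge0 ?powR_ge0 ?expR_ge0.
rewrite mul1r mulrA divfK ?gt_eqF// mulrC ler_wpM2l ?powR_ge0//.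
by rewrite ler_expR lerN2 ltW.
Qed.

Lemma EgammaE x : (0 < x)%R -> Egamma x = (Gamma x)%:E.
Proof.
by move=> x0; rewrite GammaE fineK// ge0_fin_numE ?Egamma_ge0 ?Egamma_lty.
Qed.

Lemma Gamma_gt0 x : (0 < x)%R -> (0 < Gamma x)%R.
Proof. by move=> x0; rewrite -lte_fin -EgammaE// Egamma_gt0. Qed.

Lemma GammaS x : (0 < x)%R -> (Gamma (x + 1) = x * Gamma x)%R.
Proof.
move=> x0; apply: EFin_inj.
by rewrite EFinM -!EgammaE ?EgammaS// addr_gt0.
Qed.

End Egamma.

Section Gamma_inequalities.
Context {R : realType}.
Local Notation mu := (@lebesgue_measure R).
Implicit Types x t a : R.

(** The graph of t^a lies below its tangent at 1; this is Young's inequality for t^a and 1 with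
    conjugate exponents 1 / a and 1 / (1 - a). *)
Lemma powR_young t a : 0 < t -> 0 < a < 1 -> t `^ a <= (1 - a) + a * t.
Proof.
move=> t0 /andP[a0 a1].
have := @conjugate_powR R (t `^ a) 1 a^-1 (1 - a)^-1 (powR_ge0 _ _) ler01.
rewrite !invrK !invr_gt0 subr_gt0 => /(_ a0 a1).
rewrite addrCA subrr addr0 => /(_ erefl).
by rewrite mulr1 -powRrM divff ?gt_eqF// powRr1 ?(ltW t0)// powR1 mul1r addrC mulrC.
Qed.

(** The tangent bound at t / x, integrated against t^(x-1) exp (- t). Under that weight t has mean
    Gamma (x + 1) / Gamma x = x, so the linear terms add up to exactly 1. *)
Lemma Gamma_powR_le x a : 0 < x -> 0 < a < 1 ->
  Gamma (x + a) <= x `^ a * Gamma x.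
Proof.
move=> x0 /andP[a0 a1].
rewrite -lee_fin EFinM -!EgammaE//; last exact: addr_gt0.
have -> : ((x `^ a)%:E * Egamma x =
    (x `^ a * (1 - a))%:E * Egamma x + (x `^ (a - 1) * a)%:E * Egamma (x + 1))%E.
  rewrite EgammaS// !EgammaE// -!EFinM -EFinD; congr EFin.
  have -> : x `^ a = x `^ (a - 1) * x.
    by rewrite -[X in _ * X]powRr1 ?(ltW x0)// -gt0_powRD// subrK.
  by ring.
rewrite /Egamma -!ge0_integralZl_EFin//; last 6 first.
- by move=> t _; rewrite lee_fin mulr_ge0 ?powR_ge0 ?expR_ge0.
- by apply: measurable_funTS; measR.
- by rewrite mulr_ge0 ?powR_ge0 ?ltW.
- by move=> t _; rewrite lee_fin mulr_ge0 ?powR_ge0 ?expR_ge0.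
- by apply: measurable_funTS; measR.
- by rewrite mulr_ge0 ?powR_ge0 ?subr_ge0 ?ltW.
rewrite -ge0_integralD//; last 4 first.
- by move=> t _; rewrite -EFinM lee_fin !mulr_ge0 ?powR_ge0 ?expR_ge0// subr_ge0 ltW.
- by apply: measurable_funTS; measR.
- by move=> t _; rewrite -EFinM lee_fin !mulr_ge0 ?powR_ge0 ?expR_ge0// ltW.
- by apply: measurable_funTS; measR.
apply: ge0_le_integral => //.
- by move=> t _; rewrite lee_fin mulr_ge0 ?powR_ge0 ?expR_ge0.
- by apply: measurable_funTS; measR.
- by apply: measurable_funTS; measR.
move=> t; rewrite /= in_itv/= andbT => t0.
rewrite -!EFinM -EFinD lee_fin !mulrA -mulrDl ler_wpM2r ?expR_ge0//.
have -> : x + a - 1 = (x - 1) + a by ring.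
have -> : x + 1 - 1 = (x - 1) + 1 by ring.
move: (x - 1) => y; rewrite !(gt0_powRD _ _ t0) powRr1 ?(ltW t0)//.
have := @powR_young (t / x) a.
rewrite divr_gt0// a0 a1 => /(_ isT isT) H.
have -> : t `^ a = x `^ a * (t / x) `^ a.
  by rewrite -powRM ?divr_ge0 ?ltW// mulrC divfK ?gt_eqF.
have -> : x `^ a * (1 - a) * t `^ y + x `^ (a - 1) * a * (t `^ y * t) =
   t `^ y * (x `^ a * (1 - a + a * (t / x))).
  rewrite (gt0_powRD a (-1) x0) powR_inv1 ?(ltW x0)//.
  by field; rewrite gt_eqF.
by rewrite !ler_wpM2l ?powR_ge0.
Qed.

(** The lower bound is [Gamma_powR_le]. The upper bound uses it again from x + a with exponent 1 -
    a, reaching Gamma (x + 1) = x Gamma x, and then x^a <= (x + a)^a. *)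
Lemma Gamma_ratio_bounds x a : 0 < x -> 0 < a < 1 ->
  1 <= Gamma x / Gamma (x + a) * x `^ a <= 1 + a / x.
Proof.
move=> x0 a01; have /andP[a0 a1] := a01.
have xa0 : 0 < x + a by exact: addr_gt0.
apply/andP; split.
  rewrite mulrAC ler_pdivlMr ?Gamma_gt0// mul1r mulrC.
  exact: Gamma_powR_le.
have := @Gamma_powR_le (x + a) (1 - a) xa0.
rewrite subr_gt0 a1 ltrBlDr ltrDl a0 => /(_ isT).
rewrite -addrA [a + _]addrC subrK GammaS// => H.
rewrite mulrAC ler_pdivrMr ?Gamma_gt0//.
rewrite -(ler_pM2l x0) mulrA; apply: (le_trans (ler_wpM2r (powR_ge0 _ _) H)).
have -> : x * ((1 + a / x) * Gamma (x + a)) = (x + a) * Gamma (x + a).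
  by field; rewrite gt_eqF.
rewrite mulrAC ler_wpM2r ?(ltW (Gamma_gt0 _))//.
rewrite -[leRHS]powRr1 ?(ltW xa0)// -[X in _ <= _ `^ X](subrK a 1) (@gt0_powRD _ (x + a) (1 - a) a)//.
by rewrite ler_wpM2l ?powR_ge0// ge0_ler_powR ?nnegrE ?(ltW a0) ?(ltW x0) ?(ltW xa0)// lerDl ltW.
Qed.

End Gamma_inequalities.

Section Beta.
Local Open Scope ereal_scope.
Context {R : realType}.
Local Notation mu := (@lebesgue_measure R).
Implicit Types a b t y : R.

(** The beta function B(a, b), in the variable y = u / (1 - u) where u is the usual variable in the
    unit interval. *)
Definition Ebeta a b : \bar R :=
  \int[mu]_(y in `]0%R, +oo[) (y `^ (b - 1) * (1 + y) `^ (- (a + b)))%:E.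

(* Substitute [s = t y] in the product of the two integrals. *)
Lemma Egamma_beta a b : Egamma a * Egamma b = Egamma (a + b) * Ebeta a b.
Proof.
transitivity (\int[mu]_(t in `]0%R, +oo[) \int[mu]_(y in `]0%R, +oo[)
    (t `^ (a + b - 1) * expR (- ((1 + y) * t)) * y `^ (b - 1))%:E).
  rewrite [X in X * _ = _]/Egamma -ge0_integralZr//; last 3 first.
  - by apply: measurable_funTS; measR.
  - by move=> t _; rewrite lee_fin mulr_ge0 ?powR_ge0 ?expR_ge0.
  - exact: Egamma_ge0.
  apply: eq_integral => t; rewrite inE/= in_itv/= andbT => t0.
  have -> : Egamma b = (t `^ b)%:E * \int[mu]_(y in `]0%R, +oo[)
      (y `^ (b - 1) * expR (- (t * y)))%:E.
    by rewrite Egamma_scale// muleA -EFinM -gt0_powRD// subrr powRr0 mul1e.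
  rewrite muleA -EFinM -ge0_integralZl_EFin//; last 3 first.
  - by move=> y _; rewrite lee_fin mulr_ge0 ?powR_ge0 ?expR_ge0.
  - by apply: measurable_funTS; measR.
  - by rewrite !mulr_ge0 ?powR_ge0 ?expR_ge0.
  apply: eq_integral => y _; rewrite -EFinM; congr EFin.
  have -> : (a + b - 1 = (a - 1) + b)%R by ring.
  rewrite (@gt0_powRD _ t (a - 1) b)// (_ : - ((1 + y) * t) = - t + - (t * y))%R ?expRD; first by ring.
  by ring.
rewrite ge0_tonelli_in//; last 2 first.
- by measR.
- by move=> t y; rewrite lee_fin !mulr_ge0 ?powR_ge0 ?expR_ge0.
rewrite /Ebeta -ge0_integralZl//; last 3 first.
- by apply: measurable_funTS; measR.
- by move=> y _; rewrite lee_fin mulr_ge0 ?powR_ge0.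
- exact: Egamma_ge0.
apply: eq_integral => y; rewrite inE/= in_itv/= andbT => y0.
have y10 : (0 < 1 + y)%R by rewrite addr_gt0.
rewrite EFinM muleC -muleA -(@Egamma_scale _ (a + b) (1 + y)%R y10).
rewrite -ge0_integralZl_EFin ?powR_ge0//; last 2 first.
- by move=> t _; rewrite lee_fin mulr_ge0 ?powR_ge0 ?expR_ge0.
- by apply: measurable_funTS; measR.
by apply: eq_integral => t _; rewrite -EFinM; congr EFin; ring.
Qed.

End Beta.

(** * Moments of the limit density *)

Section stable_moments.
Local Open Scope ereal_scope.
Context {R : realType}.
Local Notation mu := (@lebesgue_measure R).
Implicit Types a b t x y : R.

Lemma EFin_mul_divl a b (x : \bar R) : (0 < a)%R -> a%:E * x = b%:E ->
  x = (b / a)%:E.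
Proof.
move=> a0; case: x => [r| |].
- by rewrite -EFinM => -[<-]; congr EFin; field; rewrite gt_eqF.
- by rewrite gt0_muley ?lte_fin.
- by rewrite gt0_muleNy ?lte_fin.
Qed.

Lemma EbetaE a b : (0 < a)%R -> (0 < b)%R ->
  Ebeta a b = (Gamma a * Gamma b / Gamma (a + b))%:E.
Proof.
move=> a0 b0; apply: EFin_mul_divl; first by rewrite Gamma_gt0// addr_gt0.
by rewrite -EgammaE ?addr_gt0// -Egamma_beta !EgammaE.
Qed.

Lemma Ebeta_shift a b :
  \int[mu]_(x in `]0%R, +oo[)
    ((1 < x)%R%:R * ((x - 1) `^ (b - 1) * x `^ (- (a + b))))%:E = Ebeta a b.
Proof.
pose h x := ((x - 1) `^ (b - 1) * x `^ (- (a + b)))%R.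
transitivity (\int[mu]_(x in `]1%R, +oo[) (h x)%:E).
  exact: (integral_gtr h ler01).
rewrite /Ebeta [LHS]integral_mkcond [RHS]integral_mkcond.
rewrite (@ge0_integral_affine _ 1 1)//; last 2 first.
- apply/(measurable_restrictT _ _).1 => //; apply: measurable_funTS; rewrite /h; measR.
- by apply: erestrict_ge0 => x _; rewrite lee_fin mulr_ge0 ?powR_ge0.
apply: eq_integral => x _; rewrite normr1 mule1 !patchE !mem_setE !in_itv/= !andbT.
by rewrite mul1r ltrDr /h addrK [(x + 1)%R]addrC.
Qed.

Section moments.
Variables (alpha : R) (f : R -> R).
Hypotheses (alpha0 : (0 < alpha)%R) (mf : measurable_fun [set: R] f)
  (f0 : forall x, (0 <= f x)%R)
  (fL : forall l : R, (0 < l)%R ->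
    \int[mu]_(x in `]0%R, +oo[) (expR (- (l * x)) * f x)%:E =
      (expR (- (l `^ alpha)))%:E).

(** Gamma(b) x^(-b) is the integral of t^(b-1) exp (- x t) in t. Exchanging the integrals turns the
    density into its Laplace transform exp (- t^alpha), and u = t^alpha leaves a Gamma integral. *)
Lemma stable_neg_moment b : (0 < b)%R ->
  \int[mu]_(x in `]0%R, +oo[) (x `^ (- b) * f x)%:E =
  (Gamma (b / alpha) / (alpha * Gamma b))%:E.
Proof.
move=> b0.
have -> : (Gamma (b / alpha) / (alpha * Gamma b) =
  (Gamma (b / alpha) / alpha) / Gamma b)%R.
  by rewrite invfM mulrA.
apply: EFin_mul_divl; first exact: Gamma_gt0.
rewrite -EgammaE// -ge0_integralZl//; last 3 first.
- by apply: measurable_funTS; measR.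
- by move=> x _; rewrite lee_fin mulr_ge0 ?powR_ge0.
- exact: Egamma_ge0.
transitivity (\int[mu]_(x in `]0%R, +oo[) \int[mu]_(t in `]0%R, +oo[)
  (t `^ (b - 1) * expR (- (x * t)) * f x)%:E).
  apply: eq_integral => x; rewrite inE/= in_itv/= andbT => x0.
  rewrite muleC EFinM muleAC -Egamma_scale//.
  rewrite -ge0_integralZr//; last 3 first.
  - by apply: measurable_funTS; measR.
  - by move=> t _; rewrite lee_fin mulr_ge0 ?powR_ge0 ?expR_ge0.
  - by rewrite lee_fin.
rewrite ge0_tonelli_in//; last 2 first.
- apply/measurable_EFinP; apply: measurable_funM; first by measR.
  exact: (measurableT_comp mf).
- by move=> x t; rewrite lee_fin !mulr_ge0 ?powR_ge0 ?expR_ge0.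
transitivity (\int[mu]_(t in `]0%R, +oo[) (t `^ (b - 1) * expR (- (t `^ alpha)))%:E).
  apply: eq_integral => t; rewrite inE/= in_itv/= andbT => t0.
  rewrite EFinM -fL// -ge0_integralZl_EFin ?powR_ge0//; last 2 first.
  - by move=> x _; rewrite lee_fin mulr_ge0 ?expR_ge0.
  - by apply: measurable_funTS; measR.
  by apply: eq_integral => x _; rewrite -EFinM mulrA [(t * x)%R]mulrC.
rewrite (@ge0_integral_powR R 1 alpha^-1); last 4 first.
- by [].
- by rewrite invr_neq0 ?gt_eqF.
- by measR.
- by move=> t; rewrite lee_fin mulr_ge0 ?powR_ge0 ?expR_ge0.
have -> : (Gamma (b / alpha) / alpha)%:E = (alpha^-1)%:E * Egamma (b / alpha).
  by rewrite EgammaE ?divr_gt0// -EFinM mulrC.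
rewrite /Egamma.
rewrite -ge0_integralZl_EFin ?invr_ge0 ?(ltW alpha0)//; last 2 first.
- by move=> t _; rewrite lee_fin mulr_ge0 ?powR_ge0 ?expR_ge0.
- by apply: measurable_funTS; measR.
apply: eq_integral => u; rewrite inE/= in_itv/= andbT => u0.
rewrite -!EFinM !mul1r ger0_norm ?invr_ge0 ?(ltW alpha0)//.
rewrite -!powRrM mulVf ?gt_eqF// powRr1 ?(ltW u0)//.
have -> : (b / alpha - 1 = alpha^-1 * (b - 1) + (alpha^-1 - 1))%R by ring.
by rewrite (@gt0_powRD _ u (alpha^-1 * (b - 1)) (alpha^-1 - 1))//; congr EFin; ring.
Qed.

(** With z = v x^(- alpha) the quantity (z / v)^(1/alpha) becomes 1 / x and the condition z < v
    becomes x > 1: the kernel is then the beta integrand of [Ebeta_shift]. *)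
Lemma beta_kernel_moment v s c : (0 < v)%R ->
  \int[mu]_(z in `]0%R, +oo[) ((z < v)%R%:R *
    (z `^ (s - 1) * (1 - (z * v `^ (-1)) `^ (1 / alpha)) `^ (c - 1)))%:E =
  (alpha * v `^ s)%:E * Ebeta (alpha * s) c.
Proof.
move=> v0.
rewrite (@ge0_integral_powR R v (- alpha)); last 4 first.
- by [].
- by rewrite oppr_eq0 gt_eqF.
- by apply/measurable_EFinP; apply: measurable_funM; [exact: measurable_fun_ltR|measR].
- by move=> t; rewrite lee_fin !mulr_ge0 ?powR_ge0.
rewrite -Ebeta_shift -ge0_integralZl_EFin ?mulr_ge0 ?powR_ge0 ?(ltW alpha0)//; last 2 first.
- by move=> t _; rewrite lee_fin !mulr_ge0 ?powR_ge0.
- by apply: measurable_funTS; apply/measurable_EFinP; apply: measurable_funM; [exact: measurable_fun_ltR|measR].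
apply: eq_integral => x; rewrite inE/= in_itv/= andbT => x0.
have -> : (v * x `^ (- alpha) < v)%R = (1 < x)%R.
  rewrite powRN -ltr_pdivlMl// mulVf ?gt_eqF// invf_lt1 ?powR_gt0//.
  by have := @ltr_powRE _ alpha 1 x alpha0 ler01 (ltW x0); rewrite powR1.
have [x1|x1] := ltP 1%R x; last by rewrite !mul0r mul0e mule0.
rewrite !mul1r -!EFinM; congr EFin.
rewrite normrN gtr0_norm//.
have -> : (v * x `^ (- alpha) * v `^ (-1) = x `^ (- alpha))%R.
  by rewrite powR_inv1 ?(ltW v0)//; field; rewrite gt_eqF.
rewrite -(@powRrM _ x (- alpha) alpha^-1).
have -> : (- alpha * alpha^-1 = -1)%R by field; rewrite gt_eqF.
have -> : (1 - x `^ (-1) = (x - 1) * x `^ (-1))%R.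
  by rewrite powR_inv1 ?(ltW x0)//; field; rewrite gt_eqF.
rewrite !powRM ?powR_ge0 ?subr_ge0 ?(ltW x1) ?(ltW v0)// -!powRrM.
have -> : (- (alpha * s + c) = (- alpha * (s - 1) + -1 * (c - 1)) + (- alpha - 1))%R by ring.
rewrite (@gt0_powRD _ x (- alpha * (s - 1) + -1 * (c - 1)) (- alpha - 1))//.
rewrite (@gt0_powRD _ x (- alpha * (s - 1)) (-1 * (c - 1)))//.
have -> : (v `^ s = v `^ (s - 1) * v)%R.
  by rewrite -[X in (_ * X)%R]powRr1 ?(ltW v0)// -gt0_powRD// subrK.
by ring.
Qed.

(** With v = x^(- alpha) the argument of [f] becomes x, and what remains is the negative moment of
    order alpha s. The factor alpha v^s is the one produced by [beta_kernel_moment]. *)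
Lemma stable_power_moment s : (0 < s)%R ->
  \int[mu]_(v in `]0%R, +oo[)
    (f (v `^ (- (1 / alpha))) * v `^ (- (1 / alpha) - 1) * (alpha * v `^ s))%:E =
  (alpha * Gamma s / Gamma (alpha * s))%:E.
Proof.
move=> s0.
rewrite (@ge0_integral_powR R 1 (- alpha)); last 4 first.
- by [].
- by rewrite oppr_eq0 gt_eqF.
- apply/measurable_EFinP/measurable_funM; last by measR.
  by apply: measurable_funM; [apply: (measurableT_comp mf)|]; measR.
- by move=> t; rewrite lee_fin !mulr_ge0 ?powR_ge0// ltW.
have as0 : (0 < alpha * s)%R by exact: mulr_gt0.
have -> : (alpha * Gamma s / Gamma (alpha * s) = alpha ^+ 2 *
    (Gamma (alpha * s / alpha) / (alpha * Gamma (alpha * s))))%R.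
  rewrite [(alpha * s / alpha)%R]mulrAC divff ?gt_eqF// mul1r.
  move: (Gamma_gt0 as0); move: (Gamma s) (Gamma (alpha * s)) => A B B0.
  by field; rewrite (gt_eqF alpha0) gt_eqF.
rewrite EFinM -stable_neg_moment//.
rewrite -ge0_integralZl_EFin ?exprn_ge0 ?(ltW alpha0)//; last 2 first.
- by move=> t _; rewrite lee_fin mulr_ge0 ?powR_ge0.
- by apply: measurable_funTS; measR.
apply: eq_integral => x; rewrite inE/= in_itv/= andbT => x0.
rewrite -!EFinM !mul1r normrN gtr0_norm// -!powRrM.
have -> : (- alpha * - alpha^-1 = 1)%R by field; rewrite gt_eqF.
rewrite powRr1 ?(ltW x0)//.
have -> : (- alpha * (- alpha^-1 - 1) = 1 + alpha)%R by field; rewrite gt_eqF.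
have -> : (- (alpha * s) = (1 + alpha) + (- alpha * s) + (- alpha - 1))%R by ring.
rewrite (@gt0_powRD _ x (1 + alpha + - alpha * s) (- alpha - 1))//.
rewrite (@gt0_powRD _ x (1 + alpha) (- alpha * s))//.
by congr EFin; ring.
Qed.

End moments.
End stable_moments.

(** The conserved expectation evaluated at time n, where K_n = k: the rising factorial (theta/alpha
    + k)_s times its Gamma normalization. *)
Definition limit_moment {R : realType} (alpha theta : R) (n k s : nat) : R :=
  Gamma (theta / alpha + k%:R + s%:R) / Gamma (theta / alpha + k%:R) *
  (Gamma (theta + n%:R) / Gamma (theta + n%:R + s%:R * alpha)).

(** * The limit density: its moments and the law that it defines *)

Section limit_law.
Local Open Scope ereal_scope.
Context {R : realType}.
Local Notation mu := (@lebesgue_measure R).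
Variables (alpha theta : R) (n k : nat) (f : R -> R).
Hypotheses (halpha : (0 < alpha < 1)%R) (htheta : (- alpha < theta)%R)
  (hk : (1 <= k <= n)%N) (hf : stable_density alpha f).

Let D : set R := `]0%R, +oo[%classic.
Let mD : measurable D := measurable_itv _.
Let alpha0 : (0 < alpha)%R. Proof. by case/andP: halpha. Qed.

(** A stable density is only constrained on the positive half line; extending it by 0 makes it
    measurable and nonnegative everywhere. *)
Let fp : R -> R := f \_ D.

Let mfp : measurable_fun [set: R] fp.
Proof. by apply/(measurable_restrictT f mD); case: hf. Qed.

Let fpE x : (0 < x)%R -> fp x = f x.
Proof. by move=> x0; rewrite /fp patchE mem_setE in_itv/= x0. Qed.

Let fp0 x : (0 <= fp x)%R.
Proof.
rewrite /fp patchE; case: ifPn => //; rewrite mem_setE in_itv/= andbT.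
by case: hf => _ + _; exact.
Qed.

Let fpL l : (0 < l)%R ->
  \int[mu]_(x in D) (expR (- (l * x)) * fp x)%:E = (expR (- (l `^ alpha)))%:E.
Proof.
move=> l0; case: hf => _ _ <-; last exact: ltW.
by apply: eq_integral => x; rewrite mem_setE in_itv/= andbT => x0; rewrite fpE.
Qed.

Let c := (n%:R - k%:R * alpha)%R.
Let sg := (theta / alpha + k%:R)%R.

Let c0 : (0 < c)%R.
Proof.
rewrite subr_gt0; case/andP: halpha => _ a1; case/andP: hk => k0 kn.
apply: (@lt_le_trans _ _ k%:R); last by rewrite ler_nat.
by rewrite gtr_pMr ?ltr0n.
Qed.

Let sg0 : (0 < sg)%R.
Proof.
case/andP: hk => k0 kn; apply: (@lt_le_trans _ _ (theta / alpha + 1)%R).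
  by rewrite -ltrBlDr sub0r ltr_pdivlMr// mulN1r.
by rewrite lerD2l ler1n.
Qed.

Let thn0 : (0 < theta + n%:R)%R.
Proof.
case/andP: halpha => _ a1; case/andP: hk => k0 kn.
rewrite -ltrBlDr sub0r; apply: le_lt_trans htheta.
rewrite lerN2 (le_trans (ltW a1))// ler1n; exact: leq_trans kn.
Qed.

(** The inner integrand of the limit density as a function on the whole plane: the range v > z
    becomes an indicator, ready for Tonelli. *)
Let H (z v : R) : R := ((z < v)%R%:R *
  (1 - (z * v `^ (-1)) `^ (1 / alpha)) `^ (c - 1) *
  (fp (v `^ (- (1 / alpha))) * v `^ (- (1 / alpha) - 1)))%R.

Let H0 z v : (0 <= H z v)%R.
Proof. by rewrite !mulr_ge0 ?powR_ge0. Qed.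

Let mH : measurable_fun [set: R * R] (fun x => H x.1 x.2).
Proof.
apply: measurable_funM.
  by apply: measurable_funM; [exact: measurable_fun_ltR|measR].
by apply: measurable_funM; [apply: (measurableT_comp mfp)|]; measR.
Qed.

Let C := (Gamma (theta + n%:R) / (Gamma sg * Gamma c * alpha))%R.

Let C0 : (0 <= C)%R.
Proof. by rewrite divr_ge0 ?mulr_ge0 ?ltW ?Gamma_gt0. Qed.

Let g (z : R) : \bar R :=
  (C * z `^ (sg - 1))%:E * \int[mu]_(v in D) (H z v)%:E.

Let limit_densityE z : (0 < z)%R -> limit_density alpha theta n k f z = g z.
Proof.
move=> z0; rewrite /limit_density /g; congr (_ * _).
rewrite [LHS]integral_mkcond [RHS]integral_mkcond; apply: eq_integral => v _.
rewrite !patchE !mem_setE !in_itv/= !andbT /H.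
have [zv|vz] := ltP z v; last by rewrite !mul0r; case: ifP.
have v0 := lt_trans z0 zv.
by rewrite v0 powR_inv1 ?(ltW v0)// fpE ?powR_gt0// [(true%:R * _)%R]mul1r mulrA.
Qed.

Let g0 z : 0 <= g z.
Proof.
apply: mule_ge0; first by rewrite lee_fin (mulr_ge0 C0 (powR_ge0 _ _)).
by apply: integral_ge0 => v _; rewrite lee_fin.
Qed.

Let mg : measurable_fun [set: R] g.
Proof.
apply: emeasurable_funM; first by measR.
pose F (x : measurableTypeR R * measurableTypeR R) : \bar R :=
  (H x.1 x.2 * \1_D x.2)%:E.
have mF : measurable_fun setT F.
  apply/measurable_EFinP/measurable_funM; first exact: mH.
  exact: (measurableT_comp (measurable_indic mD)).
have F0 x : 0 <= F x by rewrite lee_fin; exact: mulr_ge0.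
rewrite (_ : (fun _ => _) = (fun z => \int[mu]_v F (z, v))).
  exact: (measurable_fun_fubini_tonelli_F (m2 := mu) F mF F0).
apply/funext => z; rewrite [LHS]integral_mkcond; apply: eq_integral => v _.
by rewrite patchE /F /= indicE; case: ifPn => _; rewrite ?mulr1 ?mulr0.
Qed.

(** Exchanging the integrals leaves a beta integral in z for fixed v, then a power moment of the
    stable factor in v. Gamma(alpha (sg + s)) cancels between the two, and alpha (sg + s) + c =
    theta + n + s alpha gives the remaining denominator. *)
Lemma moment_limit_density (s : nat) :
  \int[mu]_(z in D) ((z ^+ s)%:E * g z) = (limit_moment alpha theta n k s)%:E.
Proof.
pose sgs := (sg + s%:R)%R.
have sgs0 : (0 < sgs)%R by rewrite ltr_wpDr.
transitivity (\int[mu]_(z in D) \int[mu]_(v in D)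
    ((C * z `^ (sgs - 1)) * H z v)%:E).
  apply: eq_integral => z; rewrite mem_setE in_itv/= andbT => z0.
  rewrite /g muleA -EFinM -ge0_integralZl_EFin//; last 3 first.
  - by move=> v _; rewrite lee_fin.
  - apply: measurable_funTS; apply/measurable_EFinP.
    exact: (measurable_fun_pair2 z mH).
  - by rewrite mulr_ge0 ?exprn_ge0 ?(ltW z0)// (mulr_ge0 C0 (powR_ge0 _ _)).
  apply: eq_integral => v _; rewrite -EFinM; congr (_ * _)%:E.
  rewrite -powR_mulrn ?(ltW z0)//.
  have -> : (sgs - 1 = s%:R + (sg - 1))%R by rewrite /sgs; ring.
  by rewrite (@gt0_powRD _ z s%:R (sg - 1))//; ring.
rewrite ge0_tonelli_in//; last 2 first.
- by apply/measurable_EFinP; apply: measurable_funM => //; measR.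
- by move=> z v; rewrite lee_fin; exact: mulr_ge0 (mulr_ge0 C0 (powR_ge0 _ _)) (H0 _ _).
pose w v := (fp (v `^ (- (1 / alpha))) * v `^ (- (1 / alpha) - 1))%R.
have w0 v : (0 <= w v)%R by rewrite mulr_ge0 ?powR_ge0.
transitivity (\int[mu]_(v in D)
   ((C%:E * Ebeta (alpha * sgs) c) * (w v * (alpha * v `^ sgs))%:E)).
  apply: eq_integral => v; rewrite mem_setE in_itv/= andbT => v0.
  transitivity ((C * w v)%:E * ((alpha * v `^ sgs)%:E * Ebeta (alpha * sgs) c)); last first.
    rewrite muleA -EFinM -muleA [Ebeta _ _ * _]muleC muleA -EFinM.
    by congr (_%:E * _); ring.
  rewrite -(beta_kernel_moment alpha0 sgs c v0).
  rewrite -[RHS]ge0_integralZl_EFin; last 4 first.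
  - exact: mD.
  - by move=> z _; rewrite lee_fin !mulr_ge0 ?powR_ge0.
  - apply: measurable_funTS; apply/measurable_EFinP.
    by apply: measurable_funM; [exact: measurable_fun_ltR|measR].
  - exact: (mulr_ge0 C0 (w0 v)).
  by apply: eq_integral => z _; rewrite -EFinM /H /w; congr EFin; ring.
have as0 : (0 < alpha * sgs)%R by rewrite mulr_gt0.
rewrite EbetaE// -EFinM ge0_integralZl_EFin//; last 3 first.
- by move=> v _; rewrite lee_fin; apply: mulr_ge0 => //; apply: mulr_ge0; [exact: ltW|exact: powR_ge0].
- apply: measurable_funTS; apply/measurable_EFinP/measurable_funM; last by measR.
  by apply: measurable_funM; [apply: (measurableT_comp mfp)|]; measR.
- apply: (mulr_ge0 C0); apply: divr_ge0; last by apply/ltW/Gamma_gt0/addr_gt0.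
  by apply: mulr_ge0; rewrite ltW// Gamma_gt0.
rewrite /w (stable_power_moment alpha0 mfp fp0 fpL sgs0) -EFinM; congr EFin.
rewrite /limit_moment /C -/sg -/sgs.
have -> : (alpha * sgs + c = theta + n%:R + s%:R * alpha)%R.
  by rewrite /sgs /sg /c; field; rewrite gt_eqF.
have X0 : (0 < theta + n%:R + s%:R * alpha)%R.
  by rewrite ltr_wpDr ?mulr_ge0// ltW.
move: (Gamma_gt0 X0) (Gamma_gt0 as0) (Gamma_gt0 c0) (Gamma_gt0 sg0).
move: (Gamma _) (Gamma (alpha * sgs)) (Gamma c) (Gamma sg) (Gamma sgs) (Gamma (theta + n%:R)).
move=> G1 G2 G3 G4 G5 G6 G10 G20 G30 G40.
by field; rewrite !gt_eqF.
Qed.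

(** Total mass 1 is the moment of order 0, so no separate normalization is computed. Absolute
    moments are stated because the comparison of Laplace transforms asks for a variable that is
    nonnegative everywhere, and the identity of R is so only [nu]-almost everywhere. *)
Lemma limit_law_exists : exists nu : probability (measurableTypeR R) R,
  (forall A : set R, measurable A ->
     nu A = \int[mu]_(z in A `&` D) limit_density alpha theta n k f z) /\
  (forall s, \int[nu]_x (`|x| ^+ s)%:E = (limit_moment alpha theta n k s)%:E).
Proof.
pose gD := g \_ D.
have gD0 z : 0 <= gD z by apply: erestrict_ge0.
have mgD : measurable_fun [set: R] gD.
  by apply/(measurable_restrictT g mD); exact: measurable_funTS.
have m0 : limit_moment alpha theta n k 0 = 1%R.
  rewrite /limit_moment mul0r !addr0 !divff ?mulr1//; [exact/lt0r_neq0/Gamma_gt0|exact/lt0r_neq0/Gamma_gt0].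
have igD : \int[mu]_z gD z = 1.
  rewrite -integral_mkcond -[RHS](congr1 EFin m0) -moment_limit_density.
  by apply: eq_integral => z _; rewrite expr0 mul1e.
have gDfin : {ae mu, forall z, [set: R] z -> gD z \is a fin_num}.
  apply: (integrable_ae measurableT); apply/integrableP; split => //.
  under eq_integral do rewrite gee0_abs//.
  by rewrite igD ltry.
(* The limit density may be infinite on a null set; its real-valued version has the same
   integrals. *)
pose r z := fine (gD z).
have mr : measurable_fun [set: measurableTypeR R] r by exact: measurableT_comp.
have r0 z : (0 <= r z)%R by exact: fine_ge0.
have ir A (h : R -> \bar R) : measurable A -> measurable_fun [set: R] h ->
    (forall z, 0 <= h z) ->
    \int[mu]_(z in A) (h z * (r z)%:E) = \int[mu]_(z in A) (h z * gD z).
  move=> mA mh h0; apply: ge0_ae_eq_integral => //.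
  - by apply: emeasurable_funM; apply: measurable_funTS => //; exact/measurable_EFinP.
  - by apply: emeasurable_funM; apply: measurable_funTS.
  - by move=> z _; rewrite mule_ge0 ?lee_fin.
  - by move=> z _; rewrite mule_ge0.
  - apply: filterS gDfin; first exact: (ae_filter_ringOfSetsType mu).
    by move=> z /(_ I) zfin _; rewrite /r fineK.
pose nu := density_measure mu mr r0.
have nuA (A : set R) : measurable A -> nu A = \int[mu]_(z in A) gD z.
  move=> mA; rewrite /nu /density_measure.
  under eq_integral do rewrite -[(r _)%:E]mul1e.
  by rewrite (ir A (cst 1))//; under eq_integral do rewrite mul1e.
have nuT : nu setT = 1 by rewrite nuA.
pose nuM := Measure_isProbability.Build _ _ _ nu nuT.
pose P : probability (measurableTypeR R) R := HB.pack nu nuM.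
exists P; split.
  move=> A mA; rewrite -[LHS]/(nu A) nuA// [RHS]integral_mkcondr.
  apply: eq_integral => z _; rewrite /gD !patchE; case: ifPn => //.
  by rewrite mem_setE in_itv/= andbT => /limit_densityE.
move=> s; rewrite -moment_limit_density [RHS]integral_mkcond.
have mXs : measurable_fun [set: R] (fun z : R => (`|z| ^+ s)%:E).
  by apply/measurable_EFinP; apply: measurable_funX; exact: normr_measurable.
rewrite -[LHS]/(\int[nu]_x (`|x| ^+ s)%:E) ge0_integral_density//.
rewrite (ir setT (fun z => (`|z| ^+ s)%:E))//.
apply: eq_integral => z _; rewrite /gD !patchE.
case: ifPn => zD; last by rewrite mule0.
by move: zD; rewrite mem_setE in_itv/= andbT => z0; rewrite gtr0_norm.
Qed.

End limit_law.

(** * Laplace transforms determine laws *)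

Section sharp_cutoff.
Context {R : realType}.
Implicit Types (u w r : R) (N M : nat).

Lemma bernoulli_ineq u M : -1 <= u -> 1 + M%:R * u <= (1 + u) ^+ M.
Proof.
move=> u1; elim: M => [|M ih]; first by rewrite mul0r addr0 expr0.
have u10 : 0 <= 1 + u by rewrite -lerBlDl sub0r.
rewrite exprS; apply: le_trans (ler_wpM2l u10 ih).
rewrite -natr1 -subr_ge0.
have -> : (1 + u) * (1 + M%:R * u) - (1 + (M%:R + 1) * u) = M%:R * u ^+ 2 by ring.
by rewrite mulr_ge0 ?sqr_ge0.
Qed.

(** Split r^N as s^N s^N with s the square root of r: Bernoulli's inequality for 1 / s bounds N s^N,
    and the other factor tends to 0. *)
Lemma cvg_natmul_expr r : 0 <= r < 1 -> N%:R * r ^+ N @[N --> \oo] --> (0 : R).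
Proof.
move=> /andP[r0 r1].
have [->|rn0] := eqVneq r 0.
  apply: cvg_near_cst; exists 1%N => // N /= N1.
  by rewrite expr0n eqn0Ngt N1 mulr0.
pose s := Num.sqrt r.
have s0 : 0 < s by rewrite sqrtr_gt0 lt_neqAle eq_sym rn0.
have s1 : s < 1 by rewrite -sqrtr1 ltr_sqrt.
pose h := s^-1 - 1.
have h0 : 0 < h by rewrite subr_gt0 invf_gt1.
apply: (@squeeze_cvgr _ _ _ _ (cst 0) (geometric h^-1 s)).
- apply: nearW => N; rewrite /= mulr_ge0 ?exprn_ge0//=.
  have -> : r ^+ N = s ^+ N * s ^+ N by rewrite -exprMn -expr2 sqr_sqrtr.
  rewrite mulrA ler_wpM2r ?exprn_ge0 ?(ltW s0)//.
  rewrite -(ler_pM2r h0) mulVf ?gt_eqF//.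
  have := @bernoulli_ineq h N; rewrite (_ : 1 + h = s^-1); last by rewrite /h; ring.
  rewrite exprVn => H.
  have sN : 0 < s ^+ N by rewrite exprn_gt0.
  rewrite mulrAC -ler_pdivlMr// mul1r; apply: le_trans (H _).
    by rewrite lerDr.
  by rewrite (le_trans _ (ltW h0))// lerN10.
- exact: cvg_cst.
- by apply: cvg_geometric; rewrite ger0_norm ?ltW.
Qed.

(* The exponent N * 2 ^ N puts the jump at w = 1/2 with limit value 0 there. *)
Definition cutoff N w : R := (1 - w ^+ N) ^+ (N * 2 ^ N).

Lemma cutoff_itv N w : 0 <= w <= 1 -> 0 <= cutoff N w <= 1.
Proof.
move=> /andP[w0 w1]; rewrite /cutoff.
have wN : 0 <= 1 - w ^+ N by rewrite subr_ge0 exprn_ile1.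
by rewrite exprn_ge0//= exprn_ile1// lerBlDr lerDl exprn_ge0.
Qed.

(** Below 1/2, Bernoulli bounds the value below by 1 - N (2 w)^N. From 1/2 on, multiplying by (1 +
    w^N)^(N 2^N), which is at least 1 + N, still gives at most 1, since (1 - w^N) (1 + w^N) <= 1. *)
Lemma cvg_cutoff w : 0 <= w <= 1 ->
  cutoff N w @[N --> \oo] --> ((w < 2^-1)%R%:R : R).
Proof.
move=> w01; have /andP[w0 w1] := w01.
have NwE N : (N * 2 ^ N)%:R * w ^+ N = N%:R * (2 * w) ^+ N.
  by rewrite natrM natrX exprMn mulrA.
have [wlt|wge] := ltP w 2^-1.
  apply: (@squeeze_cvgr _ _ _ _ (fun N => 1 - N%:R * (2 * w) ^+ N) (cst 1)).
  - apply: nearW => N.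
    have /andP[_ ->] := cutoff_itv N w01.
    rewrite andbT -NwE -mulrN; apply: bernoulli_ineq.
    by rewrite lerN2 exprn_ile1.
  - rewrite -[X in _ --> X]subr0; apply: cvgB; first exact: cvg_cst.
    apply: cvg_natmul_expr; rewrite mulr_ge0//=.
    by rewrite mulrC -ltr_pdivlMr// mul1r.
  - exact: cvg_cst.
apply: (@squeeze_cvgr _ _ _ _ (cst 0) (fun N => (N.+1)%:R^-1)).
- apply: nearW => N.
  have /andP[-> _] /= := cutoff_itv N w01.
  rewrite -[leRHS]mul1r ler_pdivlMr//.
  have wN1 : w ^+ N <= 1 by rewrite exprn_ile1.
  have wN0 : 0 <= w ^+ N by rewrite exprn_ge0.
  apply: (@le_trans _ _ (cutoff N w * (1 + w ^+ N) ^+ (N * 2 ^ N))).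
    apply: ler_wpM2l; first by have /andP[] := cutoff_itv N w01.
    apply: le_trans (bernoulli_ineq _ _); last by rewrite (le_trans _ wN0)// lerN10.
    rewrite NwE -natr1 addrC lerD2l ler_peMr// exprn_ege1//.
    by rewrite mulrC -ler_pdivrMr// mul1r.
  rewrite /cutoff -exprMn exprn_ile1//.
    by rewrite mulr_ge0 ?subr_ge0// addr_ge0.
  rewrite -subr_ge0 (_ : _ - _ = (w ^+ N) ^+ 2); last by ring.
  by rewrite sqr_ge0.
- exact: cvg_cst.
- exact: cvg_harmonic.
Qed.

End sharp_cutoff.

Section laplace_transform.
Local Open Scope ereal_scope.
Context {R : realType}.

Section one_variable.
Context d (T : measurableType d) (P : probability T R) (X : T -> R).
Hypotheses (mX : measurable_fun [set: T] X) (X0 : forall w, (0 <= X w)%R).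

Definition laplace t : \bar R := \int[P]_w (expR (- (t * X w)))%:E.

Lemma integrable_bounded (h : T -> R) (C : R) :
  measurable_fun [set: T] h -> (forall w, (`|h w| <= C)%R) ->
  P.-integrable [set: T] (EFin \o h).
Proof.
move=> mh hC; apply: (@le_integrable _ _ _ P _ measurableT _ (EFin \o cst C)).
- exact/measurable_EFinP.
- by move=> w _ /=; rewrite lee_fin (le_trans (hC w))// ler_norm.
- exact: finite_measure_integrable_cst.
Qed.

(** At rate ln 2 / c the exponential is below 1/2 exactly when X exceeds c. Tail probabilities are
    thus limits of expectations of polynomials in one exponential of X. *)
Lemma cvg_integral_cutoff (c : R) : (0 < c)%R ->
  (\int[P]_w (cutoff N (expR (- (ln 2 / c * X w))))%:E) @[N --> \oo] -->
  P [set w | (c < X w)%R].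
Proof.
move=> c0; set e := fun w => expR (- (ln 2 / c * X w)).
have l20 : (0 < ln 2 :> R)%R by rewrite ln_gt0// ltr1n.
have e01 w : (0 <= e w <= 1)%R.
  rewrite expR_ge0/= -expR0 ler_expR oppr_le0 mulr_ge0//.
  by rewrite divr_ge0 ?ltW.
have me : measurable_fun [set: T] e.
  apply: measurableT_comp => //; apply: measurableT_comp => //.
  exact: measurable_funM.
have mcut N : measurable_fun [set: T] (fun w => cutoff N (e w)).
  apply: measurable_funX; apply: measurable_funB => //; exact: measurable_funX.
have mS : measurable [set w | (c < X w)%R].
  by rewrite -[X in measurable X]setTI; exact: (measurable_fun_ltr (measurable_cst c) mX).
have eE w : (e w < 2^-1)%R = (c < X w)%R.
  have -> : (2^-1 = expR (- ln 2) :> R)%R by rewrite expRN lnK// posrE.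
  by rewrite ltr_expR ltrN2 mulrAC ltr_pdivlMr// ltr_pM2l.
have -> : P [set w | (c < X w)%R] = \int[P]_w ((e w < 2^-1)%R%:R)%:E.
  rewrite -(setIT [set w | _]) -integral_indic//.
  by apply: eq_integral => w _; rewrite indicE mem_setE eE.
have [] := @dominated_convergence _ _ _ P [set: T] measurableT
  (fun N w => (cutoff N (e w))%:E) (fun w => ((e w < 2^-1)%R%:R)%:E) (cst 1).
- by move=> N; exact/measurable_EFinP.
- apply/measurable_EFinP; rewrite (_ : (fun w => _) = \1_[set w | (c < X w)%R]).
    exact: measurable_indic.
  by apply/funext => w; rewrite indicE mem_setE eE.
- apply: aeW => w _; apply: cvg_EFin; first exact: nearW.
  exact: cvg_cutoff.
- exact: finite_measure_integrable_cst.
- apply: aeW => w N _; have /andP[h0 h1] := cutoff_itv N (e01 w).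
  by rewrite gee0_abs lee_fin.
by [].
Qed.

End one_variable.

Section two_variables.
Context d1 (T1 : measurableType d1) (P : probability T1 R) (X : T1 -> R)
        d2 (T2 : measurableType d2) (Q : probability T2 R) (Y : T2 -> R).
Hypotheses (mX : measurable_fun [set: T1] X) (X0 : forall w, (0 <= X w)%R)
           (mY : measurable_fun [set: T2] Y) (Y0 : forall w, (0 <= Y w)%R).
Hypothesis laplaceXY : forall t, (0 <= t)%R -> laplace P X t = laplace Q Y t.

(** The j-th power of exp (- t X) is exp (- j t X), so expectations of polynomials in it are
    combinations of Laplace transform values at multiples of t. *)
Lemma integral_poly_expR_eq (p : {poly R}) t : (0 <= t)%R ->
  \int[P]_w (p.[expR (- (t * X w))])%:E = \int[Q]_w (p.[expR (- (t * Y w))])%:E.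
Proof.
move=> t0.
(* The extra power absorbs the indeterminate when the induction passes from p to p X + c. *)
suff H : forall j : nat,
    \int[P]_w (p.[expR (- (t * X w))] * expR (- (t * X w)) ^+ j)%:E =
    \int[Q]_w (p.[expR (- (t * Y w))] * expR (- (t * Y w)) ^+ j)%:E.
  have := H 0%N; under eq_integral do rewrite expr0 mulr1.
  by move=> ->; apply: eq_integral => w _; rewrite expr0 mulr1.
have aux dd (T : measurableType dd) (S : probability T R) (Z : T -> R) :
    measurable_fun [set: T] Z -> (forall w, (0 <= Z w)%R) ->
    forall (q : {poly R}) j, S.-integrable [set: T]
      (EFin \o (fun w => q.[expR (- (t * Z w))] * expR (- (t * Z w)) ^+ j)%R).
  move=> mZ Z0 q j.
  have me : measurable_fun [set: T] (fun w => expR (- (t * Z w))).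
    apply: measurableT_comp => //; apply: measurableT_comp => //.
    exact: measurable_funM.
  apply: (@integrable_bounded _ _ S _ (\sum_(i < size q) `|q`_i|)%R).
    apply: measurable_funM; last exact: measurable_funX.
    under eq_fun do rewrite horner_coef.
    apply: measurable_sum => i; apply: measurable_funM => //.
    exact: measurable_funX.
  move=> w; have e01 : (0 <= expR (- (t * Z w)) <= 1)%R.
    by rewrite expR_ge0 -expR0 ler_expR oppr_le0 mulr_ge0.
  have eX i : (`|expR (- (t * Z w)) ^+ i| <= 1)%R.
    have /andP[e0 e1] := e01.
    by rewrite ger0_norm ?exprn_ge0// exprn_ile1.
  rewrite normrM; apply: le_trans (ler_wpM2l (normr_ge0 _) (eX j)) _.
  rewrite mulr1 horner_coef (le_trans (ler_norm_sum _ _ _))//.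
  apply: ler_sum => i _; rewrite normrM.
  by apply: le_trans (ler_wpM2l (normr_ge0 _) (eX i)) _; rewrite mulr1.
elim/poly_ind: p => [j|p c IH j].
  by under eq_integral do rewrite horner0 mul0r;
     under [RHS]eq_integral do rewrite horner0 mul0r; rewrite !integral0.
have E dd (T : measurableType dd) (S : probability T R) (Z : T -> R) :
    measurable_fun [set: T] Z -> (forall w, (0 <= Z w)%R) ->
    \int[S]_w ((p * 'X + c%:P).[expR (- (t * Z w))] * expR (- (t * Z w)) ^+ j)%:E =
    \int[S]_w (p.[expR (- (t * Z w))] * expR (- (t * Z w)) ^+ j.+1)%:E +
    c%:E * laplace S Z (j%:R * t).
  move=> mZ Z0.
  have i1 := aux _ _ S Z mZ Z0 p j.+1.
  have i2 := aux _ _ S Z mZ Z0 1%:P%R j.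
  rewrite /laplace -integralZl//; last first.
    apply: eq_integrable i2 => // w _ /=; rewrite hornerC mul1r -expRM_natl.
    by rewrite mulrN mulrA.
  rewrite -integralD//; last first.
    apply: integrableZl => //.
    apply: eq_integrable i2 => // w _ /=; rewrite hornerC mul1r -expRM_natl.
    by rewrite mulrN mulrA.
  apply: eq_integral => w _ /=; rewrite -EFinM -EFinD; congr EFin.
  have -> : expR (- (j%:R * t * Z w)) = (expR (- (t * Z w)) ^+ j)%R.
    by rewrite -expRM_natl mulrN mulrA.
  rewrite hornerMXaddC exprS.
  by ring.
by rewrite !E// IH laplaceXY// mulr_ge0.
Qed.

Let ccdf_eq c : (0 < c)%R ->
  P [set w | (c < X w)%R] = Q [set w | (c < Y w)%R].
Proof.
move=> c0.
have t0 : (0 <= ln 2 / c :> R)%R by rewrite divr_ge0 ?ln_ge0 ?ler1n// ltW.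
have HX := @cvg_integral_cutoff _ _ P X mX X0 c c0.
have HY := @cvg_integral_cutoff _ _ Q Y mY Y0 c c0.
rewrite -(cvg_lim _ HX)// -(cvg_lim _ HY)//; congr (lim (_ @ \oo)).
apply/funext => N.
have := integral_poly_expR_eq ((1 - 'X^N) ^+ (N * 2 ^ N))%R t0.
under eq_integral do rewrite horner_exp !hornerE.
under [in RHS]eq_integral do rewrite horner_exp !hornerE.
by move=> ->.
Qed.

(** The rate ln 2 / c requires c > 0; c = 0 is reached along 1 / (n + 1), and for c < 0 the events
    are certain. *)
Let ccdf_eq_all c : P [set w | (c < X w)%R] = Q [set w | (c < Y w)%R].
Proof.
have [c0|c0] := ltP 0%R c; first exact: ccdf_eq.
have mset dd (T : measurableType dd) (Z : T -> R) a :
    measurable_fun [set: T] Z -> measurable [set w | (a < Z w)%R].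
  move=> mZ; rewrite -[X in measurable X]setTI.
  exact: (measurable_fun_ltr (measurable_cst a) mZ).
case: (ltgtP c 0%R) c0 => // [c0|->] _.
  have -> : [set w | (c < X w)%R] = [set: T1].
    by apply/seteqP; split => // w _ /=; exact: lt_le_trans (X0 w).
  have -> : [set w | (c < Y w)%R] = [set: T2].
    by apply/seteqP; split => // w _ /=; exact: lt_le_trans (Y0 w).
  by rewrite !probability_setT.
have bigE T (Z : T -> R) :
    [set w | (0 < Z w)%R] = \bigcup_n [set w | (n.+1%:R^-1 < Z w)%R].
  apply/seteqP; split => w /=.
    move=> Zw; exists (Num.truncn (Z w)^-1) => //=.
    by rewrite invf_plt ?posrE// truncnS_gt.
  by move=> [n _] /=; apply: lt_trans; rewrite invr_gt0.
have cvgE dd (T : measurableType dd) (S : probability T R) (Z : T -> R) :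
    measurable_fun [set: T] Z ->
    S [set w | (n.+1%:R^-1 < Z w)%R] @[n --> \oo] --> S [set w | (0 < Z w)%R].
  move=> mZ; rewrite bigE; apply: nondecreasing_cvg_mu.
  - by move=> n; exact: mset.
  - by apply: bigcupT_measurable => n; exact: mset.
  - move=> m n mn; apply/subsetPset => w /=; apply: le_lt_trans.
    by rewrite lef_pV2 ?posrE// ler_nat.
rewrite -(cvg_lim _ (cvgE _ _ P X mX))// -(cvg_lim _ (cvgE _ _ Q Y mY))//.
congr (lim (_ @ \oo)); apply/funext => n.
by rewrite ccdf_eq// invr_gt0.
Qed.

Lemma laplace_inj (A : set R) : measurable A -> P (X @^-1` A) = Q (Y @^-1` A).
Proof.
move=> mA.
pose X' : {mfun T1 >-> measurableTypeR R} :=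
  HB.pack X (isMeasurableFun.Build _ _ T1 (measurableTypeR R) X mX).
pose Y' : {mfun T2 >-> measurableTypeR R} :=
  HB.pack Y (isMeasurableFun.Build _ _ T2 (measurableTypeR R) Y mY).
have mset dd (T : measurableType dd) (Z : T -> R) a :
    measurable_fun [set: T] Z -> measurable [set w | (a < Z w)%R].
  move=> mZ; rewrite -[X in measurable X]setTI.
  exact: (measurable_fun_ltr (measurable_cst a) mZ).
have itvE dd (T : measurableType dd) (S : probability T R) (Z : T -> R) a b :
    measurable_fun [set: T] Z -> (a < b)%R ->
    S (Z @^-1` `]a, b]%classic) =
    S [set w | (a < Z w)%R] - S [set w | (b < Z w)%R].
  move=> mZ ab.
  have -> : Z @^-1` `]a, b]%classic =
      [set w | (a < Z w)%R] `\` [set w | (b < Z w)%R].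
    apply/seteqP; split => w /=; rewrite in_itv/=.
      by move=> /andP[-> h]; split => //; apply/negP; rewrite -leNgt.
    by move=> [-> /negP]; rewrite -leNgt.
  rewrite measureD ?setIidr//; try exact: mset.
    by move=> w /=; exact: lt_trans.
  by rewrite ltey_eq fin_num_measure//; exact: mset.
apply: (@measureR_unique R (pushforward P X') (pushforward Q Y')) => //.
- move=> a b ab; rewrite /pushforward.
  by rewrite [LHS]itvE// [RHS]itvE// !ccdf_eq_all.
- move=> a b ab; rewrite /pushforward.
  by rewrite ltey_eq fin_num_measure//; exact: (measurable_funPTI X').
Qed.

End two_variables.
End laplace_transform.

(** * Comparison of Laplace transforms through finitely many moments *)

Section exponential_remainder.
Context {R : realType}.
Implicit Types (x : R) (J : nat).

(* Up to the sign (-1) ^ J this is the remainder after J terms of the Taylor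
   series of exp (- x) at 0. *)
Fixpoint expRN_rem J x : R :=
  if J is J'.+1 then x ^+ J' / J'`!%:R - expRN_rem J' x else expR (- x).

Lemma is_derive_expRN_rem J x : is_derive x 1 (expRN_rem J.+1) (expRN_rem J x).
Proof.
elim: J => [|J IH].
  rewrite [X in is_derive _ _ X _](_ : _ = (fun y => 1 - expR (- y))); last first.
    by apply/funext => y /=; rewrite expr0 divr1.
  by apply: is_derive_eq; rewrite /=; ring.
have h1 : is_derive x 1 (fun y : R => y ^+ J.+1) (J.+1%:R * x ^+ J).
  rewrite (_ : (fun y : R => y ^+ J.+1) = @id R ^+ J.+1); last first.
    by apply/funext => y; rewrite exprfctE.
  apply: (is_derive_eq (is_deriveX J.+1 (is_derive_id x (1 : R)))).
  by rewrite /GRing.scale /= mulr1.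
have h2 := is_deriveB (is_deriveZ (J.+1)`!%:R^-1 h1) IH.
rewrite (_ : expRN_rem J.+2 =
  (J.+1)`!%:R^-1 \*: (fun y : R => y ^+ J.+1) - expRN_rem J.+1); last first.
  by apply/funext => y; rewrite /= /GRing.scale /= mulrC.
apply: (is_derive_eq h2).
rewrite /= factS natrM /GRing.scale /=.
congr (_ - _); rewrite invfM.
have J0 : J.+1%:R != 0 :> R by rewrite pnatr_eq0.
have F0 : J`!%:R != 0 :> R by rewrite pnatr_eq0 -lt0n fact_gt0.
move: (J.+1%:R) (J`!%:R) J0 F0 => a b a0 b0.
by field; rewrite ?a0 ?b0.
Qed.

(** Each remainder has the previous one as derivative and, after the first, vanishes at 0;
    nonnegativity therefore propagates by monotonicity. *)
Lemma expRN_rem_ge0 J x : 0 <= x -> 0 <= expRN_rem J x.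
Proof.
elim: J x => [x _|J IH x x0]; first exact: expR_ge0.
have R0 : expRN_rem J.+1 0 >= 0.
  case: J {IH} => [|J]; first by rewrite /= expr0 divr1 oppr0 expR0 subrr.
  have E j : expRN_rem j.+1 0 = 0.
    elim: j => [|j ih]; first by rewrite /= expr0 divr1 oppr0 expR0 subrr.
    by rewrite [LHS]/= -/(expRN_rem j.+1 0) ih expr0n mul0r subrr.
  by rewrite E.
apply: le_trans R0 _.
apply: (@ger0_derive1_ndecry _ (expRN_rem J.+1) 0) => //.
- by move=> y _; case: (is_derive_expRN_rem J y).
- move=> y; rewrite in_itv/= andbT => y0.
  rewrite derive1E; case: (is_derive_expRN_rem J y) => _ ->.
  exact/IH/ltW.
- apply: continuous_subspaceT => y.
  apply: differentiable_continuous; apply/derivable1_diffP.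
  by case: (is_derive_expRN_rem J y).
Qed.

End exponential_remainder.

Section laplace_moments.
Context {R : realType}.

Section one_variable.
Context d (T : measurableType d) (P : probability T R) (X : T -> R) (m : nat -> R).
Hypotheses (mX : measurable_fun [set: T] X) (X0 : forall w, (0 <= X w)%R)
  (momX : forall j, (\int[P]_w (X w ^+ j)%:E = (m j)%:E)%E).
Variables (t : R) (t0 : 0 <= t).

Lemma integrable_moment j : P.-integrable [set: T] (EFin \o (fun w => X w ^+ j)).
Proof.
apply/integrableP; split; first by apply/measurable_EFinP; exact: measurable_funX.
under eq_integral => w _ do rewrite /= ger0_norm ?exprn_ge0//.
by rewrite momX ltry.
Qed.

Lemma expRN_remSE J w : expRN_rem J.+1 (t * X w) =
  t ^+ J / J`!%:R * X w ^+ J - expRN_rem J (t * X w).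
Proof. by rewrite /= exprMn; congr (_ - _); rewrite mulrAC. Qed.

Lemma integrable_expRN_rem J :
  P.-integrable [set: T] (EFin \o (fun w => expRN_rem J (t * X w))).
Proof.
elim: J => [|J IH].
  apply: (@integrable_bounded _ _ _ P _ 1).
    rewrite -[X in measurable_fun _ X]/(fun w => expR (- (t * X w))); apply: measurableT_comp => //; apply: measurableT_comp => //.
    exact: measurable_funM.
  move=> w /=; rewrite ger0_norm ?expR_ge0// -expR0 ler_expR oppr_le0.
  exact: mulr_ge0.
have := integrableB measurableT (integrableZl measurableT
  (t ^+ J / J`!%:R) (integrable_moment J)) IH.
apply: eq_integrable => // w _.
by rewrite [RHS]/= -/(expRN_rem J.+1 (t * X w)) expRN_remSE.
Qed.

Definition mean_rem J : R := \int[P]_w (expRN_rem J (t * X w)).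

Lemma mean_rem_ge0 J : 0 <= mean_rem J.
Proof.
apply: Rintegral_ge0 => w _; apply: expRN_rem_ge0; exact: mulr_ge0.
Qed.

Lemma mean_remS J : mean_rem J.+1 = t ^+ J / J`!%:R * m J - mean_rem J.
Proof.
have -> : m J = \int[P]_w (X w ^+ J) by rewrite /Rintegral momX.
rewrite -RintegralZl//; last exact: integrable_moment.
rewrite -RintegralB//; last 2 first.
- exact: (integrableZl measurableT (t ^+ J / J`!%:R) (integrable_moment J)).
- exact: integrable_expRN_rem.
by apply: eq_Rintegral => w _; rewrite expRN_remSE.
Qed.

Lemma mean_rem0 : laplace P X t = (mean_rem 0)%:E.
Proof.
rewrite /mean_rem /laplace /Rintegral fineK//.
exact: (integrable_fin_num _ (integrable_expRN_rem 0)).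
Qed.

End one_variable.

(** Unrolling [mean_remS] J times produces the sum of moment differences. The last mean remainder
    lies between 0 and t^J / J! times the J-th moment, because the next one is nonnegative. Only
    moments up to order J occur, so the bound survives a limit taken in the moments. *)
Lemma laplace_moment_dist
  d1 (T1 : measurableType d1) (P : probability T1 R) (X : T1 -> R) (m1 : nat -> R)
  d2 (T2 : measurableType d2) (Q : probability T2 R) (Y : T2 -> R) (m2 : nat -> R)
  (t : R) (J : nat) :
  measurable_fun [set: T1] X -> (forall w, (0 <= X w)%R) ->
  (forall j, (\int[P]_w (X w ^+ j)%:E = (m1 j)%:E)%E) ->
  measurable_fun [set: T2] Y -> (forall w, (0 <= Y w)%R) ->
  (forall j, (\int[Q]_w (Y w ^+ j)%:E = (m2 j)%:E)%E) ->
  0 <= t ->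
  `|fine (laplace P X t) - fine (laplace Q Y t)| <=
    \sum_(j < J) t ^+ j / j`!%:R * `|m1 j - m2 j| +
    t ^+ J / J`!%:R * (m1 J + m2 J).
Proof.
move=> mX X0 momX mY Y0 momY t0.
rewrite (mean_rem0 mX X0 momX t0) (mean_rem0 mY Y0 momY t0) /=.
set dX := mean_rem P X t; set dY := mean_rem Q Y t.
have tj j : 0 <= t ^+ j / j`!%:R by rewrite divr_ge0 ?exprn_ge0.
have H1 K : `|dX 0%N - dY 0%N| <=
    \sum_(j < K) t ^+ j / j`!%:R * `|m1 j - m2 j| + `|dX K - dY K|.
  elim: K => [|K IH]; first by rewrite big_ord0 add0r.
  apply: (le_trans IH); rewrite big_ord_recr/= -addrA lerD2l.
  rewrite /dX /dY (mean_remS mX X0 momX t0) (mean_remS mY Y0 momY t0) -/dX -/dY.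
  move: (t ^+ K / K`!%:R) (tj K) => a a0.
  have -> : a * `|m1 K - m2 K| = `|a * (m1 K - m2 K)| by rewrite normrM ger0_norm.
  (* Solves the recursion for the difference at K, so that the triangle inequality moves it to K +
     1. *)
  have -> : dX K - dY K = a * (m1 K - m2 K) - (a * m1 K - dX K - (a * m2 K - dY K)) by ring.
  by rewrite (le_trans (ler_normB _ _)).
apply: (le_trans (H1 J)); rewrite lerD2l.
have H2 : dX J <= t ^+ J / J`!%:R * m1 J.
  have := mean_rem_ge0 P X0 t0 J.+1.
  by rewrite (mean_remS mX X0 momX t0) subr_ge0.
have H3 : dY J <= t ^+ J / J`!%:R * m2 J.
  have := mean_rem_ge0 Q Y0 t0 J.+1.
  by rewrite (mean_remS mY Y0 momY t0) subr_ge0.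
have H4 : 0 <= dX J by exact: mean_rem_ge0.
have H5 : 0 <= dY J by exact: mean_rem_ge0.
rewrite (le_trans (ler_normB _ _))// !ger0_norm// mulrDr.
exact: lerD.
Qed.

End laplace_moments.

(** * The one-step prediction rule *)

Definition wid N (i : 'I_N) : 'I_N.+1 := widen_ord (leqnSn N) i.

Lemma wid_inj N : injective (@wid N).
Proof. by move=> i j /(congr1 val) /= /val_inj. Qed.

Lemma wid_max N (i : 'I_N) : wid i != ord_max.
Proof. by rewrite -val_eqE/= neq_ltn ltn_ord. Qed.

Lemma ordS_case N (i : 'I_N.+1) : i = ord_max \/ exists j : 'I_N, i = wid j.
Proof.
have [iN|] := ltnP i N; first by right; exists (Ordinal iN); apply: val_inj.
move=> Ni; left; apply: val_inj; apply/eqP => /=.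
by rewrite eqn_leq Ni andbT -ltnS ltn_ord.
Qed.

Definition add_singleton N (Q : {set {set 'I_N}}) : {set {set 'I_N.+1}} :=
  ([set ord_max] |: [set (@wid N) @: B | B : {set 'I_N} in Q])%SET.

Lemma wid_imset_inj N : injective (fun B : {set 'I_N} => ((@wid N) @: B)%SET).
Proof. exact/imset_inj/wid_inj. Qed.

Lemma max_notin N (Q : {set {set 'I_N}}) :
  [set ord_max]%SET \notin [set (@wid N) @: B | B : {set 'I_N} in Q]%SET.
Proof.
apply/imsetP => -[B _ /setP/(_ ord_max)]; rewrite inE eqxx => /esym/imsetP[i _].
by move/esym/eqP; rewrite (negbTE (wid_max i)).
Qed.

Lemma card_add_singleton N (Q : {set {set 'I_N}}) : #|add_singleton Q| = #|Q|.+1.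
Proof. by rewrite /add_singleton cardsU1 max_notin (card_imset _ (@wid_imset_inj N)). Qed.

Lemma add_singleton_inj N : injective (@add_singleton N).
Proof.
move=> Q Q' E; apply: (imset_inj (@wid_imset_inj N)).
have H (A : {set {set 'I_N}}) : [set (@wid N) @: B | B : {set 'I_N} in A]%SET =
    (add_singleton A :\ [set ord_max])%SET.
  by rewrite /add_singleton setU1K// max_notin.
by rewrite !H E.
Qed.

Lemma add_singleton_partition N (Q : {set {set 'I_N}}) :
  finset.partition Q [set: 'I_N]%SET ->
  finset.partition (add_singleton Q) [set: 'I_N.+1]%SET.
Proof.
move=> /and3P[/eqP cQ tQ Q0]; apply/and3P; split.
- rewrite finset.eqEsubset finset.subsetT/=; apply/fintype.subsetP => x _; apply/finset.bigcupP.
  have [->|[i ->]] := ordS_case x.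
    by exists [set ord_max]%SET; rewrite ?setU11// inE.
  have : i \in finset.cover Q by rewrite cQ inE.
  move=> /finset.bigcupP[B BQ iB]; exists (@wid N @: B)%SET; last exact: imset_f.
  by rewrite inE; apply/orP; right; exact: imset_f.
- apply/finset.trivIsetP => A B.
  have disj (C : {set (ordinal N.+1)}) : C \in [set (@wid N) @: B | B : {set 'I_N} in Q]%SET ->
      fintype.disjoint (mem [set (ord_max : 'I_N.+1)]%SET) (mem C).
    move=> /imsetP[D _ ->]; rewrite disjoints1; apply/imsetP => -[i _].
    by move/esym/eqP; rewrite (negbTE (wid_max i)).
  rewrite !inE => /orP[/eqP ->|AQ] /orP[/eqP ->|BQ].
  + by rewrite eqxx.
  + by move=> _; exact: disj.
  + by move=> _; rewrite disjoint_sym; exact: disj.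
  move: AQ BQ => /imsetP[A' AQ ->] /imsetP[B' BQ ->] AB.
  rewrite imset_disjoint; last exact: wid_inj.
  by apply: (finset.trivIsetP tQ) => //; apply: contraNneq AB => ->.
- rewrite inE negb_or; apply/andP; split.
    by apply/negP; rewrite finset.in_set1 => /eqP/setP/(_ ord_max); rewrite !inE eqxx.
  apply/imsetP => -[B BQ /esym/eqP]; rewrite imset_eq0 => /eqP B0.
  by move: Q0; rewrite -B0 BQ.
Qed.

Section restrictions.
Context d (T : measurableType d) (Pi : random_partition T).
Local Notation K := (num_blocks Pi).

Let Pi_refl w i : Pi w i i.
Proof. by have [] := rand_rel_equiv Pi w i i i. Qed.

Let Pi_trans w i j l : Pi w i j -> Pi w i l = Pi w j l.
Proof. by have [_] := rand_rel_equiv Pi w i j l. Qed.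

Let Pi_sym w i j : Pi w i j = Pi w j i.
Proof.
by apply/idP/idP => h; [rewrite -(Pi_trans i h)|rewrite -(Pi_trans j h)]; exact: Pi_refl.
Qed.

Definition block n w (i : 'I_n) : {set 'I_n} := [set j : 'I_n | Pi w i j]%SET.

Lemma restrictionE n w : restriction Pi n w = [set block w i | i : 'I_n]%SET.
Proof.
have H (i : 'I_n) : [set j in [set: 'I_n] | Pi w i j]%SET = block w i.
  by apply/setP => j; rewrite !inE.
apply/setP => B; apply/imsetP/imsetP => -[i _ ->]; exists i => //; rewrite ?inE//; apply/setP => j; rewrite !inE//.
Qed.

Lemma block_eq n w (i j : 'I_n) : Pi w i j -> block w i = block w j.
Proof. by move=> h; apply/setP => l; rewrite !inE (Pi_trans l h). Qed.

Lemma block_eqP n w (i j : 'I_n) : (block w i == block w j) = Pi w i j.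
Proof.
apply/eqP/idP => [/setP/(_ j)|]; last exact: block_eq.
by rewrite !inE Pi_refl.
Qed.

Lemma restriction_partition n w :
  finset.partition (restriction Pi n w) [set: 'I_n]%SET.
Proof.
apply: equivalence_partitionP => i j l _ _ _.
by split; [exact: Pi_refl|exact: Pi_trans].
Qed.

(** Events about times up to n are thereby finite unions of events fixing the restriction at time n,
    on which the model prescribes the probability. *)
Lemma restriction_determines n a w w' : (a <= n)%N ->
  restriction Pi n w = restriction Pi n w' -> restriction Pi a w = restriction Pi a w'.
Proof.
move=> an; rewrite !restrictionE => E.
have H v v' : [set block v i | i : 'I_n]%SET = [set block v' i | i : 'I_n]%SET ->
    forall i j : 'I_n, Pi v i j -> Pi v' i j.
  move=> Ev i j vij.
  have /imsetP[i' _ /setP Ei'] : block v i \in [set block v' i | i : 'I_n]%SET.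
    by rewrite -Ev imset_f.
  have := Ei' i; have := Ei' j; rewrite !inE Pi_refl vij => /esym h1 /esym h2.
  by rewrite -(Pi_trans _ h2).
apply: eq_imset => i; apply/setP => j; rewrite !inE.
pose f := widen_ord an.
by apply/idP/idP; [exact: (H w w' E (f i) (f j))|exact: (H w' w (esym E) (f i) (f j))].
Qed.

Lemma num_blocks_determines n a w w' : (a <= n)%N ->
  restriction Pi n w = restriction Pi n w' -> K a w = K a w'.
Proof. by move=> an E; rewrite /num_blocks (restriction_determines an E). Qed.

Lemma measurable_restriction n Q : measurable [set w | restriction Pi n w = Q].
Proof.
pose g w := [ffun p : 'I_n * 'I_n => Pi w p.1 p.2].
have mg (h : {ffun 'I_n * 'I_n -> bool}) : measurable [set w | g w = h].
  have -> : [set w | g w = h] =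
      \bigcap_(p in [set: 'I_n * 'I_n]) [set w | Pi w p.1 p.2 = h p].
    apply/seteqP; split=> w /=.
      by move=> <- p _; rewrite ffunE.
    by move=> H; apply/ffunP => p; rewrite ffunE; exact: H.
  apply: fin_bigcap_measurable; first exact: finite_finset.
  move=> p _; case: (h p); first exact: rand_rel_measurable.
  rewrite (_ : [set w | _] = ~` [set w | Pi w p.1 p.2]).
    by apply: measurableC; exact: rand_rel_measurable.
  by apply/seteqP; split=> w /=; [move=> ->|move/negP/negbTE].
pose c (h : {ffun 'I_n * 'I_n -> bool}) :=
  equivalence_partition (fun i j => h (i, j)) [set: 'I_n]%SET.
have cE w : restriction Pi n w = c (g w).
  by apply: eq_imset => i; apply/setP => j; rewrite !inE /g ffunE.
have -> : [set w | restriction Pi n w = Q] =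
    \bigcup_(h in [set h | c h = Q]) [set w | g w = h].
  apply/seteqP; split=> w /=.
    by rewrite cE => H; exists (g w).
  by move=> [h <- /= <-]; rewrite cE.
by apply: fin_bigcup_measurable; first exact: finite_finset.
Qed.

(** Index [N] is observation X_{N+1}, so this is the event that K jumps between times N and N +
    1. *)
Definition new_block N w := [forall i : 'I_N, ~~ Pi w i N].

Lemma restrictionS_new N w : new_block N w ->
  restriction Pi N.+1 w = add_singleton (restriction Pi N w).
Proof.
move=> /forallP nw; rewrite !restrictionE /add_singleton.
have bmax : block w (ord_max : 'I_N.+1) = [set ord_max]%SET.
  apply/setP => j; rewrite !inE; have [->|[i ->]] := ordS_case j.
    by rewrite eqxx Pi_refl.
  by rewrite (negbTE (wid_max i)) Pi_sym (negbTE (nw i)).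
have bwid (i : 'I_N) : block w (wid i) = (@wid N @: block w i)%SET.
  apply/setP => j; rewrite !inE; have [->|[l ->]] := ordS_case j.
    rewrite (negbTE (nw i)); apply/esym/negbTE/imsetP => -[l _ /esym/eqP].
    by rewrite (negbTE (wid_max l)).
  by rewrite mem_imset ?inE//; exact: wid_inj.
apply/setP => B; rewrite !inE; apply/imsetP/orP.
  move=> [i _ ->]; have [->|[j ->]] := ordS_case i; first by left; rewrite bmax.
  by right; rewrite bwid; apply/imset_f/imset_f.
move=> [/eqP ->|/imsetP[_ /imsetP[i _ ->] ->]]; first by exists ord_max.
by exists (wid i) => //; rewrite bwid.
Qed.

(** Some old element shares the block of the new one, so every block at time N + 1 contains an old
    element, and intersecting with the old elements is a bijection onto the blocks at time N. *)
Lemma num_blocksS_old N w : ~~ new_block N w -> K N.+1 w = K N w.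
Proof.
rewrite negb_forall => /existsP[i0]; rewrite negbK => h0.
rewrite /num_blocks.
pose g (B : {set 'I_N.+1}) : {set 'I_N} := (@wid N @^-1: B)%SET.
have gblock (i : 'I_N) : g (block w (wid i)) = block w i.
  by apply/setP => j; rewrite !inE.
have E1 : restriction Pi N.+1 w = [set block w (wid i) | i : 'I_N]%SET.
  rewrite restrictionE; apply/setP => B; apply/imsetP/imsetP => -[i _ ->].
    have [->|[j ->]] := ordS_case i; last by exists j.
    by exists i0 => //; apply: block_eq; rewrite Pi_sym.
  by exists (wid i).
have -> : restriction Pi N w = (g @: restriction Pi N.+1 w)%SET.
  rewrite E1 restrictionE -imset_comp; apply: eq_imset => i.
  by rewrite /= gblock.
apply/esym/card_in_imset; rewrite E1 => _ _ /imsetP[i _ ->] /imsetP[j _ ->].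
by rewrite !gblock => /eqP; rewrite block_eqP => h; exact: block_eq.
Qed.

Lemma num_blocksS N w : K N.+1 w = (K N w + new_block N w)%N.
Proof.
have [h|h] := boolP (new_block N w); last by rewrite num_blocksS_old// addn0.
by rewrite /num_blocks restrictionS_new// card_add_singleton addn1.
Qed.

Lemma num_blocks0 w : K 0 w = 0%N.
Proof.
rewrite /num_blocks restrictionE; apply/eqP; rewrite cards_eq0.
by apply/eqP/setP => B; rewrite inE; apply/imsetP => -[[]].
Qed.

Lemma num_blocks1 w : K 1 w = 1%N.
Proof.
rewrite num_blocksS num_blocks0 add0n; apply/eqP; rewrite eqb1.
by apply/forallP => -[].
Qed.

Lemma num_blocks_le N w : (K N w <= N)%N.
Proof.
elim: N => [|N IH]; first by rewrite num_blocks0.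
by rewrite num_blocksS -addn1 leq_add// leq_b1.
Qed.

Lemma num_blocks_gt0 N w : (0 < N)%N -> (0 < K N w)%N.
Proof.
case: N => // N _; elim: N => [|N IH]; first by rewrite num_blocks1.
by rewrite num_blocksS ltn_addr.
Qed.

Lemma restrictionS_eq N (Q : {set {set 'I_N}}) w :
  (restriction Pi N.+1 w = add_singleton Q) <->
  (restriction Pi N w = Q /\ new_block N w).
Proof.
split=> [E|[<- nw]]; last exact: restrictionS_new.
suff nw : new_block N w.
  by split=> //; apply: add_singleton_inj; rewrite -restrictionS_new.
apply/forallP => i; apply/negP => h.
have : [set ord_max]%SET \in restriction Pi N.+1 w by rewrite E /add_singleton setU11.
rewrite restrictionE => /imsetP[j _ /setP Ej].
have := Ej ord_max; rewrite !inE eqxx => /esym jN.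
have := Ej (wid i); rewrite !inE (negbTE (wid_max i)) => /esym/negbT/negP; apply.
by rewrite Pi_sym (Pi_trans _ h) Pi_sym.
Qed.

End restrictions.

Definition new_prob {R : realType} (alpha theta : R) (N j : nat) : R :=
  (theta + j%:R * alpha) / (theta + N%:R).

Section poisson_dirichlet_step.
Context d (T : measurableType d) (R : realType) (P : probability T R)
  (alpha theta : R) (Pi : random_partition T).
Hypothesis hPi : poisson_dirichlet P alpha theta Pi.
Local Notation K := (num_blocks Pi).
Local Notation p := (new_prob alpha theta).

(** A singleton contributes an empty product over its block; the other two factors gain one term
    each, and their quotient is [new_prob]. *)
Lemma PD_eppf_add_singleton N (Q : {set {set 'I_N}}) : (0 < N)%N -> (0 < #|Q|)%N ->
  PD_eppf alpha theta (add_singleton Q) = p N #|Q| * PD_eppf alpha theta Q.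
Proof.
case: N Q => // N Q _ Q0; rewrite /PD_eppf card_add_singleton subSS subn0.
rewrite /gen_rising /rising subSS subn0 subSS subn0.
rewrite -[#|Q| in LHS](prednK Q0) big_ord_recr/= subn1 [in X in _ / X]big_ord_recr/=.
have -> : \prod_(B in add_singleton Q) \prod_(i < #|B| - 1) (1 - alpha + i%:R) =
    \prod_(B in Q) \prod_(i < #|B| - 1) (1 - alpha + i%:R).
  rewrite /add_singleton big_setU1 ?max_notin//=.
  rewrite cards1 subnn big_ord0 mul1r.
  rewrite big_imset/=; last by move=> ? ? _ _; exact: wid_imset_inj.
  apply: eq_bigr => B _; rewrite card_imset//; exact: wid_inj.
have -> : theta + 1 + N%:R = theta + N.+1%:R by rewrite -natr1; ring.
have -> : theta + alpha + (#|Q|.-1)%:R * alpha = theta + #|Q|%:R * alpha.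
  by rewrite -[in RHS](prednK Q0) -natr1; ring.
rewrite /new_prob invfM.
by ring.
Qed.

Lemma PD_new N Q : (0 < N)%N ->
  P [set w | restriction Pi N w = Q /\ new_block Pi N w] =
  ((p N #|Q|)%:E * P [set w | restriction Pi N w = Q])%E.
Proof.
move=> N0; have -> : [set w | restriction Pi N w = Q /\ new_block Pi N w] =
    [set w | restriction Pi N.+1 w = add_singleton Q].
  by apply/seteqP; split => w /= /restrictionS_eq.
(* The model speaks of genuine partitions only. If no outcome has restriction [Q], both events are
   empty; otherwise [Q] is a nonempty partition. *)
have [[w0 Qw]|noQ] := pselect (exists w, restriction Pi N w = Q); last first.
  have -> : [set w | restriction Pi N w = Q] = set0.
    by apply/seteqP; split => // w h; apply: noQ; exists w.
  have -> : [set w | restriction Pi N.+1 w = add_singleton Q] = set0.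
    by apply/seteqP; split => // w /= /restrictionS_eq[h _]; apply: noQ; exists w.
  by rewrite measure0 mule0.
have pQ : finset.partition Q [set: 'I_N]%SET by rewrite -Qw; exact: restriction_partition.
rewrite !hPi//; last exact: add_singleton_partition.
by rewrite -EFinM PD_eppf_add_singleton// -Qw; exact: num_blocks_gt0.
Qed.

Lemma determined_measurable N (E : set T) :
  (forall w w', restriction Pi N w = restriction Pi N w' -> E w -> E w') ->
  measurable E.
Proof.
move=> detE; rewrite (_ : E = \bigcup_(Q in [set Q | exists2 w, E w & restriction Pi N w = Q])
    [set w | restriction Pi N w = Q]).
  apply: fin_bigcup_measurable; first exact: finite_finset.
  by move=> Q _; exact: measurable_restriction.
apply/seteqP; split => w /=; first by move=> Ew; exists (restriction Pi N w) => //; exists w.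
by move=> [_ [w' Ew' <-] /= h]; apply: detE Ew'.
Qed.

Lemma measurable_new_block N : measurable [set w | new_block Pi N w].
Proof.
apply: (@determined_measurable N.+1) => w w' E /=.
have := num_blocks_determines (leqnn N.+1) E.
rewrite !num_blocksS (num_blocks_determines (leqnSn N) E) => /eqP.
by rewrite eqn_add2l; case: new_block; case: new_block.
Qed.

(** The probability of a new block given the restriction depends only on its number of blocks. It is
    constant on K_N = j, and factors out of the sum over the restrictions contained in [E]. *)
Lemma PD_new_event N j (E : set T) : (0 < N)%N ->
  (forall w w', restriction Pi N w = restriction Pi N w' -> E w -> E w') ->
  P ((E `&` [set w | K N w = j]) `&` [set w | new_block Pi N w]) =
  ((p N j)%:E * P (E `&` [set w | K N w = j]))%E.
Proof.
move=> N0 detE.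
pose D := [set Q | exists2 w, E w /\ K N w = j & restriction Pi N w = Q].
have finD : finite_set D by exact: finite_finset.
have E1 : E `&` [set w | K N w = j] = \bigcup_(Q in D) [set w | restriction Pi N w = Q].
  apply/seteqP; split => w /=.
    by move=> [Ew Kw]; exists (restriction Pi N w) => //; exists w.
  move=> [_ [w' [Ew' Kw'] <-] /= h]; split; first by apply: detE Ew'.
  by rewrite (num_blocks_determines (leqnn N) h).
have E2 : (E `&` [set w | K N w = j]) `&` [set w | new_block Pi N w] =
    \bigcup_(Q in D) [set w | restriction Pi N w = Q /\ new_block Pi N w].
  rewrite E1 setI_bigcupl; apply: eq_bigcupr => Q _.
  by apply/seteqP; split.
rewrite E2 E1 measure_fin_bigcup//; last 2 first.
- by move=> Q Q' _ _ [w [/= [<- _] [<- _]]].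
- move=> Q _; apply: measurableI; [exact: measurable_restriction|exact: measurable_new_block].
rewrite measure_fin_bigcup//; last 2 first.
- by move=> Q Q' _ _ [w [/= <- <-]].
- by move=> Q _; exact: measurable_restriction.
rewrite ge0_mule_fsumr//; apply: eq_fsbigr => Q; rewrite inE => -[w [_ Kw] Qw].
have -> : j = #|Q| by rewrite -Qw -Kw.
exact: PD_new.
Qed.

End poisson_dirichlet_step.

(** * The chain under the conditional law *)

Section conditioning.
Context d (T : measurableType d) (R : realType) (P : probability T R)
  (alpha theta : R) (Pi : random_partition T).
Hypotheses (halpha : 0 < alpha < 1) (htheta : - alpha < theta)
  (hPi : poisson_dirichlet P alpha theta Pi).
Local Notation K := (num_blocks Pi).
Local Notation p := (new_prob alpha theta).

Let htheta1 : - 1 < theta.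
Proof. by case/andP: halpha => _ a1; apply: lt_trans htheta; rewrite ltrN2. Qed.

Lemma new_prob_gt0 N j : (0 < N)%N -> (0 < j)%N -> 0 < p N j.
Proof.
move=> N0 j0; case/andP: halpha => a0 a1; apply: divr_gt0.
  rewrite -ltrBlDr sub0r; apply: le_lt_trans htheta.
  by rewrite lerN2 ler_peMl ?ler1n// ltW.
rewrite -ltrBlDr sub0r; apply: le_lt_trans htheta1.
by rewrite lerN2 ler1n.
Qed.

Lemma new_prob_lt1 N j : (0 < N)%N -> (j <= N)%N -> p N j < 1.
Proof.
move=> N0 jN; case/andP: halpha => a0 a1.
have N1 : 0 < theta + N%:R.
  rewrite -ltrBlDr sub0r; apply: le_lt_trans htheta1.
  by rewrite lerN2 ler1n.
rewrite ltr_pdivrMr// mul1r ltrD2l.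
apply: (@le_lt_trans _ _ (N%:R * alpha)); first by rewrite ler_wpM2r ?ler_nat// ltW.
by rewrite gtr_pMr// ltr0n.
Qed.

(** Excludes the fallback value of [mnormalize]. The induction reaches the maximal value N + 1 by a
    new block and every smaller j by keeping j; it starts at time 1, where K_1 = 1, as the
    prediction rule needs a positive time. *)
Lemma num_blocks_prob_gt0 N j : (0 < j <= N)%N -> (0 < P [set w | K N w = j])%E.
Proof.
elim: N j => [|N IH] j; first by case: j.
case: N IH => [_|N IH].
  move=> j1; have -> : j = 1%N by case: j j1 => [|[|]].
  rewrite (_ : [set w | _] = [set: T]) ?probability_setT//.
  by apply/seteqP; split => // w _ /=; exact: num_blocks1.
move=> /andP[j0 jN].
have new := @PD_new_event _ _ _ P alpha theta Pi hPi N.+1 _ [set: T] isT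
  (fun _ _ _ _ => I).
have mnew := measurable_new_block Pi N.+1.
move: jN; rewrite leq_eqVlt => /predU1P[jE|jN].
  have := new N.+1; rewrite setTI => newE.
  apply: (@lt_le_trans _ _ (P ([set w | K N.+1 w = N.+1] `&` [set w | new_block Pi N.+1 w]))).
    rewrite newE mule_gt0 ?lte_fin ?new_prob_gt0//.
    by apply: IH; rewrite leqnn.
  apply: le_measure; rewrite ?inE.
  - by apply: measurableI => //; exact: measurable_num_blocks.
  - exact: measurable_num_blocks.
  - by move=> w [/= h1 h2]; rewrite num_blocksS h1 h2 addn1 jE.
have := new j; rewrite setTI => newE.
have mKj : measurable [set w | K N.+1 w = j] by exact: measurable_num_blocks.
have E : P ([set w | K N.+1 w = j] `\` [set w | new_block Pi N.+1 w]) =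
    ((1 - p N.+1 j)%:E * P [set w | K N.+1 w = j])%E.
  transitivity (P [set w | K N.+1 w = j] -
      P ([set w | K N.+1 w = j] `&` [set w | new_block Pi N.+1 w]))%E.
    by apply: measureD => //; rewrite ltey_eq fin_num_measure.
  rewrite newE; have [r ->] : exists r, P [set w | K N.+1 w = j] = r%:E.
    by exists (fine (P [set w | K N.+1 w = j])); rewrite fineK// fin_num_measure.
  by rewrite -!EFinM -EFinB; congr EFin; ring.
apply: (@lt_le_trans _ _ (P ([set w | K N.+1 w = j] `\` [set w | new_block Pi N.+1 w]))).
  rewrite E mule_gt0 ?lte_fin ?subr_gt0 ?new_prob_lt1//.
  by apply: IH; rewrite j0.
apply: le_measure; rewrite ?inE.
- exact: measurableD.
- exact: measurable_num_blocks.
- by move=> w [/= h1 /negP h2]; rewrite num_blocksS h1 (negbTE h2) addn0.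
Qed.

Variables (n k : nat).
Hypothesis hk : (1 <= k <= n)%N.
Local Notation S := (cond_num_blocks P Pi n k).
Local Notation Kn := [set w | K n w = k].

Lemma cond_num_blocksE (A : set T) :
  S A = (P (A `&` Kn) * (fine (P Kn))^-1%:E)%E.
Proof.
have Kn0 := num_blocks_prob_gt0 hk.
have mKn : measurable Kn by exact: measurable_num_blocks.
have fKn : P Kn \is a fin_num by exact: fin_num_measure.
rewrite -[LHS]/(mnormalize (mrestr P (measurable_num_blocks Pi n k)) P A).
rewrite /mnormalize; case: ifPn => [/orP[/eqP h|/eqP h]|_].
- have {}h : P (setT `&` Kn) = 0%E := h.
  by move: Kn0; rewrite setTI in h; rewrite h ltxx.
- have {}h : P (setT `&` Kn) = +oo%E := h.
  by move: fKn; rewrite setTI in h; rewrite h.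
by rewrite -[LHS]/(P (A `&` Kn) * (fine (P (setT `&` Kn)))^-1%:E)%E setTI.
Qed.

Lemma cond_num_blocks_start : S Kn = 1%E.
Proof.
have Kn0 := num_blocks_prob_gt0 hk.
have mKn : measurable Kn by exact: measurable_num_blocks.
have fKn : P Kn \is a fin_num by exact: fin_num_measure.
rewrite cond_num_blocksE setIid -{1}(fineK fKn) -EFinM divff//.
by rewrite gt_eqF// fine_gt0// Kn0 ltey_eq fKn.
Qed.

(** The earlier time [a] is kept for the variance of increments K_N - K_a. Since n <= N, the event
    K_n = k is determined by the restriction at time N and passes through [PD_new_event]. *)
Lemma cond_num_blocks_step a N i j : (n <= a <= N)%N ->
  S ([set w | K a w = i /\ K N w = j] `&` [set w | new_block Pi N w]) =
  ((p N j)%:E * S [set w | K a w = i /\ K N w = j])%E.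
Proof.
move=> /andP[na aN]; have nN := leq_trans na aN.
have N0 : (0 < N)%N by case/andP: hk => k0 kn; rewrite (leq_trans _ nN)// (leq_trans k0).
rewrite !cond_num_blocksE muleA; congr (_ * _)%E.
have := @PD_new_event _ _ _ P alpha theta Pi hPi N j
  [set w | K a w = i /\ K n w = k] N0.
rewrite (_ : [set w | K a w = i /\ K n w = k] `&` [set w | K N w = j] =
  [set w | K a w = i /\ K N w = j] `&` Kn); last first.
  by apply/seteqP; split => w /= [[? ?] ?].
move=> <-; last first.
  move=> w w' E /=.
  by rewrite (num_blocks_determines aN E) (num_blocks_determines nN E).
by congr (P _); apply/seteqP; split => w /= [[? ?] ?].
Qed.

End conditioning.

(** * Asymptotics of Gamma ratios *)

Section asymptotics.
Context {R : realType}.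
Implicit Types (x beta alpha t : R) (m s j : nat).

Lemma cvg_shift_ratio beta : 0 < beta ->
  (beta + m%:R)^-1 @[m --> \oo] --> (0 : R).
Proof.
move=> b0; apply/cvgrPdist_lt => e e0; near=> m.
have bm : 0 < beta + m%:R by rewrite ltr_wpDr.
rewrite sub0r normrN gtr0_norm ?invr_gt0//.
rewrite invf_plt ?posrE// (@lt_le_trans _ _ m%:R)//; last by rewrite lerDr ltW.
near: m; exists (Num.truncn e^-1).+1 => // m /= Nm.
by rewrite (lt_le_trans (truncnS_gt _))// ler_nat.
Unshelve. all: by end_near. Qed.

Lemma cvg_powR1 (u : nat -> R) a : 0 <= a -> (forall m, 0 < u m) ->
  u m @[m --> \oo] --> (1 : R) -> u m `^ a @[m --> \oo] --> (1 : R).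
Proof.
move=> a0 u0 u1.
have h : {for (1 : R), continuous (fun x : R => x `^ a)}.
  apply: differentiable_continuous; apply/derivable1_diffP.
  by apply: derivable_powR; rewrite in_itv/= ltr01.
have := @cvg_comp _ _ _ u (fun x => x `^ a) _ _ _ u1 h.
by rewrite powR1.
Qed.

Lemma cvg_powR0 (u : nat -> R) a : 0 < a -> (forall m, 0 <= u m) ->
  u m @[m --> \oo] --> (0 : R) -> u m `^ a @[m --> \oo] --> (0 : R).
Proof.
move=> a0 u0 /cvgrPdist_lt ul; apply/cvgrPdist_lt => e e0.
have := ul (e `^ a^-1); rewrite powR_gt0// => /(_ isT); apply: filterS => m.
rewrite !sub0r !normrN !ger0_norm ?powR_ge0// => h.
have -> : e = (e `^ a^-1) `^ a.
  by rewrite -powRrM mulVf ?gt_eqF// powRr1// ltW.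
by rewrite ltr_powRE// powR_ge0.
Qed.

Lemma cvg_natr_ratio beta : 0 < beta ->
  (m.+1%:R / (beta + m.+1%:R)) @[m --> \oo] --> (1 : R).
Proof.
move=> b0.
have : (1 - beta * (beta + m.+1%:R)^-1) @[m --> \oo] --> (1 - beta * 0 : R).
  apply: cvgB; first exact: cvg_cst.
  apply: cvgMl_tmp; rewrite (cvg_shiftS (fun m => (beta + m%:R)^-1)).
  exact: cvg_shift_ratio.
rewrite mulr0 subr0; apply: cvg_trans; apply: near_eq_cvg; apply: nearW => m.
have bm : beta + m.+1%:R != 0 by rewrite gt_eqF// addr_gt0.
by rewrite /=; move: (m.+1%:R) bm => y y0; field.
Qed.

Lemma cvg_Gamma_ratio beta alpha : 0 < beta -> 0 < alpha < 1 ->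
  Gamma (beta + m.+1%:R) / Gamma (beta + m.+1%:R + alpha) * m.+1%:R `^ alpha
    @[m --> \oo] --> (1 : R).
Proof.
move=> b0 a01; have /andP[a0 a1] := a01.
have bm m : 0 < beta + m.+1%:R by rewrite addr_gt0.
have h1 : Gamma (beta + m.+1%:R) / Gamma (beta + m.+1%:R + alpha) *
    (beta + m.+1%:R) `^ alpha @[m --> \oo] --> (1 : R).
  apply: (@squeeze_cvgr _ _ _ _ (cst 1) (fun m => 1 + alpha * (beta + m.+1%:R)^-1)).
  - by apply: nearW => m; exact: Gamma_ratio_bounds.
  - exact: cvg_cst.
  - rewrite -[X in _ --> X]addr0 -[X in _ --> _ + X](mulr0 alpha).
    apply: cvgD; first exact: cvg_cst.
    apply: cvgMl_tmp; rewrite (cvg_shiftS (fun m => (beta + m%:R)^-1)).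
    exact: cvg_shift_ratio.
have h2 := @cvg_powR1 (fun m => m.+1%:R / (beta + m.+1%:R)) alpha (ltW a0)
  (fun m => divr_gt0 (ltr0Sn _ _) (bm m)) (cvg_natr_ratio b0).
rewrite -[X in _ --> X](mulr1 1); apply: cvg_trans (cvgM h1 h2).
apply: near_eq_cvg; apply: nearW => m /=.
have -> : m.+1%:R `^ alpha =
    (beta + m.+1%:R) `^ alpha * (m.+1%:R / (beta + m.+1%:R)) `^ alpha.
  rewrite -powRM ?divr_ge0 ?(ltW (bm _))//.
  by rewrite [X in _ = X `^ _]mulrC divfK// gt_eqF.
by rewrite mulrA.
Qed.

(** The Gamma bounds cover shifts in ]0, 1[ only, so the shift s alpha is made in s steps of
    alpha. *)
Lemma cvg_Gamma_ratioM beta alpha s : 0 < beta -> 0 < alpha < 1 ->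
  Gamma (beta + m.+1%:R + s%:R * alpha) / Gamma (beta + m.+1%:R) /
    m.+1%:R `^ (s%:R * alpha) @[m --> \oo] --> (1 : R).
Proof.
move=> b0 a01; have /andP[a0 a1] := a01; elim: s => [|s IH].
  apply: cvg_near_cst; apply: nearW => m.
  rewrite mul0r addr0 powRr0 divr1 divff// gt_eqF// Gamma_gt0//.
  by rewrite addr_gt0.
have bs0 : 0 < beta + s%:R * alpha by rewrite ltr_wpDr ?mulr_ge0// ltW.
pose q m := Gamma (beta + s%:R * alpha + m.+1%:R) /
  Gamma (beta + s%:R * alpha + m.+1%:R + alpha) * m.+1%:R `^ alpha.
have h : (q m)^-1 @[m --> \oo] --> (1 : R).
  rewrite -[X in _ --> X]invr1; apply: cvgV; first exact: oner_neq0.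
  exact: cvg_Gamma_ratio.
rewrite -[X in _ --> X](mulr1 1); apply: cvg_trans (cvgM IH h).
apply: near_eq_cvg; apply: nearW => m; rewrite /q /=.
have -> : s.+1%:R * alpha = s%:R * alpha + alpha by rewrite -natr1; ring.
have -> : beta + m.+1%:R + (s%:R * alpha + alpha) = beta + s%:R * alpha + m.+1%:R + alpha by ring.
have -> : beta + m.+1%:R + s%:R * alpha = beta + s%:R * alpha + m.+1%:R by ring.
rewrite (@gt0_powRD _ m.+1%:R (s%:R * alpha) alpha)//.
have G1 : 0 < Gamma (beta + m.+1%:R) by rewrite Gamma_gt0// addr_gt0.
have G2 : 0 < Gamma (beta + s%:R * alpha + m.+1%:R) by rewrite Gamma_gt0// addr_gt0.
have G3 : 0 < Gamma (beta + s%:R * alpha + m.+1%:R + alpha).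
  by apply/Gamma_gt0/addr_gt0 => //; exact: addr_gt0.
have P1 : 0 < m.+1%:R `^ (s%:R * alpha) by rewrite powR_gt0.
have P2 : 0 < m.+1%:R `^ alpha by rewrite powR_gt0.
move: (Gamma _) (Gamma _) (Gamma _) (_ `^ _) (_ `^ _) G1 G2 G3 P1 P2.
move=> A B C D E A0 B0 C0 D0 E0.
by field; rewrite !gt_eqF.
Qed.

Lemma cvg_ratio_test (a r : nat -> R) :
  (forall j, 0 <= a j) -> (forall j, a j.+1 <= r j * a j) ->
  r j @[j --> \oo] --> (0 : R) -> a j @[j --> \oo] --> (0 : R).
Proof.
move=> a0 ar r0.
have [N _ rN] : \forall j \near \oo, r j <= 2^-1.
  have /cvgrPdist_le/(_ 2^-1) := r0.
  rewrite invr_gt0 ltr0n => /(_ isT); apply: filterS => j.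
  by rewrite sub0r normrN; apply: le_trans; exact: ler_norm.
have aN m : a (m + N)%N <= a N * 2^-1 ^+ m.
  elim: m => [|m ih]; first by rewrite expr0 mulr1 add0n.
  rewrite addSn; apply: le_trans (ar _) _.
  apply: (@le_trans _ _ (2^-1 * a (m + N)%N)).
    by rewrite ler_wpM2r// rN//= leq_addl.
  by rewrite exprS mulrCA ler_wpM2l// invr_ge0.
rewrite -(cvg_shiftn N).
apply: (@squeeze_cvgr _ _ _ _ (cst 0) (geometric (a N) 2^-1)).
- by apply: nearW => m; rewrite a0 aN.
- exact: cvg_cst.
- by apply: cvg_geometric; rewrite ger0_norm ?invr_ge0// invf_lt1// ltr1n.
Qed.

(** Consecutive terms have ratio t (sg + j) / (j + 1) times [g j]. The factorial only balances the
    growth of Gamma(sg + j); the decay comes from [g j], which is of order j^(- alpha), and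
    therefore holds for every t. *)
Lemma cvg_limit_moment alpha theta n k t : 0 < alpha < 1 -> - alpha < theta ->
  (1 <= k <= n)%N -> 0 <= t ->
  t ^+ j / j`!%:R * limit_moment alpha theta n k j @[j --> \oo] --> (0 : R).
Proof.
move=> a01 tha kn t0; have /andP[a0 a1] := a01; have /andP[k1 k2] := kn.
set sg := theta / alpha + k%:R; set x := theta + n%:R.
have sg0 : 0 < sg.
  apply: (@lt_le_trans _ _ (theta / alpha + 1)%R).
    by rewrite -ltrBlDr sub0r ltr_pdivlMr// mulN1r.
  by rewrite lerD2l ler1n.
have x0 : 0 < x.
  rewrite -ltrBlDr sub0r; apply: le_lt_trans tha.
  by rewrite lerN2 (le_trans (ltW a1))// ler1n (leq_trans k1).
have xj j : 0 < x + j%:R * alpha by rewrite ltr_wpDr ?mulr_ge0// ltW.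
have sgj j : 0 < sg + j%:R by rewrite ltr_wpDr.
have lm0 j : 0 <= limit_moment alpha theta n k j.
  by rewrite /limit_moment mulr_ge0// divr_ge0// ltW// Gamma_gt0.
pose g j := Gamma (x + j%:R * alpha) / Gamma (x + j%:R * alpha + alpha).
have g0 j : 0 <= g j by rewrite divr_ge0// ltW// Gamma_gt0// addr_gt0.
have glim : g j @[j --> \oo] --> (0 : R).
  have inv0 : (x + j%:R * alpha)^-1 @[j --> \oo] --> (0 : R).
    have : (x / alpha + j%:R)^-1 * alpha^-1 @[j --> \oo] --> (0 * alpha^-1 : R).
      by apply: cvgMr_tmp; apply: cvg_shift_ratio; exact: divr_gt0.
    rewrite mul0r; apply: cvg_trans; apply: near_eq_cvg.
    apply: nearW => j /=; rewrite -invfM; congr (_^-1).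
    by rewrite mulrDl divfK ?gt_eqF.
  apply: (@squeeze_cvgr _ _ _ _ (cst 0)
    (fun j => (1 + alpha / x) * (x + j%:R * alpha)^-1 `^ alpha)).
  - apply: nearW => j; rewrite g0/=.
    have /andP[_ h] := Gamma_ratio_bounds (xj j) a01.
    have xa : 0 < (x + j%:R * alpha) `^ alpha by rewrite powR_gt0.
    rewrite powR_invl ?(ltW (xj _))// powRN ler_pdivlMr//.
    apply: (le_trans h); rewrite lerD2l ler_wpM2l ?(ltW a0)//.
    by rewrite lef_pV2 ?posrE// lerDl mulr_ge0// ltW.
  - exact: cvg_cst.
  - rewrite -[X in _ --> X](mulr0 (1 + alpha / x)); apply: cvgMl_tmp.
    by apply: cvg_powR0 => // j; rewrite invr_ge0 ltW.
(* (sg + j) / (j + 1) <= sg + 1, since the difference after clearing denominators is sg j + 1. *)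
pose r j := t * (sg + 1) * g j.
apply: (@cvg_ratio_test _ r).
- by move=> j; rewrite mulr_ge0// divr_ge0 ?exprn_ge0.
- move=> j; rewrite /r /limit_moment -/sg -/x.
  have -> : sg + j.+1%:R = sg + j%:R + 1 by rewrite -natr1; ring.
  have -> : x + j.+1%:R * alpha = x + j%:R * alpha + alpha by rewrite -natr1; ring.
  rewrite GammaS// /g.
  have G1 : 0 < Gamma (sg + j%:R) by rewrite Gamma_gt0.
  have G2 : 0 < Gamma sg by rewrite Gamma_gt0.
  have G3 : 0 < Gamma x by rewrite Gamma_gt0.
  have G4 : 0 < Gamma (x + j%:R * alpha) by rewrite Gamma_gt0.
  have G5 : 0 < Gamma (x + j%:R * alpha + alpha) by rewrite Gamma_gt0// addr_gt0.
  rewrite factS natrM exprS.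
  have F0 : 0 < j`!%:R :> R by rewrite ltr0n fact_gt0.
  have tj : 0 <= t ^+ j by rewrite exprn_ge0.
  move: (Gamma (sg + j%:R)) (Gamma sg) (Gamma x) (Gamma (x + j%:R * alpha))
    (Gamma (x + j%:R * alpha + alpha)) (j`!%:R) (t ^+ j) G1 G2 G3 G4 G5 F0 tj.
  move=> A B C D E F tt A0 B0 C0 D0 E0 F0 tt0.
  have -> : t * tt / (j.+1%:R * F) * ((sg + j%:R) * A / B * (C / E)) =
    (sg + j%:R) / j.+1%:R * (t * tt / F * (A / B * (C / E))).
    by field; rewrite ?pnatr_eq0 ?gt_eqF.
  have -> : t * (sg + 1) * (D / E) * (tt / F * (A / B * (C / D))) =
    (sg + 1) * (t * tt / F * (A / B * (C / E))).
    by field; rewrite !gt_eqF.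
  apply: ler_wpM2r.
    by rewrite !mulr_ge0// ?invr_ge0 ltW.
  rewrite ler_pdivrMr// -natr1 -subr_ge0.
  rewrite (_ : _ - _ = sg * j%:R + 1); last by ring.
  by rewrite addr_ge0// mulr_ge0// ltW.
- rewrite -[X in _ --> X](mulr0 (t * (sg + 1))); exact: cvgMl_tmp.
Qed.

End asymptotics.

(** * From a polynomial subsequence to the whole sequence *)

Section polynomial_subsequence.
Context {R : realType}.

(** Consecutive terms of j^q have ratio tending to 1, so a monotone sequence squeezed between them
    has the same normalized limit. A geometric subsequence would lose a constant factor here. *)
Lemma cvg_poly_subseq (u : nat -> R) (alpha L : R) (q : nat) :
  0 < alpha -> (0 < q)%N -> {homo u : i j / (i <= j)%N >-> i <= j} ->
  (forall m, 0 <= u m) ->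
  u (j.+1 ^ q)%N / (j.+1 ^ q)%:R `^ alpha @[j --> \oo] --> L ->
  u m / m%:R `^ alpha @[m --> \oo] --> L.
Proof.
move=> a0 q0 mu u0 ul.
pose a j := (j.+1 ^ q)%N.
have aS j : (a j < a j.+1)%N by rewrite ltn_exp2r.
have a_gt0 j : (0 < a j)%N by rewrite expn_gt0.
have aR j : 0 < (a j)%:R `^ alpha :> R by rewrite powR_gt0 ?ltr0n.
(* [J m] locates m between two consecutive q-th powers; m = 0 gets an arbitrary index. *)
have [J HJ] : exists J : nat -> nat,
    forall m, (0 < m)%N -> (a (J m) <= m < a (J m).+1)%N.
  suff /choice[J HJ] : forall m, exists j, (0 < m)%N -> (a j <= m < a j.+1)%N.
    by exists J.
  move=> m.
  case: m => [|m]; first by exists 0%N.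
  elim: m => [|m [j /(_ isT)/andP[j1 j2]]].
    by exists 0%N => _; rewrite /a exp1n/= -{1}(exp1n q) ltn_exp2r.
  have [h|h] := ltnP m.+2 (a j.+1).
    by exists j => _; rewrite h andbT (leq_trans j1).
  exists j.+1 => _; rewrite h/=.
  have -> : m.+2 = a j.+1 by apply/eqP; rewrite eqn_leq h j2.
  exact: aS.
have Joo : J m @[m --> \oo] --> \oo.
  move=> A [N _ NA]; exists (a N) => // m /= Nm; apply: NA => /=.
  have m0 : (0 < m)%N by exact: leq_trans Nm.
  have /andP[_ h] := HJ m m0; have := leq_ltn_trans Nm h.
  by rewrite ltn_exp2r// ltnS.
have ratio : ((a j.+1)%:R / (a j)%:R) `^ alpha @[j --> \oo] --> (1 : R).
  apply: cvg_powR1; first exact: ltW.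
    by move=> j; rewrite divr_gt0 ?ltr0n.
  have h : (1 + j.+1%:R^-1) @[j --> \oo] --> (1 + 0 : R).
    by apply: cvgD; [exact: cvg_cst|exact: cvg_harmonic].
  have := @cvg_comp _ _ _ (fun j => 1 + j.+1%:R^-1) (fun x : R => x ^+ q) _ _ _ h
    (exprn_continuous (n := q) (x := 1 + 0)).
  rewrite addr0 expr1n; apply: cvg_trans; apply: near_eq_cvg; apply: nearW => j /=.
  rewrite /a !natrX -expr_div_n; congr (_ ^+ _).
  by rewrite -[in RHS]natr1 mulrDl divff ?mul1r// pnatr_eq0.
pose hi j := u (a j.+1) / (a j.+1)%:R `^ alpha * ((a j.+1)%:R / (a j)%:R) `^ alpha.
pose lo j := u (a j) / (a j)%:R `^ alpha * (((a j.+1)%:R / (a j)%:R) `^ alpha)^-1.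
have hil : hi j @[j --> \oo] --> L.
  rewrite -[X in _ --> X]mulr1; apply: cvgM => //.
  by rewrite (cvg_shiftS (fun j => u (a j) / (a j)%:R `^ alpha)).
have lol : lo j @[j --> \oo] --> L.
  rewrite -[X in _ --> X]mulr1; apply: cvgM => //.
  rewrite -[X in _ --> X]invr1.
  by apply: cvgV => //; exact: oner_neq0.
apply: (@squeeze_cvgr _ _ _ _ (lo \o J) (hi \o J)).
- exists 1%N => // m /= m0; have /andP[h1 h2] := HJ m m0.
  have m0R : 0 < m%:R `^ alpha :> R by rewrite powR_gt0 ?ltr0n.
  have E j : ((a j.+1)%:R / (a j)%:R) `^ alpha =
      (a j.+1)%:R `^ alpha / (a j)%:R `^ alpha :> R.
    rewrite powRM ?invr_ge0// powR_invl// powRN.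
    by [].
  rewrite /lo /hi /= !E; apply/andP; split.
    rewrite invf_div mulrA divfK ?gt_eqF//.
    apply: ler_pM => //; first exact: mu.
    by rewrite lef_pV2 ?posrE// ge0_ler_powR ?nnegrE ?(ltW a0)// ler_nat ltnW.
  rewrite mulrA divfK ?gt_eqF//.
  apply: ler_pM => //; first by apply: mu; exact: ltnW.
  by rewrite lef_pV2 ?posrE// ge0_ler_powR ?nnegrE ?(ltW a0)// ler_nat.
- exact: cvg_comp Joo lol.
- exact: cvg_comp Joo hil.
Qed.

End polynomial_subsequence.

Section finite_expectation.
Context d (T : measurableType d) (R : realType) (S : probability T R).

Lemma Rintegral_sum_indic (I : finType) (c : I -> R) (A : I -> set T) :
  (forall i, measurable (A i)) ->
  \int[S]_w (\sum_i c i * \1_(A i) w) = \sum_i c i * fine (S (A i)).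
Proof.
move=> mA.
have iA i : S.-integrable [set: T] (fun w => (c i)%:E * (\1_(A i) w)%:E)%E.
  apply: integrableZl => //; apply: (@integrable_bounded _ _ _ S _ 1).
    exact: measurable_indic.
  by move=> w; rewrite indicE; case: (_ \in _); rewrite ?normr1 ?normr0.
rewrite /Rintegral; under eq_integral do rewrite -sumEFin.
rewrite integral_sum// (eq_bigr (fun i => (c i * fine (S (A i)))%:E)); last first.
  move=> i _; under eq_integral do rewrite EFinM.
  rewrite integralZl//; last first.
    apply: (@integrable_bounded _ _ _ S _ 1); first exact: measurable_indic.
    by move=> w; rewrite indicE; case: (_ \in _); rewrite ?normr1 ?normr0.
  by rewrite integral_indic// setIT EFinM fineK// fin_num_measure.
by rewrite sumEFin.
Qed.

Lemma Rintegral_cstT (r : R) : \int[S]_w r = r.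
Proof.
apply: etrans (Rintegral_cst S measurableT r) _; rewrite -[RHS]mulr1.
by congr (_ * _); exact: (congr1 fine (probability_setT S)).
Qed.

End finite_expectation.

Section rising_factorial.
Context {R : realType}.
Implicit Types (x : R) (s : nat).

Lemma risingS x s : rising x s.+1 = rising x s * (x + s%:R).
Proof. by rewrite /rising big_ord_recr. Qed.

Lemma rising1 x : rising x 1 = x.
Proof. by rewrite risingS /rising big_ord0 mul1r addr0. Qed.

Lemma rising_shift x s : x * rising (x + 1) s = rising x s * (x + s%:R).
Proof.
elim: s => [|s IH]; first by rewrite /rising !big_ord0 mulr1 mul1r addr0.
by rewrite !risingS mulrA IH -natr1; ring.
Qed.

Lemma rising_Gamma x s : 0 < x -> rising x s = Gamma (x + s%:R) / Gamma x.
Proof.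
move=> x0; elim: s => [|s IH].
  by rewrite /rising big_ord0 addr0 divff// gt_eqF// Gamma_gt0.
have xs : 0 < x + s%:R by rewrite ltr_wpDr.
rewrite risingS IH -natr1 addrA GammaS//; ring.
Qed.

End rising_factorial.

(** * The chain of the number of blocks *)

Section species_chain.
Context d (T : measurableType d) (R : realType) (S : probability T R).
Variables (alpha theta : R) (n k : nat) (K : nat -> T -> nat) (b : nat -> T -> bool).
Hypotheses (a01 : 0 < alpha < 1) (tha : - alpha < theta) (kn : (1 <= k <= n)%N).
Hypotheses (mK : forall N j, measurable [set w | K N w = j])
  (mb : forall N, measurable [set w | b N w])
  (KS : forall N w, K N.+1 w = (K N w + b N w)%N)
  (K_le : forall N w, (K N w <= N)%N)
  (K_gt0 : forall N w, (0 < N)%N -> (0 < K N w)%N)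
  (K_start : S [set w | K n w = k] = 1%E)
  (K_step : forall a N i j, (n <= a <= N)%N ->
    S ([set w | K a w = i /\ K N w = j] `&` [set w | b N w]) =
    ((new_prob alpha theta N j)%:E * S [set w | K a w = i /\ K N w = j])%E).
Local Notation p := (new_prob alpha theta).

Let a0 : 0 < alpha. Proof. by case/andP: a01. Qed.

Let thN N : (0 < N)%N -> 0 < theta + N%:R.
Proof.
case/andP: a01 => _ a1 N0.
rewrite -ltrBlDr sub0r; apply: le_lt_trans tha.
by rewrite lerN2 (le_trans (ltW a1))// ler1n.
Qed.

Let n0 : (0 < n)%N. Proof. by case/andP: kn => k1; exact: leq_trans. Qed.

Let mKK a N i j : measurable [set w | K a w = i /\ K N w = j].
Proof. exact: (measurableI _ _ (mK a i) (mK N j)). Qed.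

(** K takes finitely many values at each time, so every function of (K_a, K_N) is a finite
    combination of indicators, and measurability and integrability hold for arbitrary [H]. *)
Let KK_sum a N (H : nat -> nat -> R) (B : set T) w :
  H (K a w) (K N w) * \1_B w =
  \sum_(q : 'I_a.+1 * 'I_N.+1) H q.1 q.2 *
    \1_([set w | K a w = q.1 /\ K N w = q.2] `&` B) w.
Proof.
have iP : (K a w < a.+1)%N by rewrite ltnS.
have jP : (K N w < N.+1)%N by rewrite ltnS.
rewrite (bigD1 (Ordinal iP, Ordinal jP))//= big1 ?addr0.
  rewrite !indicE; congr (_ * _%:R); congr nat_of_bool.
  by apply/idP/idP; rewrite !inE => //= -[].
move=> [i j] /= ne; rewrite indicE memNset ?mulr0//= => -[[Ei Ej] _].
move: ne; rewrite -pair_eqE/= -!val_eqE/= Ei Ej !eqxx//.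
Qed.

Lemma measurable_KK a N (H : nat -> nat -> R) :
  measurable_fun [set: T] (fun w => H (K a w) (K N w)).
Proof.
rewrite (_ : (fun w => _) = (fun w => \sum_(q : 'I_a.+1 * 'I_N.+1) H q.1 q.2 *
    \1_([set w | K a w = q.1 /\ K N w = q.2] `&` setT) w)); last first.
  by apply/funext => w; rewrite -KK_sum indicT mulr1.
apply: measurable_sum => q; apply: measurable_funM => //.
by apply: measurable_indic; exact: measurableI.
Qed.

Lemma integrable_KK a N (H : nat -> nat -> R) :
  S.-integrable [set: T] (EFin \o (fun w => H (K a w) (K N w))).
Proof.
apply: (@integrable_bounded _ _ _ S _ (\sum_(q : 'I_a.+1 * 'I_N.+1) `|H q.1 q.2|)).
  exact: measurable_KK.
move=> w; have iP : (K a w < a.+1)%N by rewrite ltnS.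
have jP : (K N w < N.+1)%N by rewrite ltnS.
rewrite (bigD1 (Ordinal iP, Ordinal jP))//= lerDl.
by apply: sumr_ge0 => q _.
Qed.

Let E_KK a N (H : nat -> nat -> R) (B : set T) : measurable B ->
  \int[S]_w (H (K a w) (K N w) * \1_B w) =
  \sum_(q : 'I_a.+1 * 'I_N.+1) H q.1 q.2 *
    fine (S ([set w | K a w = q.1 /\ K N w = q.2] `&` B)).
Proof.
move=> mB; rewrite -Rintegral_sum_indic; last by move=> q; exact: measurableI.
by apply: eq_Rintegral => w _; exact: KK_sum.
Qed.

(** Conditional expectation given (K_a, K_N), written without conditioning: the indicator of a jump
    is replaced by its conditional probability while the past value K_a stays as a parameter. *)
Lemma expectation_next a N (G : nat -> nat -> R) : (n <= a <= N)%N ->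
  \int[S]_w G (K a w) (K N.+1 w) =
  \int[S]_w (G (K a w) (K N w) +
    p N (K N w) * (G (K a w) (K N w).+1 - G (K a w) (K N w))).
Proof.
move=> naN.
pose H i j := G i j.+1 - G i j.
have E1 : \int[S]_w (H (K a w) (K N w) * \1_([set w | b N w]) w) =
    \int[S]_w (p N (K N w) * H (K a w) (K N w)).
  rewrite E_KK//; under [RHS]eq_Rintegral => w _.
    rewrite -[_ * _]mulr1 -[X in _ * X](_ : \1_setT w = 1); last by rewrite indicT.
    over.
  rewrite (E_KK a N (fun i j => p N j * H i j))//; apply: eq_bigr => q _.
  rewrite K_step// setIT fineM//; last by apply: fin_num_measure; exact: mKK.
  by rewrite /=; ring.
have mbN : measurable_fun [set: T] (\1_([set w | b N w]) : T -> R).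
  exact: measurable_indic.
rewrite [RHS]RintegralD//; last 2 first.
- exact: integrable_KK.
- exact: (integrable_KK a N (fun i j => p N j * (G i j.+1 - G i j))).
rewrite -E1 -RintegralD//; last 2 first.
- exact: integrable_KK.
- apply: (@le_integrable _ _ _ S _ measurableT _
    (EFin \o (fun w => H (K a w) (K N w)))).
  + apply/measurable_EFinP; apply: measurable_funM => //; exact: measurable_KK.
  + move=> w _; rewrite /= lee_fin normrM ler_piMr//.
    by rewrite indicE; case: (_ \in _); rewrite ?normr1 ?normr0.
  + exact: integrable_KK.
apply: eq_Rintegral => w _; rewrite KS /H indicE.
have -> : (w \in [set w | b N w]) = b N w by apply/idP/idP; rewrite inE.
case: (b N w); first by rewrite addn1 mulr1 addrC subrK.
by rewrite addn0 mulr0 addr0.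
Qed.

Lemma expectation_start (G : nat -> R) : \int[S]_w G (K n w) = G k.
Proof.
have Kc : S (~` [set w | K n w = k]) = 0%E.
  by rewrite probability_setC// K_start subee.
transitivity (\int[S]_w (G k)); last first.
  exact: Rintegral_cstT.
rewrite /Rintegral; congr fine; apply: ae_eq_integral => //.
- by apply/measurable_EFinP; exact: (measurable_KK n n (fun i j => G i)).
- exists (~` [set w | K n w = k]); split.
  + exact: measurableC.
  + exact: Kc.
  + by move=> w /=; apply: contra_not => ->.
Qed.

(** The shift theta / alpha is chosen to make the jump probability proportional to the shifted
    state. *)
Lemma new_probE N j : (0 < N)%N ->
  p N j = alpha * (j%:R + theta / alpha) / (theta + N%:R).
Proof.
move=> N0; rewrite /new_prob; congr (_ / _).
by rewrite mulrDr [alpha * (_ / _)]mulrC divfK ?gt_eqF// addrC mulrC.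
Qed.

Local Notation x j := (j%:R + theta / alpha).

Let x_gt0 j : (0 < j)%N -> 0 < x j.
Proof.
move=> j0; apply: (@lt_le_trans _ _ (1 + theta / alpha)); last first.
  by rewrite lerD2r ler1n.
by rewrite addrC -ltrBlDr sub0r ltr_pdivlMr// mulN1r.
Qed.

(** By [rising_shift], one step multiplies the expectation by 1 + s alpha / (theta + N), which is
    also the factor by which Gamma(theta + N + s alpha) / Gamma(theta + N) grows. *)
Lemma expectation_rising s m :
  \int[S]_w rising (x (K (n + m) w)) s =
  limit_moment alpha theta n k s *
    (Gamma (theta + (n + m)%:R + s%:R * alpha) / Gamma (theta + (n + m)%:R)).
Proof.
have tn0 := thN n0.
have tns : 0 < theta + n%:R + s%:R * alpha.
  by rewrite ltr_wpDr// mulr_ge0// ltW.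
elim: m => [|m IH].
  rewrite addn0 (expectation_start (fun j => rising (x j) s)).
  case/andP: kn => k0 _; rewrite rising_Gamma ?x_gt0// /limit_moment.
  rewrite (addrC k%:R).
  have G1 := Gamma_gt0 tn0; have G2 := Gamma_gt0 tns.
  rewrite -mulrA -[LHS]mulr1; congr (_ * _).
  move: (Gamma (theta + n%:R)) (Gamma (theta + n%:R + s%:R * alpha)) G1 G2 => A B A0 B0.
  by field; rewrite !gt_eqF.
rewrite addnS; set N := (n + m)%N in IH *.
have N0 : (0 < N)%N by rewrite /N ltn_addr.
have nN : (n <= n <= N)%N by rewrite leqnn leq_addr.
rewrite (expectation_next (fun _ j => rising (x j) s) nN).
transitivity (\int[S]_w ((1 + s%:R * alpha / (theta + N%:R)) * rising (x (K N w)) s)).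
  apply: eq_Rintegral => w _.
  have xK : 0 < x (K N w) by rewrite x_gt0// K_gt0.
  rewrite new_probE//.
  have -> : x (K N w).+1 = x (K N w) + 1 by rewrite -natr1; ring.
  have := rising_shift (x (K N w)) s.
  have tN := thN N0.
  move: (rising (x (K N w) + 1) s) (rising (x (K N w)) s) => r1 r E.
  have -> : r1 = r * (x (K N w) + s%:R) / x (K N w).
    by rewrite -E mulrAC divff ?mul1r// gt_eqF.
  move: (x (K N w)) xK => y y0.
  by field; rewrite !gt_eqF.
rewrite RintegralZl; [|by []|exact: (integrable_KK n N (fun _ j => rising (x j) s))].
rewrite IH -natr1.
have tN := thN N0.
have tNs : 0 < theta + N%:R + s%:R * alpha.
  by rewrite ltr_wpDr// mulr_ge0// ltW.
have -> : theta + (N%:R + 1) + s%:R * alpha = theta + N%:R + s%:R * alpha + 1 by ring.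
rewrite addrA !GammaS//.
have G1 := Gamma_gt0 tN; have G2 := Gamma_gt0 tNs.
move: (Gamma (theta + N%:R)) (Gamma (theta + N%:R + s%:R * alpha)) G1 G2 => A B A0 B0.
by field; rewrite !gt_eqF.
Qed.

(** Orthogonality of martingale increments in inductive form: one more step adds at most the second
    moment of a jump, c_{N+1}^2 times its probability, and its expectation is at most M (c_N -
    c_{N+1}), which telescopes. *)
Lemma variance_bound_aux (c : nat -> R) (M : R) a m :
  (forall N, (0 < N)%N -> 0 < c N) ->
  (forall N, (0 < N)%N -> c N = c N.+1 * (1 + alpha / (theta + N%:R))) ->
  0 <= M -> (forall N, (n <= N)%N -> \int[S]_w x (K N w) = M / c N) ->
  (n <= a)%N ->
  \int[S]_w (c (a + m)%N * x (K (a + m) w) - c a * x (K a w)) ^+ 2 <=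
  M * (c a - c (a + m)%N).
Proof.
move=> c_gt0 cS M0 Ex na; elim: m => [|m IH].
  rewrite addn0 subrr mulr0.
  under eq_Rintegral do rewrite subrr expr0n.
  by rewrite Rintegral_cstT.
rewrite addnS; set N := (a + m)%N in IH *.
have nN : (n <= N)%N by rewrite /N (leq_trans na)// leq_addr.
have N0 : (0 < N)%N by exact: leq_trans nN.
have naN : (n <= a <= N)%N by rewrite na leq_addr.
rewrite (expectation_next
  (fun i j => (c N.+1 * x j - c a * x i) ^+ 2) naN).
have tN := thN N0.
have c1 := c_gt0 _ N0; have c2 := c_gt0 _ (ltn0Sn N).
have cE := cS _ N0.
(* By [cS], c_N x = c_{N+1} (x + p) with p the jump probability. The bound keeps c_{N+1}^2 p where
   the exact variance has p (1 - p); the gap between the two integrands is the square of c_{N+1}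
   p. *)
apply: (@le_trans _ _ (\int[S]_w ((c N * x (K N w) - c a * x (K a w)) ^+ 2 +
   (c N.+1 ^+ 2 * alpha / (theta + N%:R)) * x (K N w)))).
  apply: le_Rintegral => //.
  - exact: (integrable_KK a N (fun i j => (c N.+1 * x j - c a * x i) ^+ 2 +
      p N j * ((c N.+1 * x j.+1 - c a * x i) ^+ 2 - (c N.+1 * x j - c a * x i) ^+ 2))).
  - exact: (integrable_KK a N (fun i j => (c N * x j - c a * x i) ^+ 2 +
      (c N.+1 ^+ 2 * alpha / (theta + N%:R)) * x j)).
  move=> w _; rewrite cE -natr1.
  have -> : c N.+1 ^+ 2 * alpha / (theta + N%:R) * x (K N w) =
      c N.+1 ^+ 2 * p N (K N w) by rewrite new_probE//; ring.
  have -> : c N.+1 * (1 + alpha / (theta + N%:R)) * x (K N w) =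
      c N.+1 * (x (K N w) + p N (K N w)) by rewrite new_probE//; ring.
  rewrite -subr_ge0 (_ : _ - _ = (c N.+1 * p N (K N w)) ^+ 2); last by ring.
  exact: sqr_ge0.
rewrite RintegralD//; last 2 first.
- exact: (integrable_KK a N (fun i j => (c N * x j - c a * x i) ^+ 2)).
- exact: (integrable_KK a N (fun i j => (c N.+1 ^+ 2 * alpha / (theta + N%:R)) * x j)).
rewrite RintegralZl//; last exact: (integrable_KK a N (fun i j => x j)).
rewrite Ex//.
have -> : M * (c a - c N.+1) = M * (c a - c N) + M * (c N - c N.+1) by ring.
apply: lerD => //.
have -> : c N.+1 ^+ 2 * alpha / (theta + N%:R) * (M / c N) =
    M * (c N.+1 * (alpha / (theta + N%:R)) * (c N.+1 / c N)) by ring.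
rewrite ler_wpM2l//.
have -> : c N - c N.+1 = c N.+1 * (alpha / (theta + N%:R)) by rewrite cE; ring.
rewrite ler_piMr//.
  by rewrite mulr_ge0 ?divr_ge0 ?(ltW c2) ?(ltW a0) ?(ltW tN).
rewrite ler_pdivrMr// mul1r cE ler_peMr ?(ltW c2)// lerDl.
by rewrite divr_ge0 ?(ltW a0) ?(ltW tN).
Qed.

(* [chain_scale N * (K N + theta / alpha)] is a martingale. *)
Definition chain_scale N : R := Gamma (theta + N%:R) / Gamma (theta + N%:R + alpha).

Lemma chain_scale_gt0 N : (0 < N)%N -> 0 < chain_scale N.
Proof.
by move=> N0; have tN := thN N0; rewrite divr_gt0 ?Gamma_gt0// addr_gt0.
Qed.

Lemma chain_scaleS N : (0 < N)%N ->
  chain_scale N = chain_scale N.+1 * (1 + alpha / (theta + N%:R)).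
Proof.
move=> N0; have tN := thN N0.
have tNa : 0 < theta + N%:R + alpha by rewrite addr_gt0.
rewrite /chain_scale -natr1.
have -> : theta + (N%:R + 1) + alpha = theta + N%:R + alpha + 1 by ring.
rewrite addrA !GammaS//.
have G1 := Gamma_gt0 tN; have G2 := Gamma_gt0 tNa.
move: (Gamma (theta + N%:R)) (Gamma (theta + N%:R + alpha)) G1 G2 => A B A0 B0.
by field; rewrite !gt_eqF.
Qed.

Local Notation c := chain_scale.

Lemma limit_moment_gt0 s : 0 < limit_moment alpha theta n k s.
Proof.
case/andP: kn => k0 _; have := x_gt0 k0; rewrite addrC => s0.
have t0 := thN n0.
rewrite /limit_moment mulr_gt0 ?divr_gt0 ?Gamma_gt0//.
  by rewrite ltr_wpDr.
by rewrite ltr_wpDr// mulr_ge0// ltW.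
Qed.

Lemma variance_bound a m : (n <= a)%N ->
  \int[S]_w (c (a + m)%N * x (K (a + m) w) - c a * x (K a w)) ^+ 2 <=
  limit_moment alpha theta n k 1 * c a.
Proof.
move=> na; have a0' : (0 < a)%N by exact: leq_trans na.
have M0 := limit_moment_gt0 1.
apply: le_trans (variance_bound_aux m chain_scale_gt0 chain_scaleS (ltW M0) _ na) _.
  move=> N nN; have := expectation_rising 1 (N - n).
  rewrite subnKC// mul1r; under eq_Rintegral do rewrite rising1.
  by move=> ->; rewrite /chain_scale invf_div.
apply: ler_wpM2l; first exact: ltW.
by rewrite lerBlDr lerDl ltW// chain_scale_gt0// ltn_addr.
Qed.

Lemma chain_scale_le m : (0 < m)%N ->
  c (n + m)%N * m%:R `^ alpha <= 1 + alpha / (theta + n%:R).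
Proof.
move=> m0; have tn := thN n0.
have nm0 : (0 < n + m)%N by rewrite ltn_addr.
have tnm := thN nm0.
have /andP[_] := Gamma_ratio_bounds tnm a01; rewrite -/(c (n + m)%N) => h.
apply: (@le_trans _ _ (c (n + m)%N * (theta + (n + m)%:R) `^ alpha)).
  apply: ler_wpM2l; first by rewrite ltW// chain_scale_gt0.
  rewrite ge0_ler_powR ?nnegrE ?(ltW a0) ?(ltW tnm)//.
  by rewrite natrD addrA lerDr ltW.
apply: (le_trans h); rewrite lerD2l ler_wpM2l ?(ltW a0)//.
by rewrite lef_pV2 ?posrE// lerD2l ler_nat leq_addr.
Qed.

Lemma chain_deviation_prob (q m : nat) (e : R) : 0 < e -> (n <= q)%N ->
  (S [set w | (e <= (c (q + m)%N * x (K (q + m) w) - c q * x (K q w)) ^+ 2)%R] <=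
   (limit_moment alpha theta n k 1 * c q / e)%:E)%E.
Proof.
move=> e0 nq.
pose H i j := (c (q + m)%N * x j - c q * x i) ^+ 2.
have iH := integrable_KK q (q + m) H.
have := @le_integral_abse _ _ _ S setT measurableT
  (EFin \o (fun w => H (K q w) (K (q + m)%N w))) e.
case/integrableP : (iH) => mH _ /(_ mH e0); rewrite setTI => h.
have {h} : (e%:E * S [set w | (e <= H (K q w) (K (q + m)%N w))%R] <=
    (\int[S]_w H (K q w) (K (q + m)%N w))%:E)%E.
  apply: (le_trans (le_trans _ h)).
    rewrite le_eqVlt; apply/orP; left; apply/eqP; congr (_ * S _)%E.
    by apply/seteqP; split => w /=; rewrite lee_fin ger0_norm ?sqr_ge0.
  rewrite /Rintegral fineK; last exact: integrable_fin_num.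
  rewrite le_eqVlt; apply/orP; left; apply/eqP; apply: eq_integral => w _.
  by rewrite /= ger0_norm ?sqr_ge0.
move=> h; rewrite -(lee_pmul2l _ _ (x := e%:E))//.
apply: (le_trans h); rewrite -EFinM lee_fin.
rewrite mulrCA mulfV ?gt_eqF// mulr1.
exact: variance_bound.
Qed.

(** Along m = j^q the variance is of order at most j^(-6). Deviations above j^(-2) have squares
    above j^(-4), so their probabilities are of order j^(-2), which is summable. *)
Let ex_exponent : exists q : nat, (0 < q)%N /\ 6 <= q%:R * alpha.
Proof.
exists (Num.truncn (6 / alpha)).+1; split => //.
by rewrite -ler_pdivrMr// ltW// truncnS_gt.
Qed.

(* Makes the increments of ae_small_increments telescope. *)
Let sub_gap (j : nat) : (j.+1%:R^-1 : R) ^+ 2 <= 2 * (j.+1%:R^-1 - j.+2%:R^-1).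
Proof.
have j1 : 0 < j.+1%:R :> R by rewrite ltr0n.
rewrite -[j.+2%:R]natr1; move: (j.+1%:R) j1 (ler1n R j.+1) => y y0 y1.
have y10 : 0 < y + 1 by rewrite addr_gt0.
rewrite -subr_ge0 (_ : _ - _ = (y - 1) / (y ^+ 2 * (y + 1))).
  by rewrite divr_ge0 ?subr_ge0 ?y1// mulr_ge0 ?exprn_ge0 ?(ltW y10) ?(ltW y0).
by field; rewrite !gt_eqF.
Qed.

Let ae_small_increments q : (0 < q)%N -> 6 <= q%:R * alpha ->
  {ae S, forall w, exists J, forall j, (J <= j)%N ->
    `|c (n + j.+2 ^ q)%N * x (K (n + j.+2 ^ q) w) -
      c (n + j.+1 ^ q)%N * x (K (n + j.+1 ^ q) w)| <= (j.+1%:R^-1) ^+ 2}.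
Proof.
move=> q0 q6.
pose D j w := c (n + j.+2 ^ q)%N * x (K (n + j.+2 ^ q) w) -
      c (n + j.+1 ^ q)%N * x (K (n + j.+1 ^ q) w).
pose F j := [set w | (j.+1%:R^-1) ^+ 4 <= D j w ^+ 2].
pose C := limit_moment alpha theta n k 1 * (1 + alpha / (theta + n%:R)).
have C0 : 0 <= C.
  rewrite mulr_ge0 ?(ltW (limit_moment_gt0 1))// addr_ge0// divr_ge0 ?(ltW a0)//.
  by rewrite ltW// thN.
have mF j : measurable (F j).
  have mD := measurable_KK (n + j.+1 ^ q) (n + j.+2 ^ q)
    (fun i l => (c (n + j.+2 ^ q)%N * x l - c (n + j.+1 ^ q)%N * x i) ^+ 2).
  have := mD measurableT _ (measurable_itv `[(j.+1%:R^-1) ^+ 4, +oo[).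
  rewrite setTI; congr (measurable _).
  by apply/seteqP; split => w /=; rewrite in_itv/= andbT.
have SF j : (S (F j) <= (2 * C * (j.+1%:R^-1 - j.+2%:R^-1))%:E)%E.
  have le_pow : (j.+1 ^ q <= j.+2 ^ q)%N by rewrite leq_exp2r.
  have := @chain_deviation_prob (n + j.+1 ^ q) (j.+2 ^ q - j.+1 ^ q)
    ((j.+1%:R^-1) ^+ 4) _ (leq_addr _ _).
  rewrite -addnA subnKC// => h; apply: (le_trans (h _)).
    by rewrite exprn_gt0// invr_gt0.
  rewrite lee_fin {h}.
  have m0 : (0 < j.+1 ^ q)%N by rewrite expn_gt0.
  have := chain_scale_le m0.
  have -> : (j.+1 ^ q)%:R `^ alpha = j.+1%:R `^ (q%:R * alpha) :> R.
    by rewrite natrX -powR_mulrn// -powRrM.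
  move=> h.
  have j6 : j.+1%:R ^+ 6 <= j.+1%:R `^ (q%:R * alpha) :> R.
    by rewrite -powR_mulrn// ler_powR// ler1n.
  have c0 : 0 < c (n + j.+1 ^ q)%N by rewrite chain_scale_gt0// ltn_addr.
  have h2 : c (n + j.+1 ^ q)%N * j.+1%:R ^+ 6 <= 1 + alpha / (theta + n%:R).
    by apply: le_trans h; rewrite ler_wpM2l// ltW.
  rewrite exprVn invrK.
  apply: (@le_trans _ _ (C * (j.+1%:R^-1) ^+ 2)).
    rewrite -mulrA -[leRHS]mulrA; apply: ler_wpM2l.
      exact: ltW (limit_moment_gt0 1).
    by rewrite exprVn ler_pdivlMr ?exprn_gt0// -mulrA -exprD.
  rewrite (mulrC 2 C) -(mulrA C 2); apply: ler_wpM2l => //.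
have sumF : (\sum_(j <oo) S (F j) < +oo)%E.
  apply: (@le_lt_trans _ _ (2 * C)%:E); last by rewrite ltry.
  apply: lime_le; first by apply: is_cvg_nneseries.
  apply: nearW => J.
  apply: (@le_trans _ _ (2 * C * (1 - J.+1%:R^-1))%:E); last first.
    rewrite lee_fin; apply: ler_piMr; first exact: mulr_ge0.
    by rewrite lerBlDr lerDl invr_ge0.
  elim: J => [|J IH]; first by rewrite big_geq// invr1 subrr mulr0.
  rewrite big_nat_recr//=; apply: (le_trans (leeD IH (SF J))).
  by rewrite -EFinD lee_fin -mulrDr addrA subrK.
(* Borel-Cantelli: the outcomes lying in infinitely many [F j] form a null set, and outside it all
   late increments are small. *)
exists (lim_sup_set F); split.
- by apply: bigcapT_measurable => j; apply: bigcup_measurable => i _; exact: mF.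
- exact: lim_sup_set_cvg0.
move=> w /= nw j _; apply: contrapT => hj; apply: nw.
exists j => i /= ji; rewrite -(@ler_pXn2r _ 2)// ?nnegrE ?exprn_ge0 ?invr_ge0//.
rewrite -exprM -normrX ger0_norm ?sqr_ge0// leNgt; apply/negP => hlt.
by apply: hj; exists i => //; exact: ltW.
Qed.

Lemma ae_cvg_new_species :
  {ae S, forall w, exists L : R,
    ((K (n + m) w)%:R - (K n w)%:R) / m%:R `^ alpha @[m --> \oo] --> L}.
Proof.
have [q [q0 q6]] := ex_exponent.
apply: filterS (ae_small_increments q0 q6) => w [J HJ].
pose M j := c (n + j.+1 ^ q)%N * x (K (n + j.+1 ^ q) w).
(* Increments are at most 2 / (j + 1) - 2 / (j + 2) from [J] on. Subtracting 2 / (j + 1) makes the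
   sequence increase, adding it makes it decrease, and the two bounds enclose the limit. *)
pose lo j := M (j + J)%N - 2 * (j + J).+1%:R^-1.
pose hi j := M (j + J)%N + 2 * (j + J).+1%:R^-1.
have incr j : `|M (j + J).+1 - M (j + J)%N| <=
    2 * ((j + J).+1%:R^-1 - (j + J).+2%:R^-1).
  by apply: le_trans (HJ _ (leq_addl _ _)) _; exact: sub_gap.
have lo_nd : nondecreasing_seq lo.
  apply/nondecreasing_seqP => j; rewrite /lo addSn.
  by have := incr j; rewrite ler_norml => /andP[+ _];
    move: (M _) (M _) (_^-1) (_^-1) => *; lra.
have hi_ni j : hi j <= hi 0%N.
  elim: j => // j; apply: le_trans; rewrite /hi addSn.
  by have := incr j; rewrite ler_norml => /andP[_ +];
    move: (M _) (M _) (_^-1) (_^-1) => *; lra.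
have lo_cvg : cvgn lo.
  apply: nondecreasing_is_cvgn => //; exists (hi 0%N) => _ [j _ <-].
  apply: le_trans (hi_ni j); rewrite /lo /hi lerD2l.
  by rewrite (@le_trans _ _ 0)// ?oppr_le0 mulr_ge0 ?invr_ge0.
have M_cvg : M j @[j --> \oo] --> limn lo.
  have h : 2 * (j + J).+1%:R^-1 @[j --> \oo] --> (2 * 0 : R).
    apply: cvgMl_tmp; rewrite (cvg_shiftn J (@harmonic R)).
    exact: cvg_harmonic.
  have : (fun j => M (j + J)%N) @ \oo --> limn lo.
    rewrite (_ : (fun j => M (j + J)%N) =
        lo \+ (fun j => 2 * (j + J).+1%:R^-1)); last first.
      by apply/funext => j /=; rewrite /lo subrK.
    by have := cvgD lo_cvg h; rewrite mulr0 addr0; apply.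
  by rewrite (cvg_shiftn J M).
exists (limn lo).
apply: (@cvg_poly_subseq _ (fun m => (K (n + m) w)%:R - (K n w)%:R) alpha _ q) => //.
- apply/nondecreasing_seqP => m; rewrite lerD2r ler_nat addnS KS; exact: leq_addr.
- move=> m; rewrite subr_ge0 ler_nat; elim: m => [|m IH]; first by rewrite addn0.
  by rewrite addnS KS (leq_trans IH)// leq_addr.
have tn := thN n0.
(* The predecessor compensates for the Gamma asymptotics being indexed by [m.+1]. *)
have pow_oo : (fun j => (j.+1 ^ q).-1) @ \oo --> \oo.
  move=> A [N _ NA]; exists N => // j /= Nj; apply: NA => /=.
  apply: (leq_trans Nj); rewrite -ltnS prednK ?expn_gt0//.
  by rewrite -[X in (X <= _)%N]expn1 leq_pexp2l.
have c1 : c (n + j.+1 ^ q)%N * (j.+1 ^ q)%:R `^ alpha @[j --> \oo] --> (1 : R).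
  have := cvg_comp _ _ pow_oo (cvg_Gamma_ratio tn a01).
  move=> hc; apply: cvg_trans hc; apply: near_eq_cvg; apply: nearW => j /=.
  rewrite prednK; last by rewrite expn_gt0.
  by rewrite /c (natrD R n) addrA.
have inv0 : ((j.+1 ^ q)%:R^-1 `^ alpha) @[j --> \oo] --> (0 : R).
  apply: (@cvg_powR0 _ (fun j => (j.+1 ^ q)%:R^-1)) => //.
  have := cvg_comp _ _ pow_oo (@cvg_harmonic R).
  move=> hc; apply: cvg_trans hc; apply: near_eq_cvg; apply: nearW => j /=.
  by rewrite prednK ?expn_gt0.
pose cm j := c (n + j.+1 ^ q)%N * (j.+1 ^ q)%:R `^ alpha.
have cmV : (cm j)^-1 @[j --> \oo] --> (1 : R).
  have := cvgV (oner_neq0 R) c1; rewrite invr1; exact.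
(* Dividing by [cm] replaces the Gamma scaling by the power of m; the second term removes K_n and
   the shift theta / alpha. *)
have : M j * (cm j)^-1 - x (K n w) * (j.+1 ^ q)%:R^-1 `^ alpha @[j --> \oo]
    --> limn lo * 1 - x (K n w) * 0.
  apply: cvgB; first exact: cvgM.
  exact: cvgMl_tmp.
rewrite mulr1 mulr0 subr0; move=> hc; apply: cvg_trans hc; apply: near_eq_cvg; apply: nearW => j.
rewrite /= /M /cm powR_invl// powRN.
have C0 : 0 < c (n + j.+1 ^ q)%N by rewrite chain_scale_gt0// ltn_addr.
have P0 : 0 < (j.+1 ^ q)%:R `^ alpha :> R by rewrite powR_gt0// ltr0n expn_gt0.
move: (c _) (_ `^ _) C0 P0 => A B A0 B0.
by field; rewrite !gt_eqF.
Qed.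

End species_chain.

(** * Convergence of moments and identification of laws *)

Section moment_convergence.
Context d (T : measurableType d) (R : realType) (S : probability T R).
Variables (alpha theta : R) (n k : nat) (y : nat -> T -> R).
Hypotheses (a01 : 0 < alpha < 1) (thn : 0 < theta + n%:R).
Hypothesis integrable_y : forall m r s,
  S.-integrable [set: T] (EFin \o (fun w => y m w ^+ r * rising (y m w) s)).
Hypothesis expectation_y : forall s m,
  \int[S]_w rising (y m w) s = limit_moment alpha theta n k s *
    (Gamma (theta + (n + m)%:R + s%:R * alpha) / Gamma (theta + (n + m)%:R)).

(** Trades rising factorials for powers one factor at a time: y^(r+1) (y)_s = y^r (y)_(s+1) - s y^r
    (y)_s, where the last term is of lower order by m^(- alpha). The induction on [r] needs all [s]
    at once. *)
Lemma cvg_mixed_moment r s :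
  (\int[S]_w (y m.+1 w ^+ r * rising (y m.+1 w) s)) /
    m.+1%:R `^ ((r + s)%:R * alpha) @[m --> \oo] -->
  limit_moment alpha theta n k (r + s).
Proof.
have [a0 _] := andP a01.
elim: r s => [|r IH] s.
  rewrite add0n.
  have h : limit_moment alpha theta n k s *
      (Gamma (theta + n%:R + m.+1%:R + s%:R * alpha) /
        Gamma (theta + n%:R + m.+1%:R) / m.+1%:R `^ (s%:R * alpha))
      @[m --> \oo] --> limit_moment alpha theta n k s * 1.
    by apply: cvgMl_tmp; exact: cvg_Gamma_ratioM.
  move: h; rewrite mulr1 => h; apply: cvg_trans h.
  apply: near_eq_cvg; apply: nearW => m /=.
  under eq_Rintegral do rewrite expr0 mul1r.
  by rewrite expectation_y (natrD R n) addrA mulrA.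
have inv0 : m.+1%:R^-1 `^ alpha @[m --> \oo] --> (0 : R).
  apply: (@cvg_powR0 _ (fun m => m.+1%:R^-1)) => //.
  exact: cvg_harmonic.
have h : (\int[S]_w (y m.+1 w ^+ r * rising (y m.+1 w) s.+1)) /
      m.+1%:R `^ ((r + s.+1)%:R * alpha) -
    s%:R * ((\int[S]_w (y m.+1 w ^+ r * rising (y m.+1 w) s)) /
      m.+1%:R `^ ((r + s)%:R * alpha) * m.+1%:R^-1 `^ alpha)
    @[m --> \oo] --> limit_moment alpha theta n k (r + s.+1) -
      s%:R * (limit_moment alpha theta n k (r + s) * 0).
  apply: cvgB; first exact: IH.
  by apply: cvgMl_tmp; apply: cvgM.
move: h; rewrite !mulr0 subr0 addnS -addSn => h; apply: cvg_trans h.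
apply: near_eq_cvg; apply: nearW => m /=.
have y0 : 0 < m.+1%:R :> R by rewrite ltr0n.
rewrite (_ : \int[S]_w (y m.+1 w ^+ r.+1 * rising (y m.+1 w) s) =
    \int[S]_w (y m.+1 w ^+ r * rising (y m.+1 w) s.+1) -
    s%:R * \int[S]_w (y m.+1 w ^+ r * rising (y m.+1 w) s)); last first.
  rewrite -(RintegralZl s%:R measurableT (integrable_y m.+1 r s)).
  rewrite -(RintegralB measurableT (integrable_y m.+1 r s.+1)
    (integrableZl measurableT s%:R (integrable_y m.+1 r s))).
  apply: eq_Rintegral => w _; rewrite risingS exprSr; ring.
have -> : m.+1%:R `^ ((r.+1 + s)%:R * alpha) =
    m.+1%:R `^ ((r + s)%:R * alpha) * m.+1%:R `^ alpha :> R.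
  rewrite -(@gt0_powRD _ m.+1%:R)//; congr (_ `^ _).
  by rewrite addSn -natr1 mulrDl mul1r.
rewrite powR_invl// powRN.
have A0 : 0 < m.+1%:R `^ ((r + s)%:R * alpha) :> R by rewrite powR_gt0.
have B0 : 0 < m.+1%:R `^ alpha :> R by rewrite powR_gt0.
move: (Rintegral _ _ _) (Rintegral _ _ _) (_ `^ _) (_ `^ _) A0 B0 => I1 I2 A B A0 B0.
by field; rewrite !gt_eqF.
Qed.

Lemma cvg_moment r :
  \int[S]_w ((y m.+1 w / m.+1%:R `^ alpha) ^+ r) @[m --> \oo] -->
  limit_moment alpha theta n k r.
Proof.
have := @cvg_mixed_moment r 0; rewrite addn0 => h; apply: cvg_trans h.
apply: near_eq_cvg; apply: nearW => m /=.
rewrite mulrC -(RintegralZl _ measurableT (integrable_y m.+1 r 0)).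
apply: eq_Rintegral => w _.
rewrite /rising big_ord0 mulr1 exprMn mulrC; congr (_ * _).
by rewrite exprVn -powR_mulrn ?powR_ge0// -powRrM mulrC.
Qed.

End moment_convergence.

Lemma cvg_laplace d (T : measurableType d) (R : realType) (S : probability T R)
    (Y : nat -> T -> R) (Z : T -> R) (t : R) :
  (forall m, measurable_fun [set: T] (Y m)) -> (forall m w, 0 <= Y m w) ->
  measurable_fun [set: T] Z ->
  {ae S, forall w, Y m w @[m --> \oo] --> Z w} -> 0 <= t ->
  laplace S (Y m) t @[m --> \oo] --> laplace S Z t.
Proof.
move=> mY Y0 mZ YZ t0.
have me (X : T -> R) : measurable_fun [set: T] X ->
    measurable_fun [set: T] (fun w => (expR (- (t * X w)))%:E).
  by move=> mX; apply/measurable_EFinP; apply: measurable_fun_expR;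
    apply: measurableT_comp => //; apply: measurable_funM.
have [] := @dominated_convergence _ _ _ S setT measurableT
  (fun m w => (expR (- (t * Y m w)))%:E) (fun w => (expR (- (t * Z w)))%:E)
  (cst 1%E).
- by move=> m; exact: me.
- exact: me.
- apply: filterS YZ => w YZ _; apply: cvg_EFin; first exact: nearW.
  apply: continuous_cvg; first exact: continuous_expR.
  by apply: cvgN; apply: cvgMl_tmp.
- exact: finite_measure_integrable_cst.
- apply: aeW => w m _ /=; rewrite lee_fin ger0_norm ?expR_ge0//.
  by rewrite expR_le1 oppr_le0 mulr_ge0.
by move=> _ _.
Qed.

Lemma method_of_moments (R : realType)
    d1 (T1 : measurableType d1) (P : probability T1 R) (X : nat -> T1 -> R)
    (Z : T1 -> R) d2 (T2 : measurableType d2) (Q : probability T2 R) (Y : T2 -> R)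
    (M : nat -> R) :
  (forall m, measurable_fun [set: T1] (X m)) -> (forall m w, 0 <= X m w) ->
  (forall m j, P.-integrable [set: T1] (EFin \o (fun w => X m w ^+ j))) ->
  (forall j, \int[P]_w (X m w ^+ j) @[m --> \oo] --> M j) ->
  (forall t, 0 <= t -> t ^+ j / j`!%:R * M j @[j --> \oo] --> (0 : R)) ->
  measurable_fun [set: T1] Z -> (forall w, 0 <= Z w) ->
  {ae P, forall w, X m w @[m --> \oo] --> Z w} ->
  measurable_fun [set: T2] Y -> (forall w, 0 <= Y w) ->
  (forall j, (\int[Q]_w (Y w ^+ j)%:E = (M j)%:E)%E) ->
  forall A : set R, measurable A -> P (Z @^-1` A) = Q (Y @^-1` A).
Proof.
move=> mX X0 iX XM M0 mZ Z0 XZ mY Y0 YM A mA.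
apply: laplace_inj => // t t0.
have fin d (T : measurableType d) (S : probability T R) (W : T -> R) :
    measurable_fun [set: T] W -> (forall w, 0 <= W w) ->
    laplace S W t \is a fin_num.
  move=> mW W0; apply: integrable_fin_num => //.
  apply: (@integrable_bounded _ _ _ S (fun w => expR (- (t * W w))) 1).
    by apply: measurable_fun_expR; apply: measurableT_comp => //; apply: measurable_funM.
  by move=> w; rewrite ger0_norm ?expR_ge0// expR_le1 oppr_le0 mulr_ge0.
rewrite -(fineK (fin _ _ P Z mZ Z0)) -(fineK (fin _ _ Q Y mY Y0)); congr EFin.
apply/eqP; rewrite -subr_eq0 -normr_eq0 eq_le normr_ge0 andbT.
have hJ J : `|fine (laplace P Z t) - fine (laplace Q Y t)| <=
    2 * (t ^+ J / J`!%:R * M J).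
  have c1 : `|fine (laplace P (X m) t) - fine (laplace Q Y t)| @[m --> \oo] -->
      `|fine (laplace P Z t) - fine (laplace Q Y t)|.
    apply: cvg_norm; apply: cvgB; last exact: cvg_cst.
    by apply: fine_cvg; rewrite fineK ?fin//; exact: cvg_laplace.
  have c2 : \sum_(j < J) t ^+ j / j`!%:R * `|\int[P]_w (X m w ^+ j) - M j| +
      t ^+ J / J`!%:R * (\int[P]_w (X m w ^+ J) + M J) @[m --> \oo] -->
      \sum_(j < J) t ^+ j / j`!%:R * `|M j - M j| +
      t ^+ J / J`!%:R * (M J + M J).
    apply: cvgD.
      apply: cvg_big => [|j _]; first exact: add_continuous.
      apply: cvgMl_tmp; apply: cvg_norm.
      by apply: cvgB; [exact: XM|exact: cvg_cst].
    by apply: cvgMl_tmp; apply: cvgD; [exact: XM|exact: cvg_cst].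
  move: c2; rewrite big1 ?add0r; last first.
    by move=> j _; rewrite subrr normr0 mulr0.
  rewrite (_ : _ * (M J + M J) = 2 * (t ^+ J / J`!%:R * M J)); last by ring.
  move=> c2; apply: (ler_cvg_to c1 c2); apply: nearW => m.
  apply: (@laplace_moment_dist _ _ _ _ (X m)
    (fun j => \int[P]_w (X m w ^+ j)) _ _ _ Y M) => // j.
  by rewrite /Rintegral fineK//; apply: integrable_fin_num => //; exact: iX.
have c : 2 * (t ^+ J / J`!%:R * M J) @[J --> \oo] --> (2 * 0 : R).
  by apply: cvgMl_tmp; exact: M0.
rewrite -(mulr0 2); apply: (ler_cvg_to (cvg_cst _) c); exact: nearW.
Qed.

(** * Identification of the limit law *)

(** The upper limit is measurable and defined everywhere; [fine] and the absolute value make it real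
    and nonnegative also where the sequence diverges. *)
Lemma measurable_ae_limit d (T : measurableType d) (R : realType)
    (S : probability T R) (U : nat -> T -> R) :
  (forall m, measurable_fun [set: T] (U m)) -> (forall m w, 0 <= U m w) ->
  {ae S, forall w, exists L : R, U m w @[m --> \oo] --> L} ->
  exists Z : {RV S >-> R}, (forall w, 0 <= Z w) /\
    {ae S, forall w, U m w @[m --> \oo] --> Z w}.
Proof.
move=> mU U0 UL.
pose Z w := `|fine (limn_esup (fun m => (U m w)%:E))|.
have mZ : measurable_fun [set: T] Z.
  apply: measurableT_comp => //; apply: measurableT_comp => //.
  by apply: measurable_fun_limn_esup => m; exact/measurable_EFinP.
pose Z' : {RV S >-> R} :=
  HB.pack Z (isMeasurableFun.Build _ _ T R Z mZ).
exists Z'.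
split=> [w|]; first exact: normr_ge0.
apply: filterS UL => w [L UL] /=.
have L0 : 0 <= L by apply: (cvgr_to_ge UL); exact: nearW.
have UE : (U m w)%:E @[m --> \oo] --> L%:E.
  by apply: cvg_EFin => //; exact: nearW.
by rewrite /Z (cvg_limn_einf_sup UE).2 /= ger0_norm.
Qed.

Unset Implicit Arguments.

Theorem proposition7 (R : realType) (d : measure_display)
    (T : measurableType d) (P : probability T R) (alpha theta : R)
    (Pi : random_partition T) (n k : nat)
    (halpha : 0 < alpha < 1) (htheta : - alpha < theta)
    (hn : (1 <= n)%N) (hk : (1 <= k <= n)%N)
    (hPi : poisson_dirichlet P alpha theta Pi) :
  exists Z : {RV (cond_num_blocks P Pi n k) >-> R},
    {ae (cond_num_blocks P Pi n k), forall w,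
      (fun m : nat => num_new_blocks Pi n m w / m%:R `^ alpha) @ \oo --> Z w} /\
    forall f : R -> R, stable_density alpha f ->
      forall A : set R, measurable A ->
        (distribution (cond_num_blocks P Pi n k) Z A =
         \int[lebesgue_measure]_(z in A `&` `]0%R, +oo[)
           limit_density alpha theta n k f z)%E.
Proof.
set S := cond_num_blocks P Pi n k.
have [a0 a1] := andP halpha; have [k0 kn] := andP hk.
have thn N : (0 < N)%N -> 0 < theta + N%:R.
  by move=> N0; rewrite -ltrBlDr sub0r (lt_le_trans _ (ltW htheta))// ltrN2
    (lt_le_trans a1)// ler1n.
have ta : 0 < 1 + theta / alpha.
  by rewrite -(@pmulr_lgt0 _ alpha)// mulrDl mul1r divfK ?gt_eqF//; lra.
pose K := num_blocks Pi.
have mK N j : measurable [set w | K N w = j] by exact: measurable_num_blocks.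
have K_le := num_blocks_le Pi; have K_gt0 := @num_blocks_gt0 _ _ Pi.
have start := cond_num_blocks_start halpha htheta hPi hk.
have step a N i j := @cond_num_blocks_step _ _ _ _ _ _ _ halpha htheta hPi _ _ hk a N i j.
pose U m w : R := num_new_blocks Pi n m w / m%:R `^ alpha.
have mU m : measurable_fun [set: T] (U m).
  exact: (measurable_KK mK K_le n (n + m)
    (fun i j => (j%:R - i%:R) / m%:R `^ alpha)).
have KS := num_blocksS Pi.
have U0 m w : 0 <= U m w.
  rewrite divr_ge0 ?powR_ge0// subr_ge0 ler_nat.
  by elim: m => [|m IH]; rewrite ?addn0// addnS KS (leq_trans IH)// leq_addr.
have [Z [Z0 UZ]] := measurable_ae_limit mU U0
  (ae_cvg_new_species halpha htheta hk mK (measurable_new_block Pi) KS K_le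
    K_gt0 start step).
(* [Z] comes from the chain alone and is fixed before [f], which enters only through the law
   [nu]. *)
exists Z; split => // f hf A mA.
have [nu [nuE nuM]] := limit_law_exists halpha htheta hk hf.
(* The shifted block count, whose rising factorials have explicit expectations; it differs from the
   number of new species by [y 0], which does not depend on m. *)
pose y m w : R := (K (n + m)%N w)%:R + theta / alpha.
have y0 m w : 0 < y m w.
  apply: (lt_le_trans ta); rewrite lerD2r ler1n; apply: K_gt0.
  by rewrite ltn_addr.
have iy m (h : R -> R) : S.-integrable [set: T] (EFin \o (fun w => h (y m w))).
  exact: (integrable_KK S mK K_le n (n + m)
    (fun _ j => h (j%:R + theta / alpha))).
have ZE : S (Z @^-1` A) = nu [set x | A `|x|].
  refine (@method_of_moments R _ T S
    (fun m w => y m.+1 w / m.+1%:R `^ alpha) Z _ (measurableTypeR R) nu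
    (fun x => `|x|) (limit_moment alpha theta n k) _ _ _ _ _ _ _ _ _ _ _ A _) => //.
  - move=> m; exact: (measurable_KK mK K_le n (n + m.+1)
      (fun _ j => (j%:R + theta / alpha) / m.+1%:R `^ alpha)).
  - by move=> m w; rewrite divr_ge0 ?powR_ge0// ltW.
  - move=> m j; exact: (iy m.+1 (fun x => (x / m.+1%:R `^ alpha) ^+ j)).
  - move=> j; apply: cvg_moment => //; first exact: thn.
      by move=> m r s; exact: (iy m (fun x => x ^+ r * rising x s)).
    exact: (expectation_rising halpha htheta hk mK (measurable_new_block Pi) KS
      K_le K_gt0 start step).
  - by move=> t t0; exact: cvg_limit_moment.
  - apply: filterS UZ => w UZ.
    have inv0 : m.+1%:R^-1 `^ alpha @[m --> \oo] --> (0 : R).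
      apply: (@cvg_powR0 _ (fun m => m.+1%:R^-1)) => //.
      exact: cvg_harmonic.
    (* The constant gap [y 0] disappears after division by m^alpha, so the normalized shifted count
       also converges to [Z]. *)
    have h : U m.+1 w + y 0 w * m.+1%:R^-1 `^ alpha @[m --> \oo]
        --> Z w + y 0 w * 0.
      apply: cvgD; last exact: cvgMl_tmp.
      by rewrite (cvg_shiftS (fun m => U m w)).
    move: h; rewrite mulr0 addr0 => h; apply: cvg_trans h.
    apply: near_eq_cvg; apply: nearW => m /=.
    rewrite powR_invl// powRN /U /y /num_new_blocks addn0 -/K -mulrDl.
    by congr (_ * _); rewrite addrA subrK.
  - exact: normr_measurable.
(* The absolute value is harmless, since on ]0, +oo[ it is the identity and [nuE] integrates over
   that set only. *)
rewrite /distribution /pushforward ZE nuE//.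
  congr (integral _ _ _); apply/seteqP; split => z /= [zA];
    rewrite in_itv/= andbT => z0; split=> //.
    by move: zA; rewrite gtr0_norm.
  by rewrite gtr0_norm.
by rewrite -[X in measurable X]setTI; exact: normr_measurable.
Qed.
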